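(* Let $T>0$ and $\mathbf{a}\in\mathbb{R}^d$. For $\eta\in M_G^{2,0}(0,T)$ of the form $\eta_t=\sum_{k=0}^{N-1}\xi_k\mathbf{I}_{[t_k,t_{k+1})}(t)$ define $$I(\eta)=\int_0^T\eta(s)\,dB_s^{\mathbf{a}}:=\sum_{k=0}^{N-1}\xi_k\big(B_{t_{k+1}}^{\mathbf{a}}-B_{t_k}^{\mathbf{a}}\big).$$ Then the linear mapping $I:M_G^{2,0}(0,T)\to L_G^2(\mathcal{H}_T)$ is continuous and thus can be continuously extended to $I:M_G^2(0,T)\to L_G^2(\mathcal{H}_T)$. In fact, for each $\eta\in M_G^{2,0}(0,T)$, $$\mathbb{E}\Big[\int_0^T\eta(s)\,dB_s^{\mathbf{a}}\Big]=0,\qquad \mathbb{E}\Big[\Big(\int_0^T\eta(s)\,dB_s^{\mathbf{a}}\Big)^2\Big]\le\sigma_{\mathbf{a}\mathbf{a}^T}\int_0^T\mathbb{E}[\eta^2(s)]\,ds .$$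
   Context: Fix $d\ge1$ and a nonempty, bounded, closed set $\Gamma\subset\mathbb{R}^{d\times d}$. $\mathbb{S}_d$ is the space of symmetric $d\times d$ real matrices; for $A\in\mathbb{S}_d$, $G(A)=\frac12\sup_{\gamma\in\Gamma}\mathrm{tr}[\gamma\gamma^TA]$ and $\sigma_A=2G(A)$. $lip(\mathbb{R}^m)$ denotes the bounded Lipschitz real functions on $\mathbb{R}^m$. For $\phi\in lip(\mathbb{R}^d)$, $P_t^G(\phi)(x)=u(t,x)$, where $u$ is the unique bounded continuous viscosity solution on $[0,\infty)\times\mathbb{R}^d$ of $\partial_tu-G(D^2u)=0$, $u(0,\cdot)=\phi$; $P_t^G(\phi):=P_t^G(\phi)(0)$. $\Omega$ is the space of continuous paths $\omega:[0,\infty)\to\mathbb{R}^d$ with $\omega_0=0$, and $B_t(\omega)=\omega_t$. $L_{ip}^0(\mathcal{H}_T)$ is the set of random variables $\phi(B_{t_1},\dots,B_{t_m})$ with $m\ge1$, $t_i\in[0,T]$, $\phi\in lip(\mathbb{R}^{d\times m})$, and $L_{ip}^0(\mathcal{H})=\bigcup_{N\ge 1}L_{ip}^0(\mathcal{H}_N)$. The $G$-expectation $\mathbb{E}$ is the functional on $L_{ip}^0(\mathcal{H})$ determined by: $\mathbb{E}[\psi(B_{t+s}-B_s)]=\mathbb{E}[\psi(B_t)]=P_t^G(\psi)$ for $\psi\in lip(\mathbb{R}^d)$; and, for $0\le t_1<\dots<t_m$, $\mathbb{E}[\phi(B_{t_1},\dots,B_{t_m})]=\mathbb{E}[\phi_1(B_{t_1},\dots,B_{t_{m-1}})]$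 with $\phi_1(x^1,\dots,x^{m-1})=\mathbb{E}[\phi(x^1,\dots,x^{m-1},B_{t_m}-B_{t_{m-1}}+x^{m-1})]$. It is a sublinear expectation (monotone, constant-preserving, $\mathbb{E}[X]-\mathbb{E}[Y]\le\mathbb{E}[X-Y]$, positively homogeneous, $\mathbb{E}[X+c]=\mathbb{E}[X]+c$). $L_G^1(\mathcal{H}_T)$, $L_G^1(\mathcal{H})$ are the completions of $L_{ip}^0(\mathcal{H}_T)$, $L_{ip}^0(\mathcal{H})$ under $\|X\|=\mathbb{E}[|X|]$ (elements at norm-distance $0$ identified); $\mathbb{E}$ extends continuously. $L_G^p=\{X\in L_G^1:|X|^p\in L_G^1\}$ with norm $\mathbb{E}[|X|^p]^{1/p}$. Elements of the completions are treated as random variables, operations on them being extended by limits from $L_{ip}^0$. $M_G^{2,0}(0,T)$: simple processes $\eta_t=\sum_{k=0}^{N-1}\xi_k\mathbf{I}_{[t_k,t_{k+1})}(t)$ with $0=t_0<\dots<t_N=T$ and $\xi_k\in L_G^2(\mathcal{H}_{t_k})$. $M_G^2(0,T)$ is its completion under the norm $\big(\frac1T\int_0^T\mathbb{E}[|\eta_t|^2]dt\big)^{1/2}$. $B^{\mathbf{a}}_t=(\mathbf{a},B_t)$ (scalar product). *)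

(* Defs.v *)
(* MathComp / MathComp-Analysis; R is an arbitrary realType. *)
From HB Require Import structures.
From mathcomp Require Import all_boot all_order all_algebra.
From mathcomp Require Import all_classical all_reals all_analysis.

Set Implicit Arguments.
Unset Strict Implicit.
Unset Printing Implicit Defensive.

Import Order.TTheory GRing.Theory Num.Theory.
Import numFieldNormedType.Exports.

Local Open Scope classical_set_scope.
Local Open Scope ring_scope.

Definition lip (R : realType) (V : normedModType R) (f : V -> R) : Prop :=
  (exists M : R, forall x, `|f x| <= M) /\
  (exists K : R, forall x y, `|f x - f y| <= K * `|x - y|).

(* Used at symmetric matrices only. *)
Definition G (R : realType) (d : nat) (Gam : set 'M[R]_d) (A : 'M[R]_d) : R :=
  2^-1 * sup [set \tr (g *m g^T *m A) | g in Gam].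

Definition sigma (R : realType) (d : nat) (Gam : set 'M[R]_d) (A : 'M[R]_d) : R :=
  2 * G Gam A.

Definition Dt (R : realType) (d : nat) (psi : R -> 'cV[R]_d -> R)
    (t : R) (x : 'cV[R]_d) : R :=
  derive1 (fun s => psi s x) t.

Definition Dx (R : realType) (d : nat) (psi : R -> 'cV[R]_d -> R) (i : 'I_d)
    (t : R) (x : 'cV[R]_d) : R :=
  'D_(delta_mx i 0) (psi t) x.

Definition Dxx (R : realType) (d : nat) (psi : R -> 'cV[R]_d -> R)
    (t : R) (x : 'cV[R]_d) : 'M[R]_d :=
  \matrix_(i, j) Dx (Dx psi i) j t x.

(* Class C^{1,2} on the open set ]0, oo[ x R^d. *)
Definition C12 (R : realType) (d : nat) (psi : R -> 'cV[R]_d -> R) : Prop :=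
  (forall t x, 0 < t ->
     [/\ derivable (fun s => psi s x) t 1,
         forall i, derivable (psi t) x (delta_mx i 0) &
         forall i j, derivable (Dx psi i t) x (delta_mx j 0)]) /\
  (forall z : R * 'cV[R]_d, 0 < z.1 ->
     [/\ {for z, continuous (fun y : R * 'cV[R]_d => psi y.1 y.2)},
         {for z, continuous (fun y : R * 'cV[R]_d => Dt psi y.1 y.2)},
         forall i, {for z, continuous (fun y : R * 'cV[R]_d => Dx psi i y.1 y.2)} &
         {for z, continuous (fun y : R * 'cV[R]_d => Dxx psi y.1 y.2)}]).

Definition viscosity_subsolution (R : realType) (d : nat) (Gam : set 'M[R]_d)
    (u : R -> 'cV[R]_d -> R) : Prop :=
  forall (psi : R -> 'cV[R]_d -> R) (t : R) (x : 'cV[R]_d),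
    C12 psi -> 0 < t ->
    (\forall y \near (t, x), u y.1 y.2 - psi y.1 y.2 <= u t x - psi t x) ->
    Dt psi t x - G Gam (Dxx psi t x) <= 0.

Definition viscosity_supersolution (R : realType) (d : nat) (Gam : set 'M[R]_d)
    (u : R -> 'cV[R]_d -> R) : Prop :=
  forall (psi : R -> 'cV[R]_d -> R) (t : R) (x : 'cV[R]_d),
    C12 psi -> 0 < t ->
    (\forall y \near (t, x), u t x - psi t x <= u y.1 y.2 - psi y.1 y.2) ->
    0 <= Dt psi t x - G Gam (Dxx psi t x).

(* u is the bounded continuous viscosity solution on [0, oo[ x R^d of
   d_t u - G(D^2 u) = 0, u(0, .) = phi (unique by the classical theory), i.e.
   u t x = P_t^G(phi)(x); test functions touch locally, and the values
   of u at negative times are irrelevant. *)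
Definition is_PG (R : realType) (d : nat) (Gam : set 'M[R]_d)
    (phi : 'cV[R]_d -> R) (u : R -> 'cV[R]_d -> R) : Prop :=
  [/\ exists M : R, forall t x, 0 <= t -> `|u t x| <= M,
      {within [set z : R * 'cV[R]_d | 0 <= z.1],
        continuous (fun z : R * 'cV[R]_d => u z.1 z.2)},
      viscosity_subsolution Gam u,
      viscosity_supersolution Gam u &
      forall x, u 0 x = phi x].

(* A continuous path on [0, oo[ starting at 0, encoded by its extension to R by
   0 on the negative half-line (which is continuous). *)
Definition Omega (R : realType) (d : nat) : Type :=
  {w : R -> 'cV[R]_d | continuous w /\ forall t, t <= 0 -> w t = 0}.

Definition B (R : realType) (d : nat) (t : R) (w : Omega R d) : 'cV[R]_d :=
  proj1_sig w t.

Definition Bmx (R : realType) (d m : nat) (t : 'I_m -> R) (w : Omega R d) :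
    'M[R]_(d, m) :=
  \matrix_(i, j) B (t j) w i 0.

Definition Lip0_le (R : realType) (d : nat) (T : R) : set (Omega R d -> R) :=
  [set X | exists (m : nat) (t : 'I_m -> R) (phi : 'M[R]_(d, m) -> R),
    [/\ (0 < m)%N, forall j, 0 <= t j <= T, lip phi &
        X = (fun w => phi (Bmx t w))]].

Definition Lip0 (R : realType) (d : nat) : set (Omega R d -> R) :=
  [set X | exists2 N : nat, (0 < N)%N & Lip0_le N%:R X].

Definition sublinear_expectation (R : realType) (W : Type) (H : set (W -> R))
    (E : (W -> R) -> R) : Prop :=
  [/\ forall X Y, H X -> H Y -> (forall w, Y w <= X w) -> E Y <= E X,
      forall c : R, E (fun=> c) = c,
      forall X Y, H X -> H Y -> E X - E Y <= E (fun w => X w - Y w),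
      forall (l : R) X, H X -> 0 <= l -> E (fun w => l * X w) = l * E X &
      forall X (c : R), H X -> E (fun w => X w + c) = E X + c].

(* E is the G-expectation on Lip0; its values outside Lip0 are unconstrained.
   In the last clause the times are t 0 < ... < t m.+1. *)
Record G_expectation (R : realType) (d : nat) (Gam : set 'M[R]_d)
    (E : (Omega R d -> R) -> R) : Prop := {
  Gexp_sublinear : sublinear_expectation (@Lip0 R d) E;
  Gexp_increment : forall psi : 'cV[R]_d -> R, lip psi ->
    exists2 u, is_PG Gam psi u &
      forall s t : R, 0 <= s -> 0 <= t ->
        E (fun w => psi (B (t + s) w - B s w)) = u t 0 /\
        E (fun w => psi (B t w)) = u t 0;
  Gexp_step : forall (m : nat) (t : nat -> R) (phi : 'M[R]_(d, m.+1 + 1) -> R),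
    lip phi -> 0 <= t 0 -> (forall k, (k <= m)%N -> t k < t k.+1) ->
    let phi1 (x : 'M[R]_(d, m.+1)) :=
      E (fun w => phi (row_mx x (B (t m.+1) w - B (t m) w + col ord_max x))) in
    E (fun w => phi (Bmx (fun k : 'I_(m.+1 + 1) => t k) w)) =
    E (fun w => phi1 (Bmx (fun k : 'I_m.+1 => t k) w)) }.

(* (L, iota) is a completion of the linear space S for the seminorm nS:
   elements at nS-distance 0 are identified by iota. *)
Record is_completion (R : realType) (V : lmodType R) (S : set V) (nS : V -> R)
    (L : completeNormedModType R) (iota : V -> L) : Prop := {
  completion_linear : forall (c : R) x y, S x -> S y ->
    iota (c *: x + y) = c *: iota x + iota y;
  completion_isometry : forall x, S x -> `|iota x| = nS x;
  completion_dense : closure (iota @` S) = setT }.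

(* In what follows (L1, iota) is a completion of Lip0 for E[|.|], i.e. L1 is
   L_G^1(H). *)

(* The completion of Lip0_le T, realized inside that of Lip0. *)
Definition LG1_le (R : realType) (d : nat) (L1 : completeNormedModType R)
    (iota : (Omega R d -> R) -> L1) (T : R) : set L1 :=
  closure (iota @` Lip0_le T).

(* The continuous extension of E to L1. *)
Definition EL (R : realType) (d : nat) (E : (Omega R d -> R) -> R)
    (L1 : completeNormedModType R) (iota : (Omega R d -> R) -> L1) (Z : L1) : R :=
  xget 0 [set r : R | exists X : nat -> Omega R d -> R,
    [/\ forall n, Lip0 (X n), iota (X n) @[n --> \oo] --> Z &
        E (X n) @[n --> \oo] --> r]].

(* Nonlinear operations on L1 are the closures, in L1, of the graphs of the
   pointwise operations on Lip0. *)
Definition is_sq (R : realType) (d : nat) (L1 : completeNormedModType R)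
    (iota : (Omega R d -> R) -> L1) (X Z : L1) : Prop :=
  exists Xn : nat -> Omega R d -> R,
    [/\ forall n, Lip0 (Xn n), iota (Xn n) @[n --> \oo] --> X &
        iota (fun w => `|Xn n w| ^+ 2) @[n --> \oo] --> Z].

Definition is_mul (R : realType) (d : nat) (L1 : completeNormedModType R)
    (iota : (Omega R d -> R) -> L1) (X Y Z : L1) : Prop :=
  exists Xn Yn : nat -> Omega R d -> R,
    [/\ forall n, Lip0 (Xn n) /\ Lip0 (Yn n),
        iota (Xn n) @[n --> \oo] --> X, iota (Yn n) @[n --> \oo] --> Y &
        iota (fun w => Xn n w * Yn n w) @[n --> \oo] --> Z].

Definition sqL (R : realType) (d : nat) (L1 : completeNormedModType R)
    (iota : (Omega R d -> R) -> L1) (X : L1) : L1 :=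
  xget 0 [set Z | is_sq iota X Z].

Definition mulL (R : realType) (d : nat) (L1 : completeNormedModType R)
    (iota : (Omega R d -> R) -> L1) (X Y : L1) : L1 :=
  xget 0 [set Z | is_mul iota X Y Z].

Definition LG2_le (R : realType) (d : nat) (L1 : completeNormedModType R)
    (iota : (Omega R d -> R) -> L1) (T : R) : set L1 :=
  [set X | LG1_le iota T X /\ exists2 Z, LG1_le iota T Z & is_sq iota X Z].

Definition LG2_norm (R : realType) (d : nat) (E : (Omega R d -> R) -> R)
    (L1 : completeNormedModType R) (iota : (Omega R d -> R) -> L1) (X : L1) : R :=
  Num.sqrt (EL E iota (sqL iota X)).

(* B^a_t = (a, B_t) is unbounded, hence not in Lip0: as an element of L1 it is
   the limit of its truncations at levels -n and n. *)
Definition Ba (R : realType) (d : nat) (L1 : completeNormedModType R)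
    (iota : (Omega R d -> R) -> L1) (a : 'cV[R]_d) (t : R) : L1 :=
  lim (iota (fun w : Omega R d =>
    Num.max (- n%:R) (Num.min n%:R (\sum_(i < d) a i 0 * B t w i 0)))
    @[n --> \oo]).

Definition simple_rep (R : realType) (d : nat) (L1 : completeNormedModType R)
    (iota : (Omega R d -> R) -> L1) (T : R)
    (N : nat) (t : nat -> R) (xi : nat -> L1) (eta : R -> L1) : Prop :=
  [/\ t 0 = 0, t N = T, forall k, (k < N)%N -> t k < t k.+1,
      forall k, (k < N)%N -> LG2_le iota (t k) (xi k) &
      eta = (fun s => \sum_(k < N) \1_(`[t k, t k.+1[ : set R) s *: xi k)].

Definition MG20 (R : realType) (d : nat) (L1 : completeNormedModType R)
    (iota : (Omega R d -> R) -> L1) (T : R) : set (R -> L1) :=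
  [set eta | exists (N : nat) (t : nat -> R) (xi : nat -> L1),
    simple_rep iota T N t xi eta].

Definition int_E_sq (R : realType) (d : nat) (E : (Omega R d -> R) -> R)
    (L1 : completeNormedModType R) (iota : (Omega R d -> R) -> L1) (T : R)
    (eta : R -> L1) : R :=
  \int[lebesgue_measure]_(s in `[0, T]) EL E iota (sqL iota (eta s)).

Definition MG2_norm (R : realType) (d : nat) (E : (Omega R d -> R) -> R)
    (L1 : completeNormedModType R) (iota : (Omega R d -> R) -> L1) (T : R)
    (eta : R -> L1) : R :=
  Num.sqrt (T^-1 * int_E_sq E iota T eta).

Definition ito_sum (R : realType) (d : nat) (L1 : completeNormedModType R)
    (iota : (Omega R d -> R) -> L1) (a : 'cV[R]_d)
    (N : nat) (t : nat -> R) (xi : nat -> L1) : L1 :=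
  \sum_(k < N) mulL iota (xi k) (Ba iota a (t k.+1) - Ba iota a (t k)).

Definition ito (R : realType) (d : nat) (L1 : completeNormedModType R)
    (iota : (Omega R d -> R) -> L1) (a : 'cV[R]_d) (T : R) (eta : R -> L1) : L1 :=
  xget 0 [set Z | exists (N : nat) (t : nat -> R) (xi : nat -> L1),
    simple_rep iota T N t xi eta /\ Z = ito_sum iota a N t xi].

Definition linear_on (R : realType) (V W : lmodType R) (S : set V)
    (f : V -> W) : Prop :=
  forall (c : R) x y, S x -> S y -> f (c *: x + y) = c *: f x + f y.

Definition seminorm_continuous_on (R : realType) (V W : lmodType R) (S : set V)
    (nV : V -> R) (nW : W -> R) (f : V -> W) : Prop :=
  forall x, S x -> forall e : R, 0 < e -> exists2 r : R, 0 < r &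
    forall y, S y -> nV (y - x) < r -> nW (f y - f x) < e.

(* Main.v *)
(* Only polynomial test functions are needed from the viscosity theory: comparing a
   bounded subsolution with b y + e y^2 + g y^4 (y = (a, x)) evolved by the linear heat
   equation of rate s = sigma_{aa^T} bounds truncations of an increment D of B^a over
   time h: E[D^2] <= s h, E[c D] <= o(1) for every real c, and E[D^4] <= 3 s^2 h^2.  The
   last bound makes the truncations Cauchy in L2, the second one makes the cross terms
   vanish: if X depends on the path up to the left end point, then by independence
   E[X D] = 0 and E[X^2 D^2] <= s h E[X^2].  Expanding the square of the partial sums one
   step at a time gives both assertions for simple processes.

   Products and squares in the completion are well defined because an L1-convergent
   sequence of bounded variables is uniformly integrable, so that its limit is determined
   by convergence in capacity, for which multiplication is continuous. *)
Require Import Defs.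
From HB Require Import structures.
From mathcomp Require Import all_boot all_order all_algebra.
From mathcomp Require Import all_classical all_reals all_analysis.
From mathcomp Require Import measurable_realfun ring lra.

Set Implicit Arguments.
Unset Strict Implicit.
Unset Printing Implicit Defensive.

Import Order.TTheory GRing.Theory Num.Theory.
Import numFieldNormedType.Exports.

Local Open Scope classical_set_scope.
Local Open Scope ring_scope.

(** * Quartic barriers for the G-heat equation *)

(** [E] is only sublinear: E[-X] differs from -E[X], so a mean is shown to vanish by upper bounds
    for both signs. Moreover [G] acts as the linear rate sigma_{aa^T} / 2 only on nonnegative
    multiples of a a^T, so every barrier must be convex in y = (a, x). For a truncated increment
    times c, of either sign, the majorant is c y + (|c| / n) y^2: the quadratic term pays for the
    truncation, keeps the barrier bounded below, and costs only O(1 / n). The barrier is smooth,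
    hence is itself the test function and no doubling of variables occurs. The penalty k |x|^2 + l t
    makes the maximum of u minus the barrier attained on all of [0, oo[, with no terminal time; l
    exceeds what k |x|^2 adds to [G], so a maximum at a positive time contradicts the subsolution
    inequality. [E] is controlled on bounded cylinder variables only. Each element of L_G^2 is
    therefore handled through a sequence of such variables that is Cauchy in mean square: estimates
    are proved along the sequence and then passed to the limit. *)

Lemma cvg_sumr (K : numFieldType) (V : normedModType K) (I T : Type) (r : seq I)
    (F : set_system T) (FF : Filter F) (f : I -> T -> V) (l : I -> V) :
  (forall i, f i x @[x --> F] --> l i) ->
  (\sum_(i <- r) f i x) @[x --> F] --> \sum_(i <- r) l i.
Proof.
move=> fl; elim: r => [|i r IH].
  by rewrite big_nil; under eq_cvg do rewrite big_nil; exact: cvg_cst.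
by rewrite big_cons; under eq_cvg do rewrite big_cons; exact: cvgD.
Qed.

Section Dot.
Variables (R : realType) (d : nat).
Implicit Types a x : 'cV[R]_d.

Definition dot a x : R := \sum_(i < d) a i 0 * x i 0.

Lemma dotDr a x y : dot a (x + y) = dot a x + dot a y.
Proof. by rewrite -big_split /=; apply: eq_bigr => i _; rewrite mxE mulrDr. Qed.

Lemma dotZr a c x : dot a (c *: x) = c * dot a x.
Proof. by rewrite mulr_sumr; apply: eq_bigr => i _; rewrite mxE mulrCA. Qed.

Lemma dotNr a x : dot a (- x) = - dot a x.
Proof. by rewrite -scaleN1r dotZr mulN1r. Qed.

Lemma dotBr a x y : dot a (x - y) = dot a x - dot a y.
Proof. by rewrite dotDr dotNr. Qed.

Lemma dot0r a : dot a 0 = 0.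
Proof. by rewrite -(scale0r 0) dotZr mul0r. Qed.

Lemma dot_delta a i : dot a (delta_mx i 0) = a i 0.
Proof.
rewrite /dot (bigD1 i) //= mxE !eqxx mulr1 big1 ?addr0 // => j /negPf ji.
by rewrite mxE ji mulr0.
Qed.

Lemma coord_le_norm m n (x : 'M[R]_(m, n)) i j : `|x i j| <= `|x|.
Proof.
rewrite [leRHS]/Num.norm /= mx_normrE; apply/bigmax_geP; right => /=.
by exists (i, j).
Qed.

Lemma dot_lip a : exists K : R, 0 <= K /\ forall x, `|dot a x| <= K * `|x|.
Proof.
exists (\sum_(i < d) `|a i 0|); split; first by apply: sumr_ge0.
move=> x; rewrite mulr_suml; apply: le_trans (ler_norm_sum _ _ _) _.
by apply: ler_sum => i _; rewrite normrM ler_wpM2l // coord_le_norm.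
Qed.

Lemma dot_continuous a : continuous (dot a).
Proof.
move=> x; apply: (cvg_sumr (nbhs_filter x)) => i.
have H : (fun y : 'cV[R]_d => y i 0) @ nbhs x --> x i 0 by exact: coord_continuous.
exact: cvgMl_tmp H.
Qed.

Lemma is_derive_linear (V : normedModType R) (f : V -> R) (x v : V) (df : R) :
  (forall h : R, f (h *: v + x) = h * df + f x) -> is_derive x v f df.
Proof.
move=> fE.
have H : h^-1 *: ((f \o shift x) (h *: v) - f x) @[h --> 0^'] --> df.
  apply: cvg_near_cst; near=> h.
  rewrite /= fE addrK /GRing.scale /= mulrA mulVf ?mul1r //.
  by near: h; exact: nbhs_dnbhs_neq.
split; first by apply: cvgP H.
by apply: cvg_lim H.
Unshelve. all: by end_near. Qed.

Lemma is_derive_dot a x v : is_derive x v (dot a) (dot a v).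
Proof. by apply: is_derive_linear => h; rewrite dotDr dotZr. Qed.

Lemma is_derive_sqnorm x v :
  is_derive x v (fun y => dot y y) (2 * dot x v).
Proof.
have H i : is_derive x v (fun y : 'cV[R]_d => y i 0) (v i 0).
  by apply: is_derive_linear => h; rewrite !mxE.
have := is_derive_sum (fun i => is_deriveM (H i) (H i)).
move/is_derive_eq => /(_ (2 * dot x v)).
rewrite (_ : (\sum_(_ < d) _) = (fun y => dot y y)); last first.
  by apply/funext => y; rewrite fct_sumE.
apply; rewrite mulr_sumr; apply: eq_bigr => i _.
by rewrite /GRing.scale /= mulr2n mulrDl mul1r.
Qed.

Lemma dot_ge0 x : 0 <= dot x x.
Proof. by apply: sumr_ge0 => i _; rewrite -expr2 sqr_ge0. Qed.

Lemma sqr_coord_le_dot x i : x i 0 ^+ 2 <= dot x x.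
Proof.
by rewrite /dot (bigD1 i) //= -expr2 lerDl sumr_ge0 // => j _; rewrite -expr2 sqr_ge0.
Qed.

End Dot.

(** * Bounds on [G] and [sigma] *)

Section GBound.
Variables (R : realType) (d : nat) (Gam : set 'M[R]_d).
Hypotheses (Gam_nonempty : Gam !=set0) (Gam_bounded : bounded_set Gam).

Lemma trace_bound (A : 'M[R]_d) :
  exists C : R, forall g, Gam g -> `|\tr (g *m g^T *m A)| <= C.
Proof.
have [M [_ HM]] := Gam_bounded.
pose M1 := `|M| + 1.
have HM1 g : Gam g -> `|g| <= M1.
  by apply: HM; rewrite /M1; apply: le_lt_trans (ler_norm _) _; rewrite ltrDl.
exists (\sum_(i < d) \sum_(j < d) \sum_(k < d) M1 * M1 * `|A j i|) => g Gg.
have C i j : `|g i j| <= M1 by apply: le_trans (coord_le_norm _ _ _) (HM1 _ Gg).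
rewrite /mxtrace; apply: le_trans (ler_norm_sum _ _ _) _; apply: ler_sum => i _.
rewrite mxE; apply: le_trans (ler_norm_sum _ _ _) _; apply: ler_sum => j _.
rewrite mxE mulr_suml; apply: le_trans (ler_norm_sum _ _ _) _.
apply: ler_sum => k _; rewrite !mxE !normrM ler_wpM2r //.
by apply: ler_pM.
Qed.

Lemma trace_has_sup (A : 'M[R]_d) : has_sup [set \tr (g *m g^T *m A) | g in Gam].
Proof.
have [C HC] := trace_bound A; split.
  by have [g Gg] := Gam_nonempty; exists (\tr (g *m g^T *m A)); exists g.
by exists C => _ [g Gg <-]; apply: le_trans (ler_norm _) (HC _ Gg).
Qed.

Lemma sigmaE (A : 'M[R]_d) : sigma Gam A = sup [set \tr (g *m g^T *m A) | g in Gam].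
Proof. by rewrite /sigma /G mulrA divff ?mul1r // pnatr_eq0. Qed.

Lemma trace_le_sigma A g : Gam g -> \tr (g *m g^T *m A) <= sigma Gam A.
Proof.
move=> Gg; rewrite sigmaE; apply: sup_upper_bound; first exact: trace_has_sup.
by exists g.
Qed.

(** For any g in [Gam], tr(g g^T a a^T) = |g^T a|^2. *)
Lemma sigma_ge0 (a : 'cV[R]_d) : 0 <= sigma Gam (a *m a^T).
Proof.
have [g Gg] := Gam_nonempty; apply: le_trans (trace_le_sigma _ Gg).
rewrite mulmxA mxtrace_mulC !mulmxA -mulmxA -[g in a^T *m g]trmxK -trmx_mul.
rewrite trace_mx11 mxE; apply: sumr_ge0 => i _.
by rewrite mxE -expr2 sqr_ge0.
Qed.

(** The matrix has the shape of the Hessian of the barrier: a rank-one part from the polynomial in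
    (a, x) and a multiple of the identity from the penalty k |x|^2. The sign of l matters, since [G]
    is only positively homogeneous. *)
Lemma G_bound : exists2 C : R, 0 <= C & forall (a : 'cV[R]_d) (l e : R),
  0 <= l -> 0 <= e ->
  G Gam (l *: (a *m a^T) + e%:M) <= 2^-1 * (l * sigma Gam (a *m a^T)) + e * C.
Proof.
have [C HC] := trace_bound 1%:M.
have C0 : 0 <= C by have [g Gg] := Gam_nonempty; apply: le_trans (HC g Gg).
exists C => // a l e l0 e0; rewrite /G.
apply: le_trans (_ : 2^-1 * (l * sigma Gam (a *m a^T) + e * C) <= _).
  rewrite ler_wpM2l ?invr_ge0 //; apply: ge_sup.
    by have [] := trace_has_sup (l *: (a *m a^T) + e%:M).
  move=> _ [g Gg <-]; rewrite mulmxDr mxtraceD -scalemxAr mxtraceZ.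
  rewrite lerD ?ler_wpM2l ?trace_le_sigma //.
  rewrite -[e%:M]scalemx1 -scalemxAr mxtraceZ ler_wpM2l //.
  by apply: le_trans (ler_norm _) (HC _ Gg).
have := mulr_ge0 e0 C0; lra.
Qed.

End GBound.

(** Carries the compactness of boxes from row vectors to column vectors in [barrier_maximum]. *)
Lemma trmx_continuous (R : realType) m n : continuous (@trmx R m n).
Proof.
move=> x A [P PN PA]; exists (fun j i => P i j); first by move=> j i; have := PN i j; rewrite mxE.
by move=> y yP; apply: PA => i j; rewrite mxE; exact: yP.
Qed.

(** Covers all derivatives of the barrier: in time (P = S = the time variable), the gradient (P =
    [dot a], S = |x|^2) and the Hessian (P = [dot a], S = a coordinate). *)
Lemma is_derive_quartic (R : realType) (V : normedModType R)
    (c0 c1 c2 c3 c4 k : R) (f P S : V -> R) (x v : V) (df dP dS : R) :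
  is_derive x v P dP -> is_derive x v S dS ->
  (forall y, f y = c0 + c1 * P y + c2 * P y ^+ 2 + c3 * P y ^+ 3 +
                   c4 * P y ^+ 4 + k * S y) ->
  df = (c1 + 2 * c2 * P x + 3 * c3 * P x ^+ 2 + 4 * c4 * P x ^+ 3) * dP + k * dS ->
  is_derive x v f df.
Proof.
move=> HP HS fE ->.
have D (c : R) n : is_derive x v (c *: P ^+ n) (c * (n%:R * P x ^+ n.-1 * dP)).
  exact: is_deriveZ.
have DS : is_derive x v (k *: S) (k * dS) by exact: is_deriveZ.
have K := is_deriveD (is_deriveD (is_deriveD (is_deriveD (is_deriveD
  (is_derive_cst c0 x v) (D c1 1)) (D c2 2)) (D c3 3)) (D c4 4)) DS.
have -> : f = cst c0 + c1 *: P ^+ 1 + c2 *: P ^+ 2 + c3 *: P ^+ 3 + c4 *: P ^+ 4 + k *: S.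
  by apply/funext => y; rewrite fE.
by apply: (is_derive_eq K); rewrite /= expr0 expr1; ring.
Qed.

(** * Comparison of a subsolution with a polynomial barrier *)

Section Comparison.
Variables (R : realType) (d : nat) (Gam : set 'M[R]_d).
Hypotheses (Gam_nonempty : Gam !=set0) (Gam_bounded : bounded_set Gam).
Variable a : 'cV[R]_d.
Local Notation sg := (sigma Gam (a *m a^T)).

(* The classical solution of [d_t w = (s / 2) d_yy w] with initial value
   [b y + e y^2 + g y^4]. *)
Definition quartic_heat (s b e g t y : R) : R :=
  b * y + e * (y ^+ 2 + s * t) +
  g * (y ^+ 4 + 6 * s * t * y ^+ 2 + 3 * s ^+ 2 * t ^+ 2).

Lemma quartic_heat_ge s b e g t y : 0 <= s -> 0 <= e -> 0 <= g -> 0 <= t ->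
  b * y + e * y ^+ 2 <= quartic_heat s b e g t y.
Proof.
move=> s0 e0 g0 t0; rewrite /quartic_heat.
have h1 : 0 <= e * (s * t) by rewrite !mulr_ge0.
have h2 : 0 <= y ^+ 4 by rewrite exprn_even_ge0.
have h3 := mulr_ge0 (mulr_ge0 s0 t0) (sqr_ge0 y).
have h4 := mulr_ge0 (sqr_ge0 s) (sqr_ge0 t).
have := mulr_ge0 g0 h2; have := mulr_ge0 g0 h3; have := mulr_ge0 g0 h4; move: h1; lra.
Qed.

(* For [0 < k] and [l] large compared with [k], a strict supersolution that tends to
   +oo at infinity, so that [u - barrier] attains its maximum for bounded [u]. *)
Definition barrier (b e g k l t : R) (x : 'cV[R]_d) : R :=
  quartic_heat sg b e g t (dot a x) + k * dot x x + l * t.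

Section Barrier.
Variables (b e g k l : R).
Local Notation v := (barrier b e g k l).

(** The first and second derivatives of [quartic_heat] in y. *)
Definition barrier_slope t y := b + 2 * (e + 6 * g * sg * t) * y + 4 * g * y ^+ 3.
Definition barrier_curv t y := 2 * (e + 6 * g * sg * t) + 12 * g * y ^+ 2.

Lemma is_derive_barrier_t (t : R) x :
  is_derive t (1 : R) (v ^~ x)
    (e * sg + g * (6 * sg * dot a x ^+ 2 + 6 * sg ^+ 2 * t) + l).
Proof.
apply: (is_derive_quartic (k := 0)
  (c0 := b * dot a x + e * dot a x ^+ 2 + g * dot a x ^+ 4 + k * dot x x)
  (c1 := e * sg + g * (6 * sg * dot a x ^+ 2) + l) (c2 := g * (3 * sg ^+ 2))
  (c3 := 0) (c4 := 0) (is_derive_id t (1 : R)) (is_derive_id t (1 : R))) => /=.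
- by move=> y; rewrite /barrier /quartic_heat; ring.
- by ring.
Qed.

Lemma is_derive_barrier_x t x (i : 'I_d) :
  is_derive x (delta_mx i 0) (v t)
    (barrier_slope t (dot a x) * a i 0 + 2 * k * x i 0).
Proof.
apply: (is_derive_quartic (k := k)
  (c0 := e * sg * t + g * (3 * sg ^+ 2 * t ^+ 2) + l * t)
  (c1 := b) (c2 := e + 6 * g * sg * t)
  (c3 := 0) (c4 := g) (is_derive_dot a x (delta_mx i 0))
  (is_derive_sqnorm x (delta_mx i 0))) => /=.
- by move=> y; rewrite /barrier /quartic_heat; ring.
- by rewrite !dot_delta /barrier_slope; ring.
Qed.

Lemma Dx_barrier (i : 'I_d) :
  Dx v i = fun t x => barrier_slope t (dot a x) * a i 0 + 2 * k * x i 0.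
Proof.
by apply/funext => t; apply/funext => x; exact: (@derive_val _ _ _ _ _ _ _ (is_derive_barrier_x t x i)).
Qed.

Lemma is_derive_barrier_xx t x (i j : 'I_d) :
  is_derive x (delta_mx j 0) (Dx v i t)
    (barrier_curv t (dot a x) * (a i 0 * a j 0) + 2 * k *+ (i == j)).
Proof.
rewrite Dx_barrier.
have D : is_derive x (delta_mx j 0) (fun y : 'cV[R]_d => y i 0) ((i == j)%:R).
  by apply: is_derive_linear => h; rewrite !mxE eqxx andbT.
apply: (is_derive_quartic (k := 2 * k)
  (c0 := b * a i 0) (c1 := 2 * (e + 6 * g * sg * t) * a i 0) (c2 := 0)
  (c3 := 4 * g * a i 0) (c4 := 0) (is_derive_dot a x (delta_mx j 0)) D) => /=.
- by move=> y; rewrite /barrier_slope; ring.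
- by rewrite !dot_delta /barrier_curv -mulr_natr; ring.
Qed.

Lemma Dxx_barrier t x :
  Dxx v t x = barrier_curv t (dot a x) *: (a *m a^T) + (2 * k)%:M.
Proof.
apply/matrixP => i j; rewrite !mxE big_ord1 mxE.
exact: (@derive_val _ _ _ _ _ _ _ (is_derive_barrier_xx t x i j)).
Qed.

Lemma Dt_barrier t x :
  Dt v t x = e * sg + g * (6 * sg * dot a x ^+ 2 + 6 * sg ^+ 2 * t) + l.
Proof. by rewrite /Dt derive1E; exact: (@derive_val _ _ _ _ _ _ _ (is_derive_barrier_t t x)). Qed.

(** Continuity in the pair, as [C12] asks for it, but with f left curried so that [jointly_tac] can
    match on its body. *)
Let jointly (z : R * 'cV[R]_d) (f : R -> 'cV[R]_d -> R) : Prop :=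
  (fun y => f y.1 y.2) @ nbhs z --> f z.1 z.2.

Let jointlyC z c : jointly z (fun _ _ => c).
Proof. exact: cvg_cst. Qed.

Let jointlyD z f h : jointly z f -> jointly z h -> jointly z (fun t x => f t x + h t x).
Proof. exact: cvgD. Qed.

Let jointlyM z f h : jointly z f -> jointly z h -> jointly z (fun t x => f t x * h t x).
Proof. exact: cvgM. Qed.

Let jointlyX z f n : jointly z f -> jointly z (fun t x => f t x ^+ n).
Proof.
move=> zf; elim: n => [|n IH]; first exact: jointlyC.
rewrite (_ : (fun t x => _) = (fun t x => f t x * f t x ^+ n)).
  exact: jointlyM.
by apply/funext => t; apply/funext => x; rewrite exprS.
Qed.

Let jointly_t z : jointly z (fun t _ => t).
Proof. exact: cvg_fst. Qed.

Let jointly_dot z : jointly z (fun _ x => dot a x).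
Proof. by apply: (cvg_comp _ _ cvg_snd); exact: dot_continuous. Qed.

Let jointly_coord z i : jointly z (fun _ x => x i 0).
Proof. by apply: (cvg_comp _ _ cvg_snd); exact: coord_continuous. Qed.

Let jointly_sqnorm z : jointly z (fun _ x => dot x x).
Proof.
have H i : jointly z (fun _ x => x i 0 * x i 0).
  by apply: (@jointlyM _ (fun _ x => x i 0) (fun _ x => x i 0)); exact: jointly_coord.
exact: (cvg_sumr (nbhs_filter z) H).
Qed.

Ltac jointly_tac := repeat lazymatch goal with
  | |- context [fun t x => _ + _] => apply: jointlyD
  | |- context [fun t x => _ * _] => apply: jointlyM
  | |- context [fun t x => _ ^+ _] => apply: jointlyX
  | |- context [fun t x => fun_of_matrix x _ _] => exact: jointly_coord
  | |- context [fun t x => dot x x] => exact: jointly_sqnorm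
  | |- context [fun t x => dot _ x] => exact: jointly_dot
  | |- context [fun t x => t] => exact: jointly_t
  | |- _ => exact: jointlyC
  end.

Lemma barrier_continuous z : jointly z v.
Proof. rewrite /barrier /quartic_heat; jointly_tac. Qed.

Lemma barrier_C12 : C12 v.
Proof.
split=> [t x _|z _].
  split=> [|i|i j].
  - by have := is_derive_barrier_t t x => -[].
  - by have := is_derive_barrier_x t x i => -[].
  - by have := is_derive_barrier_xx t x i j => -[].
split; first exact: barrier_continuous.
- suff : jointly z (fun t x => e * sg + g * (6 * sg * dot a x ^+ 2 + 6 * sg ^+ 2 * t) + l).
    rewrite /jointly -Dt_barrier; under eq_cvg do rewrite -Dt_barrier; exact.
  jointly_tac.
- move=> i.
  suff : jointly z (fun t x => barrier_slope t (dot a x) * a i 0 + 2 * k * x i 0).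
    by rewrite Dx_barrier.
  rewrite /barrier_slope; jointly_tac.
have H : jointly z (fun t x => barrier_curv t (dot a x)).
  rewrite /barrier_curv; jointly_tac.
rewrite (_ : (fun y => _) = (fun y : R * 'cV[R]_d =>
  barrier_curv y.1 (dot a y.2) *: (a *m a^T) + (2 * k)%:M)); last first.
  by apply/funext => y; rewrite Dxx_barrier.
by apply: cvgD; [exact: cvgZr_tmp|exact: cvg_cst].
Qed.

End Barrier.

Lemma barrier_maximum (b e g k l C M : R) (u : R -> 'cV[R]_d -> R) (t0 : R) (x0 : 'cV[R]_d) :
  0 <= e -> 0 <= g -> 0 < k -> 0 < l -> 0 <= t0 ->
  (forall y, - C <= b * y + e * y ^+ 2) ->
  (forall t x, 0 <= t -> `|u t x| <= M) ->
  {within [set z : R * 'cV[R]_d | 0 <= z.1],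
        continuous (fun z : R * 'cV[R]_d => u z.1 z.2)} ->
  exists t x, 0 <= t /\ forall s y, 0 <= s ->
    u s y - barrier b e g k l s y <= u t x - barrier b e g k l t x.
Proof.
move=> e0 g0 k0 l0 t00 HC HM uc.
have sg0 : 0 <= sg by exact: sigma_ge0.
pose h (z : R * 'cV[R]_d) := u z.1 z.2 - barrier b e g k l z.1 z.2.
have vlow t x : 0 <= t -> - C + k * dot x x + l * t <= barrier b e g k l t x.
  move=> t_ge0; rewrite /barrier lerD2r lerD2r.
  apply: le_trans (HC (dot a x)) _.
  exact: quartic_heat_ge.
pose m := h (t0, x0).
pose B0 := `|M + C - m| + 1.
have B00 : 0 < B0 by rewrite /B0 ltr_wpDl.
(* Outside the box either l t or k |x|^2 is at least B0 > M + C - m, so u minus the barrier drops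
   below its value m at (t0, x0). The summand 1 in r ensures r <= x_i^2 as soon as r < |x_i|. *)
pose r := 1 + B0 / k + B0 / l.
have r1 : 1 <= r by rewrite /r -addrA lerDl addr_ge0 // divr_ge0 // ltW.
pose K := [set z : R * 'cV[R]_d | 0 <= z.1 <= r /\ forall i, `|z.2 i 0| <= r].
have far t x : 0 <= t -> ~ K (t, x) -> h (t, x) < m.
  move=> t_ge0 nK.
  have : M + C - m < k * dot x x + l * t.
    apply: le_lt_trans (ler_norm _) _.
    apply: lt_le_trans (_ : B0 <= _); first by rewrite /B0 ltrDl.
    have kd : 0 <= k * dot x x by rewrite mulr_ge0 ?dot_ge0 // ltW.
    have lt : 0 <= l * t by rewrite mulr_ge0 // ltW.
    have [tr|tr] := leP t r.
      have [i xi] : exists i, r < `|x i 0|.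
        apply/not_existsP => H; apply: nK; split; first by rewrite /= t_ge0.
        by move=> i; rewrite leNgt; apply/negP; apply: H.
      apply: le_trans (_ : k * dot x x <= _); last by rewrite lerDl.
      rewrite -ler_pdivrMl // mulrC.
      apply: le_trans (_ : r <= _).
        by rewrite /r -addrA addrCA lerDl addr_ge0 // divr_ge0 // ltW.
      apply: le_trans (sqr_coord_le_dot x i).
      rewrite -real_normK ?num_real //.
      apply: le_trans (ltW xi) _; rewrite expr2 ler_peMl //.
      by rewrite (le_trans r1) // ltW.
    apply: le_trans (_ : l * t <= _); last by rewrite lerDr.
    rewrite -ler_pdivrMl // mulrC; apply: le_trans (ltW tr).
    by rewrite /r lerDr addr_ge0 // divr_ge0 // ltW.
  have := vlow t x t_ge0.
  have := HM t x t_ge0; rewrite ler_norml => /andP[_].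
  rewrite /h /=; lra.
have Kt0 : K (t0, x0) by apply: contrapT => nK; have := far _ _ t00 nK; rewrite ltxx.
have cK : compact K.
  have c1 : compact [set x : 'cV[R]_d | forall i, `|x i 0| <= r].
    have c2 : compact [set x : 'rV[R]_d | forall i, `[- r, r]%classic (x ord0 i)].
      by apply: (@rV_compact R d (fun=> `[- r, r]%classic)) => _; exact: segment_compact.
    have := continuous_compact (continuous_subspaceT (@trmx_continuous R 1 d)) c2.
    congr compact; apply/seteqP; split => [_ [x xr <-] i|x xr].
      by have := xr i; rewrite mxE /= in_itv /= ler_norml.
    exists x^T; last by rewrite trmxK.
    by move=> i; rewrite /= mxE in_itv /= -ler_norml.
  have := compact_setX (@segment_compact R 0 r) c1.
  by congr compact; apply/seteqP; split => z; rewrite /= in_itv.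
have hc : {within K, continuous h}.
  have sK : K `<=` [set z | 0 <= z.1] by move=> z [/andP[]].
  apply: (continuous_subspaceW sK) => z.
  apply: cvgB; first exact: uc.
  apply: (continuous_subspaceT (f := fun z => barrier b e g k l z.1 z.2)).
  by move=> y; exact: barrier_continuous.
have [z zK zmax] := compact_EVT_max (ex_intro _ _ Kt0) cK hc.
exists z.1, z.2; split; first by move: zK; rewrite inE => -[/andP[]].
move=> s y s0.
have [Ks|nKs] := pselect (K (s, y)).
  by apply: (zmax (s, y)); rewrite inE.
apply: ltW; apply: lt_le_trans (far _ _ s0 nKs) _.
by apply: zmax; rewrite inE.
Qed.

Lemma heat_comparison (b e g C : R) phi u (t : R) :
  0 <= e -> 0 <= g -> (forall y, - C <= b * y + e * y ^+ 2) ->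
  (forall x, phi x <= b * dot a x + e * dot a x ^+ 2 + g * dot a x ^+ 4) ->
  is_PG Gam phi u -> 0 <= t ->
  u t 0 <= e * (sg * t) + g * (3 * sg ^+ 2 * t ^+ 2).
Proof.
move=> e0 g0 HC Hphi [[M HM] uc usub _ u0] t0.
have [D D0 HD] := G_bound Gam_nonempty Gam_bounded.
have sg0 : 0 <= sg by exact: sigma_ge0.
(* The Hessian 2k of the penalty contributes at most 2 k D to [G]; the slope l exceeds this by k,
   which makes the barrier a strict supersolution. *)
have main k : 0 < k -> u t 0 <= barrier b e g k (2 * k * D + k) t 0.
  move=> k0; have l0 : 0 < 2 * k * D + k.
    by rewrite ltr_wpDl // mulr_ge0 // mulr_ge0 // ltW.
  have [s [y [s0 smax]]] := barrier_maximum 0 e0 g0 k0 l0 t0 HC HM uc.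
  (* At a maximum at time 0 the initial condition already gives u <= barrier there, hence
     everywhere. *)
  have [s_eq0|s_neq0] := eqVneq s 0.
    have := smax t 0 t0; rewrite s_eq0 u0 -subr_le0.
    suff : phi y <= barrier b e g k (2 * k * D + k) 0 y by lra.
    apply: le_trans (Hphi y) _; rewrite /barrier /quartic_heat.
    by have := mulr_ge0 (ltW k0) (dot_ge0 y); lra.
  have s_gt0 : 0 < s by rewrite lt_neqAle eq_sym s_neq0.
  have := usub (barrier b e g k (2 * k * D + k)) s y (barrier_C12 _ _ _ _ _) s_gt0.
  have near_max : \forall z \near (s, y),
      u z.1 z.2 - barrier b e g k (2 * k * D + k) z.1 z.2 <=
      u s y - barrier b e g k (2 * k * D + k) s y.
    have pos : \forall z \near (s, y), 0 < z.1.
      have H : nbhs s [set r | 0 < r] by exact: lt_nbhsr.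
      exact: (@cvg_fst _ _ (nbhs s) (nbhs y) _ _ H).
    by near=> z; apply: smax; apply: ltW; near: z; exact: pos.
  (* The time derivative minus sigma / 2 times the curvature is exactly l. The subsolution
     inequality thus gives l <= 2 k D, which is absurd. *)
  move=> /(_ near_max); rewrite Dt_barrier Dxx_barrier.
  have c0 : 0 <= barrier_curv e g s (dot a y).
    rewrite /barrier_curv.
    have h1 := mulr_ge0 (mulr_ge0 g0 sg0) s0.
    have h2 := mulr_ge0 g0 (sqr_ge0 (dot a y)).
    by move: e0 h1 h2; lra.
  have k2 : 0 <= 2 * k by move: k0; lra.
  have := HD a _ _ c0 k2; rewrite /barrier_curv; move: k0.
  set G1 := G _ _; set sg' := sg; lra.
rewrite -[leRHS]addr0; apply/ler_addgt0Pr => _/posnumP[r].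
(* At x = 0 the penalty is only l t = k (2D + 1) t, which stays below r for this k. *)
pose k := r%:num / ((2 * D + 1) * t + 1).
have den0 : 0 < (2 * D + 1) * t + 1.
  by rewrite ltr_wpDl // mulr_ge0 // addr_ge0 // mulr_ge0.
apply: le_trans (main k _) _; first by rewrite divr_gt0.
rewrite /barrier /quartic_heat !dot0r.
have -> : (2 * k * D + k) * t = k * ((2 * D + 1) * t + 1) - k by ring.
rewrite /k divfK ?gt_eqF //.
have : 0 < r%:num / ((2 * D + 1) * t + 1) by rewrite divr_gt0.
by rewrite !expr0n /=; lra.
Unshelve. all: by end_near. Qed.

End Comparison.

(** * Bounded Lipschitz cylinder variables *)

Section LocallyLipschitz.
Variable R : realType.
Implicit Types F : R -> R -> R.

(** A Lipschitz bound on bounded sets suffices because F is only composed with bounded functions;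
    this admits products. *)
Definition locally_lip2 F := forall M : R, 0 <= M -> exists2 K : R, 0 <= K &
  forall x y x' y', `|x| <= M -> `|y| <= M -> `|x'| <= M -> `|y'| <= M ->
    `|F x y - F x' y'| <= K * (`|x - x'| + `|y - y'|).

Lemma locally_lip2_add : locally_lip2 (fun x y => x + y).
Proof.
move=> M _; exists 1 => // x y x' y' _ _ _ _.
by rewrite mul1r opprD addrACA ler_normD.
Qed.

Lemma locally_lip2_sub : locally_lip2 (fun x y => x - y).
Proof.
move=> M _; exists 1 => // x y x' y' _ _ _ _.
by rewrite mul1r opprD addrACA (le_trans (ler_normD _ _)) // -opprD normrN.
Qed.

Lemma locally_lip2_mul : locally_lip2 (fun x y => x * y).
Proof.
move=> M M0; exists M => // x y x' y' xM yM x'M y'M.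
have -> : x * y - x' * y' = (x - x') * y + x' * (y - y') by ring.
apply: le_trans (ler_normD _ _) _; rewrite !normrM mulrDr.
by rewrite mulrC lerD // ler_wpM2r.
Qed.

Lemma locally_lip2_fst (f : R -> R) : (forall x y, `|f x - f y| <= `|x - y|) ->
  locally_lip2 (fun x _ => f x).
Proof.
move=> fl M _; exists 1 => // x y x' y' _ _ _ _.
by rewrite mul1r (le_trans (fl _ _)) // lerDl.
Qed.

Definition trunc (c y : R) : R := Num.max (- c) (Num.min c y).

Lemma trunc_lip c x y : `|trunc c x - trunc c y| <= `|x - y|.
Proof.
have H u v : `|u - v| <= `|x - y| <-> u <= v + `|x - y| /\ v <= u + `|x - y|.
  rewrite ler_distl; split; [move=> /andP[] |move=> []]; first lra.
  by move=> h1 h2; apply/andP; split; lra.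
apply/H; have /H[] : `|x - y| <= `|x - y| by [].
have := normr_ge0 (x - y); rewrite /trunc /Num.max /Num.min.
by move=> h0 h1 h2; split; do ![case: ifP]; move=> *; lra.
Qed.

Lemma trunc_norm_le c y : 0 <= c -> `|trunc c y| <= c.
Proof.
move=> c0; rewrite ler_norml /trunc; apply/andP; split.
  by rewrite le_max lexx.
by rewrite ge_max ge_min lexx andbT; lra.
Qed.

Lemma trunc_id c y : `|y| <= c -> trunc c y = y.
Proof.
by rewrite ler_norml /trunc => /andP[h1 h2]; rewrite min_r // max_r.
Qed.

Lemma trunc_norm_le_id c y : 0 <= c -> `|trunc c y| <= `|y|.
Proof.
move=> c0; have /= := trunc_lip c y 0; rewrite subr0.
by rewrite (@trunc_id c 0) ?normr0 // subr0.
Qed.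

Lemma trunc_dist c y : 0 <= c -> `|y - trunc c y| = Num.max 0 (`|y| - c).
Proof.
move=> c0; have [yc|yc] := leP `|y| c.
  by rewrite trunc_id // subrr normr0 max_l // subr_le0.
rewrite max_r ?subr_ge0 ?ltW // /trunc; have [y0|y0] := leP 0 y.
  rewrite (ger0_norm y0) in yc *; rewrite min_l ?ltW // max_r; last by lra.
  by rewrite gtr0_norm // subr_gt0.
rewrite (ltr0_norm y0) in yc *; rewrite min_r; last by lra.
by rewrite max_l; [rewrite ltr0_norm; lra|lra].
Qed.

End LocallyLipschitz.

Section Lip.
Variable R : realType.

Lemma lip_comp2 (V : normedModType R) (F : R -> R -> R) (f g : V -> R) :
  locally_lip2 F -> lip f -> lip g -> lip (fun x => F (f x) (g x)).
Proof.
move=> HF [[Mf Hf] [Kf Lf]] [[Mg Hg] [Kg Lg]].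
pose M := `|Mf| + `|Mg|.
have M0 : 0 <= M by rewrite addr_ge0.
have fM x : `|f x| <= M.
  by apply: le_trans (Hf x) _; apply: le_trans (ler_norm _) _; rewrite lerDl.
have gM x : `|g x| <= M.
  by apply: le_trans (Hg x) _; apply: le_trans (ler_norm _) _; rewrite lerDr.
have [K K0 HK] := HF M M0; split.
  exists (`|F 0 0| + K * (M + M)) => x.
  rewrite -[F (f x) _](subrK (F 0 0)) addrC; apply: le_trans (ler_normD _ _) _.
  rewrite lerD2l; apply: le_trans (HK _ _ _ _ _ _ _ _) _; rewrite ?normr0 //.
  by rewrite !subr0 ler_wpM2l // lerD.
exists (K * (Kf + Kg)) => x y; apply: le_trans (HK _ _ _ _ _ _ _ _) _ => //.
by rewrite -mulrA ler_wpM2l // mulrDl lerD.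
Qed.

Lemma lip_comp (V W : normedModType R) (h : V -> W) (f : W -> R) (K : R) :
  (forall x y, `|h x - h y| <= K * `|x - y|) -> lip f -> lip (f \o h).
Proof.
move=> Hh [[M HM] [L HL]]; split; first by exists M => x; exact: HM.
exists (`|L| * K) => x y /=; apply: le_trans (HL _ _) _.
apply: le_trans (ler_wpM2r _ (ler_norm L)) _ => //.
by rewrite -mulrA ler_wpM2l.
Qed.

Lemma lip_cst (V : normedModType R) (c : R) : lip (fun _ : V => c).
Proof.
split; first by exists `|c|.
by exists 0 => x y; rewrite subrr normr0 mul0r.
Qed.

Lemma mx_norm_le m n (x : 'M[R]_(m, n)) (c : R) :
  0 <= c -> (forall i j, `|x i j| <= c) -> `|x| <= c.
Proof.
move=> c0 xc; rewrite [leLHS]/Num.norm /= mx_normrE; apply/bigmax_leP.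
by split => //= -[i j] _; exact: xc.
Qed.

End Lip.

(** Common to [lip], [Lip0_le T] and [Lip0], so that the single tactic [stable_tac] proves
    membership in all three. *)
Record stable (R : realType) (W : Type) (H : set (W -> R)) : Prop := {
  stable_cst : forall c, H (fun _ => c);
  stable_comp : forall F X Y, locally_lip2 F -> H X -> H Y ->
    H (fun w => F (X w) (Y w)) }.

Section Stable.
Variables (R : realType) (W : Type) (H : set (W -> R)).
Hypothesis HH : stable H.
Implicit Types X Y : W -> R.

Lemma stableD X Y : H X -> H Y -> H (fun w => X w + Y w).
Proof. exact: (stable_comp HH (@locally_lip2_add R)). Qed.

Lemma stableB X Y : H X -> H Y -> H (fun w => X w - Y w).
Proof. exact: (stable_comp HH (@locally_lip2_sub R)). Qed.

Lemma stableM X Y : H X -> H Y -> H (fun w => X w * Y w).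
Proof. exact: (stable_comp HH (@locally_lip2_mul R)). Qed.

Lemma stableN X : H X -> H (fun w => - X w).
Proof.
move=> HX; rewrite (_ : (fun w => _) = (fun w => 0 - X w)).
  by apply: stableB => //; exact: stable_cst.
by apply/funext => w; rewrite sub0r.
Qed.

Lemma stableX X n : H X -> H (fun w => X w ^+ n).
Proof.
move=> HX; elim: n => [|n IH]; first exact: stable_cst.
rewrite (_ : (fun w => _) = (fun w => X w * X w ^+ n)); first exact: stableM.
by apply/funext => w; rewrite exprS.
Qed.

Lemma stable_norm X : H X -> H (fun w => `|X w|).
Proof.
move=> HX; apply: (stable_comp HH (F := fun x _ => `|x|) _ HX HX).
by apply: locally_lip2_fst => x y; exact: ler_dist_dist.
Qed.

Lemma stable_trunc c X : H X -> H (fun w => trunc c (X w)).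
Proof.
move=> HX; apply: (stable_comp HH (F := fun x _ => trunc c x) _ HX HX).
by apply: locally_lip2_fst => x y; exact: trunc_lip.
Qed.

End Stable.

Ltac stable_tac HH := repeat first
  [ assumption | done | apply: (stable_cst HH) | apply: (stableX HH)
  | apply: (stableM HH) | apply: (stableB HH) | apply: (stableN HH) | apply: (stableD HH)
  | apply: (stable_norm HH) | apply: (stable_trunc HH) ].

Section Lip0.
Variables (R : realType) (d : nat).
Implicit Types X Y : Omega R d -> R.

Lemma lip_stable (V : normedModType R) : stable (@lip R V).
Proof. by split; [exact: lip_cst|move=> F X Y; exact: lip_comp2]. Qed.

(** A dummy time 0 is appended, so that m = 0, that is a constant, is covered although [Lip0_le]
    asks for at least one time. *)
Lemma Lip0_le_intro T (m : nat) (t : 'I_m -> R) (phi : 'M[R]_(d, m) -> R) :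
  0 <= T -> (forall j, 0 <= t j <= T) -> lip phi -> Lip0_le T (fun w => phi (Bmx t w)).
Proof.
move=> T0 tT Lphi.
pose t' (j : 'I_(m + 1)) := if fintype.split j is inl i then t i else 0.
exists (m + 1)%N, t', (phi \o lsubmx); split.
- by rewrite addn1.
- by move=> j; rewrite /t'; case: (fintype.split j) => // _; rewrite lexx.
- apply: (lip_comp (K := 1)) => // x y; rewrite mul1r.
  by apply: mx_norm_le => // i j; rewrite !mxE; have := coord_le_norm (x - y) i (lshift 1 j); rewrite !mxE.
- apply/funext => w /=; congr phi; apply/matrixP => i j; rewrite !mxE /t'.
  by rewrite (unsplitK (inl j)).
Qed.

Lemma Lip0_le_stable T : 0 <= T -> stable (@Lip0_le R d T).
Proof.
move=> T0; split.
  move=> c; have := @Lip0_le_intro T 0 (fun=> 0) (fun=> c) T0; apply.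
    by move=> j; rewrite lexx.
  exact: lip_cst.
move=> F X Y HF [m [t [phi [m0 tT Lphi ->]]]] [m' [t' [phi' [_ tT' Lphi' ->]]]].
pose s (j : 'I_(m + m')) := match fintype.split j with inl i => t i | inr i => t' i end.
pose psi (x : 'M[R]_(d, m + m')) := F (phi (lsubmx x)) (phi' (rsubmx x)).
exists (m + m')%N, s, psi; split.
- by rewrite addn_gt0 m0.
- by move=> j; rewrite /s; case: (fintype.split j).
- apply: (lip_comp2 (f := phi \o lsubmx) (g := phi' \o rsubmx) HF).
    apply: (lip_comp (K := 1)) => // x y; rewrite mul1r; apply: mx_norm_le => // i j.
    by rewrite !mxE; have := coord_le_norm (x - y) i (lshift m' j); rewrite !mxE.
  apply: (lip_comp (K := 1)) => // x y; rewrite mul1r; apply: mx_norm_le => // i j.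
  by rewrite !mxE; have := coord_le_norm (x - y) i (rshift m j); rewrite !mxE.
- apply/funext => w /=; rewrite /psi; congr (F (phi _) (phi' _)); apply/matrixP => i j; rewrite !mxE /s.
    by rewrite (unsplitK (inl j)).
  by rewrite (unsplitK (inr j)).
Qed.

Lemma Lip0_le_mono S T X : S <= T -> Lip0_le S X -> Lip0_le T X.
Proof.
move=> ST [m [t [phi [m0 tT Lphi ->]]]]; exists m, t, phi; split => // j.
by have /andP[-> h] := tT j; rewrite (le_trans h).
Qed.

Lemma Lip0P X : Lip0 X <-> exists2 T, 0 <= T & Lip0_le T X.
Proof.
split=> [[N _ HX]|[T T0 HX]]; first by exists N%:R.
exists (Num.truncn T).+1 => //; apply: Lip0_le_mono HX.
by apply: ltW; rewrite truncnS_gt.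
Qed.

Lemma Lip0_le_Lip0 T X : 0 <= T -> Lip0_le T X -> Lip0 X.
Proof. by move=> T0 HX; apply/Lip0P; exists T. Qed.

Lemma Lip0_stable : stable (@Lip0 R d).
Proof.
split.
  by move=> c; apply/Lip0P; exists 0 => //; exact: (stable_cst (Lip0_le_stable _)).
move=> F X Y HF /Lip0P[S S0 HX] /Lip0P[T T0 HY].
have M0 : 0 <= Num.max S T by rewrite le_max S0.
apply/Lip0P; exists (Num.max S T) => //.
by apply: (stable_comp (Lip0_le_stable M0)) => //; [apply: Lip0_le_mono HX|apply: Lip0_le_mono HY];
  rewrite le_max lexx ?orbT.
Qed.

Lemma Lip0_bounded X : Lip0 X -> exists2 M, 0 <= M & forall w, `|X w| <= M.
Proof.
move=> [N _ [m [t [phi [_ _ [[M HM] _] ->]]]]].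
exists `|M| => // w; exact: le_trans (HM _) (ler_norm _).
Qed.

Lemma Lip0_le_increment s t (psi : 'cV[R]_d -> R) : 0 <= s -> s <= t -> lip psi ->
  Lip0_le t (fun w => psi (B t w - B s w)).
Proof.
move=> s0 st Lpsi.
pose u (j : 'I_(1 + 1)) := match fintype.split j with inl _ => s | inr _ => t end.
have := @Lip0_le_intro t _ u (fun x => psi (rsubmx x - lsubmx x)) (le_trans s0 st).
have -> : (fun w => psi (B t w - B s w)) =
    (fun w => psi (rsubmx (Bmx u w) - lsubmx (Bmx u w))).
  apply/funext => w; congr psi; apply/matrixP => i j; rewrite !mxE /u.
  by rewrite (unsplitK (inl j)) (unsplitK (inr j)) ord1.
apply; first by move=> j; rewrite /u; case: (fintype.split j); rewrite ?s0 ?lexx ?(le_trans s0).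
apply: (lip_comp (h := fun x : 'M[R]_(d, 1 + 1) => rsubmx x - lsubmx x) (K := 2)) => // x y.
rewrite mulr2n mulrDl mul1r; apply: mx_norm_le => [|i j]; first by rewrite addr_ge0.
rewrite !mxE.
have := coord_le_norm (x - y) i (rshift 1 j); have := coord_le_norm (x - y) i (lshift 1 j).
rewrite !mxE; set p := x _ _; set q := y _ _; set p' := x _ _; set q' := y _ _ => h1 h2.
have -> : p' - p - (q' - q) = (p' - q') - (p - q) by ring.
by apply: le_trans (ler_normB _ _) _; rewrite lerD.
Qed.

End Lip0.

(** * Sublinear expectation and its L1 completion *)

Section Sequences.
Variable R : realType.

Lemma cvgnP (V : normedModType R) (u : nat -> V) (l : V) :
  u @ \oo --> l <-> forall e : R, 0 < e -> exists N, forall n, (N <= n)%N -> `|l - u n| < e.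
Proof.
split=> [/cvgrPdist_lt ul e e0|H].
  by have [N _ HN] := ul e e0; exists N => n Nn; exact: HN.
by apply/cvgrPdist_lt => e /H[N HN]; exists N.
Qed.

Lemma cvgn_cauchy (V : completeNormedModType R) (u : nat -> V) :
  (forall e : R, 0 < e -> exists N, forall m n, (N <= m)%N -> (N <= n)%N -> `|u m - u n| < e) ->
  exists l : V, u @ \oo --> l.
Proof.
move=> H; apply/cvg_ex; apply: cauchy_cvg; apply: cauchy_exP => e e0.
have [N HN] := H e e0; exists (u N); exists N => // n /= Nn.
by rewrite -ball_normE /ball_ /=; exact: HN.
Qed.

Lemma cvgn_uniq (V : normedModType R) (u : nat -> V) (l l' : V) :
  u @ \oo --> l -> u @ \oo --> l' -> l = l'.
Proof. by move=> ul ul'; exact: (norm_cvg_unique ul ul'). Qed.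

Lemma cvgn_le (u : nat -> R) (l c : R) N :
  u @ \oo --> l -> (forall n, (N <= n)%N -> u n <= c) -> l <= c.
Proof. by move=> ul uc; apply: (cvgr_to_le ul); exists N. Qed.

Lemma cvgn_ge (u : nat -> R) (l c : R) N :
  u @ \oo --> l -> (forall n, (N <= n)%N -> c <= u n) -> c <= l.
Proof. by move=> ul uc; apply: (cvgr_to_ge ul); exists N. Qed.

Lemma cvgn_le_cvgn (u v : nat -> R) (l l' : R) :
  u @ \oo --> l -> v @ \oo --> l' -> (forall n, u n <= v n) -> l <= l'.
Proof.
move=> ul vl' uv; rewrite -subr_ge0.
have H : (fun n => v n - u n) @ \oo --> l' - l by exact: cvgB.
by apply: (@cvgn_ge _ _ _ 0 H) => n _; rewrite subr_ge0.
Qed.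

Lemma cvgn_squeeze (V : normedModType R) (u v : nat -> V) (l : V) (z : nat -> R) :
  u @ \oo --> l -> z @ \oo --> 0 -> (forall n, `|u n - v n| <= z n) -> v @ \oo --> l.
Proof.
move=> /cvgnP ul /cvgnP z0 uv; apply/cvgnP => e e0.
have e20 : 0 < e / 2 by rewrite divr_gt0.
have [N1 H1] := ul _ e20; have [N2 H2] := z0 _ e20.
exists (maxn N1 N2) => n; rewrite geq_max => /andP[/H1 h1 /H2].
rewrite sub0r normrN => h2; have := uv n.
have -> : l - v n = (l - u n) + (u n - v n) by rewrite addrA subrK.
move=> h3; apply: le_lt_trans (ler_normD _ _) _.
by have := ler_norm (z n); lra.
Qed.

(** For D m n a distance between the m-th and n-th terms this is the Cauchy property. Being
    one-sided, it passes to any smaller D whatever its sign. *)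
Definition vanish (D : nat -> nat -> R) := forall e : R, 0 < e ->
  exists N, forall m n, (N <= m)%N -> (N <= n)%N -> D m n < e.

Lemma vanish_le D D' : (forall m n, D m n <= D' m n) -> vanish D' -> vanish D.
Proof.
move=> DD' H e /H[N HN]; exists N => m n Nm Nn.
by apply: le_lt_trans (DD' _ _) _; exact: HN.
Qed.

Lemma vanishD D D' : vanish D -> vanish D' -> vanish (fun m n => D m n + D' m n).
Proof.
move=> H H' e e0; have e20 : 0 < e / 2 by rewrite divr_gt0.
have [N1 H1] := H _ e20; have [N2 H2] := H' _ e20.
exists (maxn N1 N2) => m n; rewrite !geq_max => /andP[a1 a2] /andP[b1 b2].
by have := H1 m n a1 b1; have := H2 m n a2 b2; lra.
Qed.

Lemma vanishZ c D : 0 <= c -> vanish D -> vanish (fun m n => c * D m n).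
Proof.
move=> c0 H e e0; have c10 : 0 < c + 1 by lra.
have [N HN] := H (e / (c + 1)) (divr_gt0 e0 c10); exists N => m n Nm Nn.
have := HN m n Nm Nn; rewrite ltr_pdivlMr // => h.
have [Dmn|Dmn] := leP 0 (D m n); first by apply: le_lt_trans h; lra.
by apply: le_lt_trans e0; rewrite mulr_ge0_le0 // ltW.
Qed.

Lemma vanish_cvgl (u : nat -> R) : u @ \oo --> 0 -> vanish (fun m _ => u m).
Proof.
move=> /cvgnP H e /H[N HN]; exists N => m n /HN + _; rewrite sub0r normrN.
by apply: le_lt_trans; exact: ler_norm.
Qed.

Lemma vanish_cvgr (u : nat -> R) : u @ \oo --> 0 -> vanish (fun _ n => u n).
Proof.
move=> /cvgnP H e /H[N HN]; exists N => m n _ /HN; rewrite sub0r normrN.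
by apply: le_lt_trans; exact: ler_norm.
Qed.

Lemma cvgn_inv : (fun n => (n.+1%:R : R)^-1) @ \oo --> 0.
Proof. exact: (@cvg_harmonic R). Qed.

Lemma closure_seqP (V : normedModType R) (A : set V) (x : V) :
  closure A x <-> forall e : R, 0 < e -> exists2 y, A y & `|x - y| < e.
Proof.
split=> [cAx e e0|H].
  have [y [Ay]] := cAx _ (nbhsx_ballx x e e0).
  by rewrite -ball_normE => xy; exists y.
move=> U /nbhs_ballP[e /= e0 eU]; have [y Ay xy] := H e e0.
by exists y; split => //; apply: eU; rewrite -ball_normE.
Qed.

Lemma closure_cvgn (V : normedModType R) (A : set V) (u : nat -> V) (x : V) :
  (forall n, A (u n)) -> u @ \oo --> x -> closure A x.
Proof.
move=> Au /cvgnP ux; apply/closure_seqP => e /ux[N HN].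
by exists (u N) => //; exact: HN.
Qed.

End Sequences.

Section Expectation.
Variables (R : realType) (d : nat) (E : (Omega R d -> R) -> R).
Hypothesis HE : sublinear_expectation (@Lip0 R d) E.
Local Notation H := (@Lip0 R d).
Let HS := @Lip0_stable R d.
Implicit Types X Y Z : Omega R d -> R.

Lemma E_le X Y : H X -> H Y -> (forall w, X w <= Y w) -> E X <= E Y.
Proof. by case: HE => h _ _ _ _ HX HY XY; exact: h. Qed.

Lemma E_cst c : E (fun=> c) = c.
Proof. by case: HE. Qed.

Lemma E_add X Y : H X -> H Y -> E (fun w => X w + Y w) <= E X + E Y.
Proof.
move=> HX HY; case: HE => _ _ h _ _; rewrite -lerBlDr.
have := h _ _ (stableD HS HX HY) HY.
by rewrite (_ : (fun w => X w + Y w - Y w) = X) //; apply/funext => w; rewrite addrK.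
Qed.

Lemma E_scale c X : 0 <= c -> H X -> E (fun w => c * X w) = c * E X.
Proof. by case: HE => _ _ _ h _ c0 HX; exact: h. Qed.

Lemma E_ge0 X : H X -> (forall w, 0 <= X w) -> 0 <= E X.
Proof. by move=> HX X0; rewrite -(E_cst 0); apply: E_le => //; stable_tac HS. Qed.

(** This and its variants with more terms are the working form of sublinearity: a pointwise bound by
    a combination with nonnegative coefficients passes to [E]. *)
Lemma E_le1 Z c1 X1 : H Z -> H X1 -> 0 <= c1 ->
  (forall w, Z w <= c1 * X1 w) -> E Z <= c1 * E X1.
Proof. by move=> HZ H1 c10 ZX; rewrite -E_scale //; apply: E_le => //; stable_tac HS. Qed.

Lemma E_le2 Z c1 X1 c2 X2 : H Z -> H X1 -> H X2 -> 0 <= c1 -> 0 <= c2 ->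
  (forall w, Z w <= c1 * X1 w + c2 * X2 w) -> E Z <= c1 * E X1 + c2 * E X2.
Proof.
move=> HZ H1 H2 c10 c20 ZX.
apply: le_trans (E_le HZ _ ZX) _; first by stable_tac HS.
by rewrite -!E_scale //; apply: E_add; stable_tac HS.
Qed.

Lemma E_le3 Z c1 X1 c2 X2 c3 X3 : H Z -> H X1 -> H X2 -> H X3 ->
  0 <= c1 -> 0 <= c2 -> 0 <= c3 ->
  (forall w, Z w <= c1 * X1 w + c2 * X2 w + c3 * X3 w) ->
  E Z <= c1 * E X1 + c2 * E X2 + c3 * E X3.
Proof.
move=> HZ H1 H2 H3 c10 c20 c30 ZX.
have -> : c1 * E X1 + c2 * E X2 + c3 * E X3 =
  c1 * E X1 + 1 * (c2 * E X2 + c3 * E X3) by ring.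
have H23 : H (fun w => c2 * X2 w + c3 * X3 w) by stable_tac HS.
apply: le_trans (E_le2 (c1 := c1) (c2 := 1) HZ H1 H23 c10 ler01 _) _.
  by move=> w; have := ZX w; lra.
by rewrite lerD2l !mul1r; exact: E_le2.
Qed.

Lemma E_le5 Z c1 X1 c2 X2 c3 X3 c4 X4 c5 X5 :
  H Z -> H X1 -> H X2 -> H X3 -> H X4 -> H X5 ->
  0 <= c1 -> 0 <= c2 -> 0 <= c3 -> 0 <= c4 -> 0 <= c5 ->
  (forall w, Z w <= c1 * X1 w + c2 * X2 w + c3 * X3 w + c4 * X4 w + c5 * X5 w) ->
  E Z <= c1 * E X1 + c2 * E X2 + c3 * E X3 + c4 * E X4 + c5 * E X5.
Proof.
move=> HZ H1 H2 H3 H4 H5 c10 c20 c30 c40 c50 ZX.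
have H345 : H (fun w => c3 * X3 w + c4 * X4 w + c5 * X5 w) by stable_tac HS.
apply: le_trans (E_le3 (c1 := c1) (c2 := c2) (c3 := 1) HZ H1 H2 H345 c10 c20 ler01 _) _.
  by move=> w; have := ZX w; lra.
have := E_le3 H345 H3 H4 H5 c30 c40 c50 (fun w => lexx _); lra.
Qed.

Lemma E_dist X Y : H X -> H Y -> `|E X - E Y| <= E (fun w => `|X w - Y w|).
Proof.
move=> HX HY; rewrite ler_distlC.
have h1 : E X <= 1 * E Y + 1 * E (fun w => `|X w - Y w|).
  apply: E_le2 => //; first by stable_tac HS.
  by move=> w; have := ler_norm (X w - Y w); lra.
have h2 : E Y <= 1 * E X + 1 * E (fun w => `|X w - Y w|).
  apply: E_le2 => //; first by stable_tac HS.
  by move=> w; have := ler_norm (Y w - X w); rewrite distrC; lra.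
by apply/andP; split; lra.
Qed.

(** Apply [E] to 2 m |X| <= X^2 + m^2 with m = E|X|. *)
Lemma E_sqr_norm X : H X -> E (fun w => `|X w|) ^+ 2 <= E (fun w => X w ^+ 2).
Proof.
move=> HX; set m := E _.
have m0 : 0 <= m by apply: E_ge0 => //; stable_tac HS.
have : 2 * m * E (fun w => `|X w|) <= 1 * E (fun w => X w ^+ 2) + 1 * E (fun=> m ^+ 2).
  rewrite -E_scale //; [|by lra|by stable_tac HS].
  apply: E_le2 => //; try by stable_tac HS.
  by move=> w; have := sqr_ge0 (m - `|X w|); rewrite sqrrB real_normK ?num_real //; lra.
by rewrite E_cst -/m; lra.
Qed.

Lemma E_sqr_bounded (X : nat -> Omega R d -> R) : (forall n, H (X n)) ->
  vanish (fun m n => E (fun w => (X m w - X n w) ^+ 2)) ->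
  exists C N, 0 <= C /\ forall n, (N <= n)%N -> E (fun w => X n w ^+ 2) <= C.
Proof.
move=> HX /(_ 1 ltr01)[N HN].
have sq0 n : 0 <= E (fun w => X n w ^+ 2).
  by apply: E_ge0 => [|w]; [stable_tac HS|exact: sqr_ge0].
exists (2 * 1 + 2 * E (fun w => X N w ^+ 2)), N; split.
  by rewrite addr_ge0 // mulr_ge0.
move=> n Nn; apply: le_trans (_ : 2 * E (fun w => (X n w - X N w) ^+ 2) + 2 * E (fun w => X N w ^+ 2) <= _).
  apply: E_le2 => //; try by stable_tac HS.
  by move=> w; have := sqr_ge0 (X n w - 2 * X N w); lra.
by have := HN n N Nn (leqnn _); lra.
Qed.

(** The weighted inequality |x y| <= c x^2 + y^2 / c replaces Cauchy-Schwarz: c is fixed large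
    against the bounded second moments first, then the differences are made small against c. *)
Lemma vanish_mul (X Y : nat -> Omega R d -> R) :
  (forall n, H (X n)) -> (forall n, H (Y n)) ->
  vanish (fun m n => E (fun w => (X m w - X n w) ^+ 2)) ->
  vanish (fun m n => E (fun w => (Y m w - Y n w) ^+ 2)) ->
  vanish (fun m n => E (fun w => `|X m w * Y m w - X n w * Y n w|)).
Proof.
move=> HX HY VX VY e e0.
have [CX [NX [CX0 HCX]]] := E_sqr_bounded HX VX.
have [CY [NY [CY0 HCY]]] := E_sqr_bounded HY VY.
(* Makes c^-1 (CX + CY) <= e / 4; the summand 1 keeps c positive when both bounds are 0. *)
pose c := 4 * (CX + CY) / e + 1.
have c0 : 0 < c.
  rewrite ltr_wpDl // divr_ge0 //; last exact: ltW.
  by rewrite mulr_ge0 // addr_ge0.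
have ec : 0 < e / (4 * c) by rewrite divr_gt0 // mulr_gt0.
have [N1 H1] := VX _ ec; have [N2 H2] := VY _ ec.
exists (maxn (maxn NX NY) (maxn N1 N2)) => m n.
rewrite !geq_max => /andP[/andP[mX mY] /andP[m1 m2]] /andP[/andP[nX nY] /andP[n1 n2]].
have ub : E (fun w => `|X m w * Y m w - X n w * Y n w|) <=
    c * E (fun w => (X m w - X n w) ^+ 2) + c^-1 * E (fun w => Y m w ^+ 2) +
    c * E (fun w => (Y m w - Y n w) ^+ 2) + c^-1 * E (fun w => X n w ^+ 2) +
    0 * E (fun=> 0).
  apply: E_le5 => //; try (by stable_tac HS); rewrite ?invr_ge0 ?ltW // => w.
  have AG (x y : R) : `|x * y| <= c * x ^+ 2 + c^-1 * y ^+ 2.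
    have h1 : 0 <= c^-1 * (c * `|x| - `|y|) ^+ 2 by rewrite mulr_ge0 ?sqr_ge0 // invr_ge0 ltW.
    have h2 : c^-1 * (c * `|x| - `|y|) ^+ 2 = c * `|x| ^+ 2 - 2 * (`|x| * `|y|) + c^-1 * `|y| ^+ 2.
      by field; rewrite gt_eqF.
    have h3 : 0 <= `|x| * `|y| by rewrite mulr_ge0.
    rewrite normrM; move: h1; rewrite h2 !real_normK ?num_real //; lra.
  have -> : X m w * Y m w - X n w * Y n w =
    (X m w - X n w) * Y m w + (Y m w - Y n w) * X n w by ring.
  apply: le_trans (ler_normD _ _) _.
  by have := AG (X m w - X n w) (Y m w); have := AG (Y m w - Y n w) (X n w); lra.
apply: le_lt_trans ub _.
have ec4 : e / 4 = c * (e / (4 * c)) by field; rewrite gt_eqF.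
have b1 : c * E (fun w => (X m w - X n w) ^+ 2) < e / 4.
  by rewrite ec4 ltr_pM2l //; exact: H1.
have b2 : c * E (fun w => (Y m w - Y n w) ^+ 2) < e / 4.
  by rewrite ec4 ltr_pM2l //; exact: H2.
have b3 : c^-1 * (CX + CY) <= e / 4.
  rewrite ler_pdivrMl // /c mulrDl mul1r.
  have -> : 4 * (CX + CY) / e * (e / 4) = CX + CY by field; rewrite gt_eqF.
  by rewrite lerDl divr_ge0 // ltW.
have ci : 0 <= c^-1 by rewrite invr_ge0 ltW.
have b4 := ler_wpM2l ci (HCX n nX).
have b5 := ler_wpM2l ci (HCY m mY).
by move: b1 b2 b3 b4 b5; lra.
Qed.

End Expectation.

(** * Expectation and products in the L1 completion *)

Section Completion.
Variables (R : realType) (d : nat) (E : (Omega R d -> R) -> R).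
Hypothesis HE : sublinear_expectation (@Lip0 R d) E.
Variables (L1 : completeNormedModType R) (iota : (Omega R d -> R) -> L1).
Hypothesis HL : is_completion (@Lip0 R d) (fun X => E (fun w => `|X w|)) iota.
Local Notation H := (@Lip0 R d).
Let HS := @Lip0_stable R d.
Implicit Types (X Y Z : Omega R d -> R) (P Q S : L1).

Lemma iota_lin c X Y : H X -> H Y -> iota (fun w => c * X w + Y w) = c *: iota X + iota Y.
Proof. by move=> HX HY; rewrite -(completion_linear HL c HX HY). Qed.

Lemma iotaB X Y : H X -> H Y -> iota (fun w => X w - Y w) = iota X - iota Y.
Proof.
move=> HX HY; rewrite (_ : (fun w => _) = (fun w => -1 * Y w + X w)).
  by rewrite iota_lin // scaleN1r addrC.
by apply/funext => w; rewrite mulN1r addrC.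
Qed.

Lemma iota_dist X Y : H X -> H Y -> `|iota X - iota Y| = E (fun w => `|X w - Y w|).
Proof.
by move=> HX HY; rewrite -iotaB // (completion_isometry HL) //; stable_tac HS.
Qed.

Lemma iota_norm X : H X -> `|iota X| = E (fun w => `|X w|).
Proof. exact: completion_isometry HL _. Qed.

Lemma iota0 : iota (fun=> 0) = 0.
Proof.
apply/eqP; rewrite -normr_eq0 iota_norm; last by stable_tac HS.
by under [X in E X]eq_fun do rewrite normr0; rewrite (E_cst HE).
Qed.

Lemma iota_cvg_cauchy (X : nat -> Omega R d -> R) P : (forall n, H (X n)) ->
  iota (X n) @[n --> \oo] --> P -> vanish (fun m n => E (fun w => `|X m w - X n w|)).
Proof.
move=> HX /cvgnP XP e e0; have [N HN] := XP _ (divr_gt0 e0 (ltr0n _ 2)).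
exists N => m n Nm Nn; rewrite -iota_dist //.
rewrite (_ : iota (X m) - iota (X n) = (P - iota (X n)) - (P - iota (X m))).
  by apply: le_lt_trans (ler_normB _ _) _; have := HN m Nm; have := HN n Nn; lra.
by rewrite opprB [RHS]addrC addrA subrK.
Qed.

Lemma iota_cauchy_cvg (X : nat -> Omega R d -> R) : (forall n, H (X n)) ->
  vanish (fun m n => E (fun w => `|X m w - X n w|)) ->
  exists P, iota (X n) @[n --> \oo] --> P.
Proof.
move=> HX V; apply: cvgn_cauchy => e /V[N HN]; exists N => m n Nm Nn.
by rewrite iota_dist //; exact: HN.
Qed.

(** [E] is 1-Lipschitz for the L1 seminorm, so the limit exists and is the same along every
    approximating sequence; the choice in [EL] is forced. *)
Lemma E_cvg (X : nat -> Omega R d -> R) P : (forall n, H (X n)) ->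
  iota (X n) @[n --> \oo] --> P -> E (X n) @[n --> \oo] --> EL E iota P.
Proof.
move=> HX XP; have V := iota_cvg_cauchy HX XP.
have [r Xr] : exists r : R, E (X n) @[n --> \oo] --> r.
  apply: cvgn_cauchy => e /V[N HN]; exists N => m n Nm Nn.
  by apply: le_lt_trans (E_dist HE _ _) _ => //; exact: HN.
rewrite /EL (xget_subset1 _ (x := r)) //; first by exists X.
move=> r0 r1 [Y [HY YP Yr]] [X1 [HX1 XP1 Xr1]].
apply: (cvgn_uniq Yr); apply: (cvgn_squeeze Xr1 (z := fun n => `|iota (X1 n) - iota (Y n)|)).
  by rewrite -(normr0 L1) -(subrr P); apply: cvg_norm; exact: cvgB.
by move=> n; rewrite iota_dist //; exact: E_dist.
Qed.

(** Meant for D = |X Y - X' Y'|, A = |X - X'|, C = |Y - Y'|, y = |Y|, x = |X'|. Where x, y <= K the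
    product rule bounds D; elsewhere M <= (M / K) max(x, y), as in Chebyshev's inequality, and D <=
    del + M is used. *)
Lemma mul_diff_le (D del M K A C y x : R) : 1 <= M -> 0 < K ->
  D <= del + M -> D <= A * y + x * C -> 0 <= A -> 0 <= C -> 0 <= x -> 0 <= y -> 0 <= del ->
  D <= 1 * del + (M * K) * A + (M * K) * C + (M / K) * y + (M / K) * x.
Proof.
move=> M1 K0 DM DAC A0 C0 x0 y0 d0.
have M0 : 0 < M by lra.
have MK : 0 < M / K by rewrite divr_gt0.
have MKA : K * A <= M * K * A by rewrite -mulrA ler_peMl // mulr_ge0 // ltW.
have MKC : K * C <= M * K * C by rewrite -mulrA ler_peMl // mulr_ge0 // ltW.
have h1 : 0 <= K * A by rewrite mulr_ge0 // ltW.
have h2 : 0 <= K * C by rewrite mulr_ge0 // ltW.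
have h3 : 0 <= M / K * y by rewrite mulr_ge0 // ltW.
have h4 : 0 <= M / K * x by rewrite mulr_ge0 // ltW.
have [yK|yK] := leP y K; last first.
  have : M <= M / K * y.
    by rewrite mulrAC ler_pdivlMr // ler_wpM2l // ltW.
  by lra.
have [xK|xK] := leP x K; last first.
  have : M <= M / K * x.
    by rewrite mulrAC ler_pdivlMr // ler_wpM2l // ltW.
  by lra.
have : A * y <= K * A by rewrite mulrC ler_wpM2r.
have : x * C <= K * C by rewrite ler_wpM2r.
lra.
Qed.

(* Products converge in capacity along both pairs of sequences, and an L1-Cauchy
   sequence of bounded variables is uniformly integrable. *)
Lemma is_mul_unique P Q S S' : is_mul iota P Q S -> is_mul iota P Q S' -> S = S'.
Proof.
move=> [X [Y [HXY XP YQ XYS]]] [X' [Y' [HXY' XP' YQ' XYS']]].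
have HX n : H (X n) by have [] := HXY n.
have HY n : H (Y n) by have [] := HXY n.
have HX' n : H (X' n) by have [] := HXY' n.
have HY' n : H (Y' n) by have [] := HXY' n.
pose D n w := X n w * Y n w - X' n w * Y' n w.
have HD n : H (D n) by rewrite /D; stable_tac HS.
have DS : iota (D n) @[n --> \oo] --> S - S'.
  rewrite (_ : (fun n => iota (D n)) =
    (fun n => iota (fun w => X n w * Y n w) - iota (fun w => X' n w * Y' n w))).
    exact: cvgB.
  by apply/funext => n; rewrite /D iotaB //; stable_tac HS.
have VD := iota_cvg_cauchy HD DS.
suff : `|S - S'| <= 0 by rewrite normr_le0 subr_eq0 => /eqP.
rewrite -[leRHS]addr0; apply/ler_addgt0Pr => _/posnumP[e]; rewrite add0r.
pose e1 := e%:num / 4.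
have e10 : 0 < e1 by rewrite divr_gt0.
have [N1 HN1] := VD _ e10.
have [M0 M00 HM0] := Lip0_bounded (HD N1).
pose M := M0 + 1.
have M1 : 1 <= M by rewrite /M; lra.
pose C := `|Q| + `|P| + 2.
have C2 : 2 <= C by rewrite /C lerDr addr_ge0.
(* Eventually E|Y n| and E|X' n| are at most |Q| + 1 and |P| + 1, so the tail term is at most (M /
   K) C = e1. *)
pose K := M * C / e1.
have K0 : 0 < K by rewrite divr_gt0 // mulr_gt0; lra.
have MK : 0 < M * K by rewrite mulr_gt0; lra.
have MK' : 0 < M / K by rewrite divr_gt0; lra.
have e2 : 0 < e1 / (M * K) by rewrite divr_gt0.
have XX' : `|iota (X n) - iota (X' n)| @[n --> \oo] --> (0 : R).
  by rewrite -(normr0 L1) -(subrr P); apply: cvg_norm; exact: cvgB.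
have YY' : `|iota (Y n) - iota (Y' n)| @[n --> \oo] --> (0 : R).
  by rewrite -(normr0 L1) -(subrr Q); apply: cvg_norm; exact: cvgB.
have bnd (U : nat -> Omega R d -> R) (Z : L1) : (forall n, H (U n)) -> iota (U n) @[n --> \oo] --> Z ->
    exists N, forall n, (N <= n)%N -> E (fun w => `|U n w|) <= `|Z| + 1.
  move=> HU /cvgnP/(_ 1 ltr01)[N HN]; exists N => n /HN; rewrite -iota_norm // => h.
  have -> : iota (U n) = Z - (Z - iota (U n)) by rewrite opprB [RHS]addrC subrK.
  by apply: le_trans (ler_normB _ _) _; rewrite lerD2l ltW.
have [N2 HN2] := bnd Y Q HY YQ.
have [N3 HN3] := bnd X' P HX' XP'.
have [N4 HN4] := (iffLR (cvgnP _ _) XX') _ e2.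
have [N5 HN5] := (iffLR (cvgnP _ _) YY') _ e2.
have DnS : `|iota (D n)| @[n --> \oo] --> `|S - S'| by exact: cvg_norm.
apply: (@cvgn_le _ _ _ _ (maxn N1 (maxn (maxn N2 N3) (maxn N4 N5))) DnS) => n.
rewrite !geq_max => /andP[n1 /andP[/andP[n2 n3] /andP[n4 n5]]].
rewrite iota_norm //.
have ub := @E_le5 _ _ _ HE (fun w => `|D n w|) 1 (fun w => `|D n w - D N1 w|)
  (M * K) (fun w => `|X n w - X' n w|) (M * K) (fun w => `|Y n w - Y' n w|)
  (M / K) (fun w => `|Y n w|) (M / K) (fun w => `|X' n w|).
apply: le_trans (ub _ _ _ _ _ _ _ _ _ _ _ _) _; try (by stable_tac HS); try exact: ltW; try exact: ler01.
  move=> w; apply: mul_diff_le => //.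
    rewrite -[D n w](subrK (D N1 w)).
    apply: le_trans (ler_normD _ _) _; rewrite subrK lerD2l.
    by apply: le_trans (HM0 w) _; rewrite /M; lra.
  rewrite -!normrM.
  rewrite /D (_ : X n w * Y n w - X' n w * Y' n w =
    (X n w - X' n w) * Y n w + X' n w * (Y n w - Y' n w)); last by ring.
  exact: ler_normD.
have b1 := HN1 n N1 n1 (leqnn _).
have b2 := HN2 n n2; have b3 := HN3 n n3.
have b4 := HN4 n n4; have b5 := HN5 n n5.
rewrite sub0r normrN normr_id iota_dist // ltr_pdivlMr // mulrC in b4.
rewrite sub0r normrN normr_id iota_dist // ltr_pdivlMr // mulrC in b5.
have b6 : M / K * (E (fun w => `|Y n w|) + E (fun w => `|X' n w|)) <= e1.
  apply: le_trans (_ : M / K * C <= _).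
    by rewrite ler_wpM2l //; [exact: ltW|rewrite /C; lra].
  by rewrite (_ : M / K * C = e1) // /K; field; rewrite !gt_eqF //; lra.
have -> : e%:num = 4 * e1 by rewrite /e1; field.
move: b1 b4 b5 b6; rewrite mulrDr; lra.
Qed.

Lemma mulL_eq (X Y : nat -> Omega R d -> R) P Q S :
  (forall n, H (X n)) -> (forall n, H (Y n)) ->
  iota (X n) @[n --> \oo] --> P -> iota (Y n) @[n --> \oo] --> Q ->
  iota (fun w => X n w * Y n w) @[n --> \oo] --> S -> mulL iota P Q = S.
Proof.
move=> HX HY XP YQ XYS; apply: xget_subset1.
  by exists X, Y; split => // n; split.
by move=> ? ? h1 h2; exact: (is_mul_unique h1 h2).
Qed.

Lemma is_sq_mul P S : is_sq iota P S -> is_mul iota P P S.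
Proof.
move=> [X [HX XP XS]]; exists X, X; split=> //.
rewrite (_ : (fun n => _) = (fun n => iota (fun w => `|X n w| ^+ 2))) //.
apply/funext => n; congr iota; apply/funext => w.
by rewrite real_normK ?num_real // expr2.
Qed.

Lemma sqL_eq (X : nat -> Omega R d -> R) P S : (forall n, H (X n)) ->
  iota (X n) @[n --> \oo] --> P -> iota (fun w => X n w ^+ 2) @[n --> \oo] --> S ->
  sqL iota P = S.
Proof.
move=> HX XP XS; apply: xget_subset1.
  exists X; split => //.
  rewrite (_ : (fun n => _) = (fun n => iota (fun w => X n w ^+ 2))) //.
  by apply/funext => n; congr iota; apply/funext => w; rewrite real_normK ?num_real.
by move=> ? ? /is_sq_mul h1 /is_sq_mul h2; exact: (is_mul_unique h1 h2).
Qed.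

End Completion.

(** * Square-integrable elements *)

Section L2.
Variables (R : realType) (d : nat) (E : (Omega R d -> R) -> R).
Hypothesis HE : sublinear_expectation (@Lip0 R d) E.
Variables (L1 : completeNormedModType R) (iota : (Omega R d -> R) -> L1).
Hypothesis HL : is_completion (@Lip0 R d) (fun X => E (fun w => `|X w|)) iota.
Local Notation H := (@Lip0 R d).
Let HS := @Lip0_stable R d.
Implicit Types (X Y Z : nat -> Omega R d -> R) (P Q : L1) (S T : R).

(* [E2 P] is the paper's E[P^2], and [L2rep T P X] says that X is a sequence of
   Lip0_le T that is Cauchy for E[|.|^2] and represents P. *)
Record L2rep T P X : Prop := {
  L2rep_in : forall n, Lip0_le T (X n);
  L2rep_cvg : iota (X n) @[n --> \oo] --> P;
  L2rep_cauchy : vanish (fun m n => E (fun w => (X m w - X n w) ^+ 2)) }.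

Definition E2 P := EL E iota (sqL iota P).

Lemma L2rep_Lip0 T P X n : 0 <= T -> L2rep T P X -> H (X n).
Proof. by move=> T0 r; apply: Lip0_le_Lip0 (L2rep_in r n). Qed.

Lemma L2rep_mono S T P X : S <= T -> L2rep S P X -> L2rep T P X.
Proof. by move=> ST [h1 h2 h3]; split => // n; apply: Lip0_le_mono (h1 n). Qed.

(** Mean-square Cauchy factors have L1-Cauchy products, so [mulL] is a genuine limit and not the
    default value 0. *)
Lemma L2rep_mul S T P Q X Y : 0 <= S -> 0 <= T -> L2rep S P X -> L2rep T Q Y ->
  iota (fun w => X n w * Y n w) @[n --> \oo] --> mulL iota P Q.
Proof.
move=> S0 T0 rX rY.
have HX n := L2rep_Lip0 n S0 rX; have HY n := L2rep_Lip0 n T0 rY.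
have HXY n : H (fun w => X n w * Y n w) by stable_tac HS.
have V := vanish_mul HE HX HY (L2rep_cauchy rX) (L2rep_cauchy rY).
have [Z XYZ] := iota_cauchy_cvg HL HXY V.
by rewrite (mulL_eq HE HL HX HY (L2rep_cvg rX) (L2rep_cvg rY) XYZ).
Qed.

Lemma L2rep_sq T P X : 0 <= T -> L2rep T P X ->
  iota (fun w => X n w ^+ 2) @[n --> \oo] --> sqL iota P.
Proof.
move=> T0 rX; have HX n := L2rep_Lip0 n T0 rX.
have -> : sqL iota P = mulL iota P P.
  by apply: (sqL_eq HE HL HX (L2rep_cvg rX)); exact: (L2rep_mul T0 T0 rX rX).
exact: (L2rep_mul T0 T0 rX rX).
Qed.

Lemma L2rep_E2 T P X : 0 <= T -> L2rep T P X ->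
  E (fun w => X n w ^+ 2) @[n --> \oo] --> E2 P.
Proof.
move=> T0 rX; have HX n := L2rep_Lip0 n T0 rX.
apply: (E_cvg HE HL) (L2rep_sq T0 rX) => n; stable_tac HS.
Qed.

Lemma L2rep_lin T c P Q X Y : 0 <= T -> L2rep T P X -> L2rep T Q Y ->
  L2rep T (c *: P + Q) (fun n w => c * X n w + Y n w).
Proof.
move=> T0 rX rY; have HX n := L2rep_Lip0 n T0 rX; have HY n := L2rep_Lip0 n T0 rY.
split.
- move=> n; have HST := Lip0_le_stable d T0; have := L2rep_in rX n; have := L2rep_in rY n.
  by move=> ? ?; stable_tac HST.
- rewrite (_ : (fun n => _) = (fun n => c *: iota (X n) + iota (Y n))).
    by apply: cvgD; [apply: cvgZl_tmp; exact: L2rep_cvg rX|exact: L2rep_cvg rY].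
  by apply/funext => n; rewrite (iota_lin HL).
- have c0 : 0 <= 2 * c ^+ 2 by rewrite mulr_ge0 // sqr_ge0.
  apply: vanish_le (vanishD (vanishZ c0 (L2rep_cauchy rX))
    (vanishZ (ler0n _ 2) (L2rep_cauchy rY))) => m n.
  apply: (E_le2 HE) => //; try (by stable_tac HS).
  by move=> w; have := sqr_ge0 (c * (X m w - X n w) - (Y m w - Y n w)); lra.
Qed.

Lemma L2rep_cst T (X : Omega R d -> R) : 0 <= T -> Lip0_le T X -> L2rep T (iota X) (fun _ => X).
Proof.
move=> T0 HX; split => // [|e e0]; first exact: cvg_cst.
exists 0%N => m n _ _; rewrite (_ : (fun w => _) = fun=> 0) ?(E_cst HE) //.
by apply/funext => w; rewrite subrr expr0n.
Qed.

Lemma L2rep0 T : 0 <= T -> L2rep T 0 (fun _ _ => 0).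
Proof.
move=> T0; have HST := Lip0_le_stable d T0.
have h : Lip0_le T (fun _ : Omega R d => 0 : R) by stable_tac HST.
by rewrite -(iota0 HE HL); exact: L2rep_cst.
Qed.

(** If |z| <= K < |x| then x^2 - z^2 >= x^2 - K^2 >= (|x| - K)^2; if |x| <= K the left sides vanish.
    Closeness of x^2 to a bounded z^2 thus controls the part of x beyond K. *)
Lemma sqr_sub_trunc (K x z : R) : `|z| <= K ->
  (x - trunc K x) ^+ 2 <= `|x ^+ 2 - z ^+ 2| /\ `|x ^+ 2 - trunc K x ^+ 2| <= `|x ^+ 2 - z ^+ 2|.
Proof.
move=> zK; have K0 : 0 <= K by apply: le_trans zK.
have [xK|xK] := leP `|x| K.
  by rewrite trunc_id // !subrr normr0 expr2 mul0r; split; exact: normr_ge0.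
have z2 : z ^+ 2 <= K ^+ 2 by rewrite -real_normK ?num_real // ler_sqr ?nnegrE.
have x2 : x ^+ 2 = `|x| ^+ 2 by rewrite real_normK ?num_real.
have td : `|x - trunc K x| = `|x| - K by rewrite trunc_dist // max_r // subr_ge0 ltW.
have tx : (x - trunc K x) ^+ 2 = (`|x| - K) ^+ 2.
  by rewrite -real_normK ?num_real // td.
have t2 : trunc K x ^+ 2 = K ^+ 2.
  rewrite -real_normK ?num_real //; congr (_ ^+ 2); apply/eqP; rewrite eq_le trunc_norm_le //=.
  have := ler_normD (x - trunc K x) (trunc K x).
  by rewrite subrK td; lra.
have xK2 : K * K <= `|x| * K by rewrite ler_wpM2r // ltW.
have xx2 : `|x| * K <= `|x| * `|x| by rewrite ler_wpM2l // ltW.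
have p1 : 0 <= x ^+ 2 - K ^+ 2 by rewrite x2; lra.
split; apply: le_trans (ler_norm _); first by rewrite tx x2; lra.
by rewrite t2 (ger0_norm p1); lra.
Qed.

(** Split x - y into the two truncation errors and the difference of the truncations, whose square
    is at most 2 K |x - y|; the square of a sum of three terms costs a factor 3. *)
Lemma sqr_dist_trunc (K x y z : R) : `|z| <= K ->
  (x - y) ^+ 2 <= 6 * K * `|x - y| + 3 * `|x ^+ 2 - z ^+ 2| + 3 * `|y ^+ 2 - z ^+ 2|.
Proof.
move=> zK; have K0 : 0 <= K by apply: le_trans zK.
have [h1 _] := sqr_sub_trunc x zK; have [h2 _] := sqr_sub_trunc y zK.
set tx := trunc K x in h1 *; set ty := trunc K y in h2 *.
have h3 : (tx - ty) ^+ 2 <= 2 * K * `|x - y|.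
  rewrite -real_normK ?num_real // expr2; apply: ler_pM => //; last exact: trunc_lip.
  apply: le_trans (ler_normB _ _) _; rewrite mulr2n mulrDl mul1r.
  by apply: lerD; exact: trunc_norm_le.
have := sqr_ge0 ((x - tx) - (tx - ty)).
have := sqr_ge0 ((x - tx) + (y - ty)).
have := sqr_ge0 ((y - ty) + (tx - ty)); lra.
Qed.

(** L1 convergence of the squares makes them uniformly integrable. A late term X N1, bounded by K,
    serves as the reference z of [sqr_dist_trunc]; with K fixed, L1 closeness of X m and X n
    finishes. *)
Lemma L2rep_of_sq T P (U : L1) X : (forall n, Lip0_le T (X n)) -> 0 <= T ->
  iota (X n) @[n --> \oo] --> P -> iota (fun w => X n w ^+ 2) @[n --> \oo] --> U ->
  L2rep T P X.
Proof.
move=> HTX T0 XP XS; split => // e e0; have HX n := Lip0_le_Lip0 T0 (HTX n).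
have HX2 n : H (fun w => X n w ^+ 2) by stable_tac HS.
have V2 := iota_cvg_cauchy HL HX2 XS; have V1 := iota_cvg_cauchy HL HX XP.
have e9 : 0 < e / 9 by rewrite divr_gt0.
have [N1 HN1] := V2 _ e9.
have [K0 K00 HK] := Lip0_bounded (HX N1).
pose K := K0 + 1.
have K_gt0 : 0 < K by rewrite /K; lra.
have e18 : 0 < e / (18 * K) by rewrite divr_gt0 // mulr_gt0.
have [N2 HN2] := V1 _ e18.
exists (maxn N1 N2) => m n; rewrite !geq_max => /andP[m1 m2] /andP[n1 n2].
apply: le_lt_trans (_ : 6 * K * E (fun w => `|X m w - X n w|) +
  3 * E (fun w => `|X m w ^+ 2 - X N1 w ^+ 2|) +
  3 * E (fun w => `|X n w ^+ 2 - X N1 w ^+ 2|) < _).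
  apply: (E_le3 HE) => //; try (by stable_tac HS).
    by rewrite mulr_ge0 // ltW.
  by move=> w; apply: sqr_dist_trunc; apply: le_trans (HK w) _; rewrite /K; lra.
have a1 := HN1 m N1 m1 (leqnn _); have a2 := HN1 n N1 n1 (leqnn _).
have a3 := HN2 m n m2 n2.
have a4 : 6 * K * E (fun w => `|X m w - X n w|) < e / 3.
  have -> : e / 3 = (6 * K) * (e / (18 * K)) by field; rewrite gt_eqF.
  by rewrite ltr_pM2l // mulr_gt0.
move: a1 a2 a4; lra.
Qed.

(* The sequence that witnesses [is_sq] may depend on times after [T]; truncating an
   L1-approximation of [P] in [Lip0_le T] at a level fixed by the uniform
   integrability of the squares repairs this. *)
Lemma LG2_leP T P : 0 <= T -> LG2_le iota T P <-> exists X, L2rep T P X.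
Proof.
move=> T0; have HST := Lip0_le_stable d T0; split; last first.
  move=> [X rX]; have HX n := L2rep_Lip0 n T0 rX.
  split.
    by apply: (closure_cvgn _ (L2rep_cvg rX)) => n; exists (X n) => //; exact: L2rep_in rX n.
  exists (sqL iota P).
    apply: (closure_cvgn _ (L2rep_sq T0 rX)) => n; exists (fun w => X n w ^+ 2) => //.
    by have := L2rep_in rX n => ?; rewrite /=; stable_tac HST.
  exists X; split => //; first exact: L2rep_cvg rX.
  rewrite (_ : (fun n => _) = (fun n => iota (fun w => X n w ^+ 2))).
    exact: L2rep_sq rX.
  by apply/funext => n; congr iota; apply/funext => w; rewrite real_normK ?num_real.
move=> [/closure_seqP cP [U _ [X [HX XP XS0]]]].
have XS : iota (fun w => X n w ^+ 2) @[n --> \oo] --> U.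
  rewrite (_ : (fun n => _) = (fun n => iota (fun w => `|X n w| ^+ 2))) //.
  by apply/funext => n; congr iota; apply/funext => w; rewrite real_normK ?num_real.
have HX2 n : H (fun w => X n w ^+ 2) by stable_tac HS.
have V2 := iota_cvg_cauchy HL HX2 XS.
have approx (e : R) : 0 < e -> exists Y : Omega R d -> R, [/\ Lip0_le T Y, `|P - iota Y| < e &
    `|U - iota (fun w => Y w ^+ 2)| < e].
  move=> e0; pose e1 := e / 4.
  have e10 : 0 < e1 by rewrite divr_gt0.
  have [N1 HN1] := V2 _ e10.
  have [K0 K00 HK] := Lip0_bounded (HX N1).
  pose K := K0 + 1.
  have K1 : 1 <= K by rewrite /K; lra.
  have KK0 : 0 < K by lra.
  (* Since E|V - X n| < 2 del, the term 2 K E|V - X n| in the estimate of the squares stays below 4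
     K del = e1. *)
  pose del := e1 / (4 * K).
  have del0 : 0 < del by rewrite divr_gt0 // mulr_gt0.
  have delK : 4 * K * del = e1 by rewrite /del; field; rewrite gt_eqF.
  have dele1 : 4 * del <= e1 by rewrite -delK; have := ler_wpM2r (ltW del0) K1; lra.
  have [_ [V HV <-] PV] := cP _ del0.
  have HV0 := Lip0_le_Lip0 T0 HV.
  have [N2 HN2] := (iffLR (cvgnP _ _) XP) _ del0.
  have [N3 HN3] := (iffLR (cvgnP _ _) XS) _ e10.
  pose n := maxn N1 (maxn N2 N3).
  have n1 : (N1 <= n)%N by rewrite leq_maxl.
  have a2 := HN2 n (leq_trans (leq_maxl _ _) (leq_maxr _ _)).
  have a3 := HN3 n (leq_trans (leq_maxr _ _) (leq_maxr _ _)).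
  have a1 := HN1 n N1 n1 (leqnn _).
  have zK w : `|X N1 w| <= K by apply: le_trans (HK w) _; rewrite /K; lra.
  have a4 : E (fun w => `|V w - X n w|) < 2 * del.
    rewrite -(iota_dist HL) //.
    rewrite (_ : iota V - iota (X n) = (P - iota (X n)) - (P - iota V)).
      by apply: le_lt_trans (ler_normB _ _) _; lra.
    by rewrite opprB [RHS]addrC addrA subrK.
  have dist_tx w : `|trunc K (V w) - X n w| <=
      1 * `|V w - X n w| + 1 * `|X n w ^+ 2 - X N1 w ^+ 2|.
    rewrite (_ : trunc K (V w) - X n w =
      (trunc K (V w) - trunc K (X n w)) + (trunc K (X n w) - X n w)); last by ring.
    apply: le_trans (ler_normD _ _) _; rewrite !mul1r lerD ?trunc_lip //.
    rewrite distrC trunc_dist; last by lra.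
    have [xK|xK] := leP `|X n w| K; first by rewrite max_l // subr_le0.
    rewrite max_r; last by rewrite subr_ge0 ltW.
    have [_ h] := sqr_sub_trunc (X n w) (zK w); apply: le_trans h.
    have t2 : trunc K (X n w) ^+ 2 <= K ^+ 2.
      by rewrite -real_normK ?num_real // ler_sqr ?nnegrE ?trunc_norm_le //; lra.
    apply: le_trans (ler_norm _).
    rewrite -[X n w ^+ 2]real_normK ?num_real //.
    (* This is where K >= 1 enters: the factor |X n| + K is at least 1, so the excess over K is
       dominated by the excess of the squares. *)
    have h2 : (`|X n w| - K) * 1 <= (`|X n w| - K) * (`|X n w| + K).
      by rewrite ler_wpM2l //; [rewrite subr_ge0 ltW|lra].
    lra.
  have dist_tx2 w : `|trunc K (V w) ^+ 2 - X n w ^+ 2| <=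
      2 * K * `|V w - X n w| + 1 * `|X n w ^+ 2 - X N1 w ^+ 2|.
    rewrite (_ : trunc K (V w) ^+ 2 - X n w ^+ 2 =
      (trunc K (V w) ^+ 2 - trunc K (X n w) ^+ 2) + (trunc K (X n w) ^+ 2 - X n w ^+ 2)); last by ring.
    apply: le_trans (ler_normD _ _) _; rewrite mul1r lerD //; last first.
      by rewrite distrC; have [_ h] := sqr_sub_trunc (X n w) (zK w).
    rewrite subr_sqr normrM mulrC; apply: ler_pM => //; last exact: trunc_lip.
    apply: le_trans (ler_normD _ _) _; rewrite mulr2n mulrDl mul1r.
    by apply: lerD; apply: trunc_norm_le; lra.
  have HY : Lip0_le T (fun w => trunc K (V w)) by stable_tac HST.
  have HY0 := Lip0_le_Lip0 T0 HY.
  exists (fun w => trunc K (V w)); split => //.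
    rewrite (_ : P - _ = (P - iota (X n)) - (iota (fun w => trunc K (V w)) - iota (X n))); last first.
      by rewrite opprB addrA subrK.
    apply: le_lt_trans (ler_normB _ _) _; rewrite (iota_dist HL) //.
    have : E (fun w => `|trunc K (V w) - X n w|) <=
        1 * E (fun w => `|V w - X n w|) + 1 * E (fun w => `|X n w ^+ 2 - X N1 w ^+ 2|).
      by apply: (E_le2 HE) => //; stable_tac HS.
    by move: a1 a2 a4 dele1; rewrite /e1; lra.
  rewrite (_ : U - _ = (U - iota (fun w => X n w ^+ 2)) -
     (iota (fun w => trunc K (V w) ^+ 2) - iota (fun w => X n w ^+ 2))); last first.
    by rewrite opprB addrA subrK.
  apply: le_lt_trans (ler_normB _ _) _; rewrite (iota_dist HL) //; last by stable_tac HS.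
  have : E (fun w => `|trunc K (V w) ^+ 2 - X n w ^+ 2|) <=
      2 * K * E (fun w => `|V w - X n w|) + 1 * E (fun w => `|X n w ^+ 2 - X N1 w ^+ 2|).
    by apply: (E_le2 HE) => //; try (by stable_tac HS); lra.
  have : 2 * K * E (fun w => `|V w - X n w|) <= 2 * K * (2 * del).
    by rewrite ler_wpM2l //; lra.
  by move: a1 a3 delK; rewrite /e1; lra.
have /choice[Y HY] : forall n : nat, exists Y : Omega R d -> R, [/\ Lip0_le T Y, `|P - iota Y| < n.+1%:R^-1 &
    `|U - iota (fun w => Y w ^+ 2)| < n.+1%:R^-1] by move=> n; apply: approx.
exists Y; apply: (@L2rep_of_sq T P U) => //.
- by move=> n; have [] := HY n.
- apply: (@cvgn_squeeze _ _ (fun=> P) _ _ (fun n => n.+1%:R^-1) (cvg_cst _) (@cvgn_inv R)).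
  by move=> n; apply: ltW; have [] := HY n.
- apply: (@cvgn_squeeze _ _ (fun=> U) _ _ (fun n => n.+1%:R^-1) (cvg_cst _) (@cvgn_inv R)).
  by move=> n; apply: ltW; have [] := HY n.
Qed.

Lemma LG2_le_mono S T P : 0 <= S -> S <= T -> LG2_le iota S P -> LG2_le iota T P.
Proof.
move=> S0 ST /(LG2_leP _ S0)[X rX]; apply/LG2_leP; first exact: le_trans ST.
by exists X; exact: L2rep_mono rX.
Qed.

Lemma LG2_le_lin T c P Q : 0 <= T -> LG2_le iota T P -> LG2_le iota T Q ->
  LG2_le iota T (c *: P + Q).
Proof.
move=> T0 /(LG2_leP _ T0)[X rX] /(LG2_leP _ T0)[Y rY].
by apply/LG2_leP => //; exists (fun n w => c * X n w + Y n w); exact: L2rep_lin.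
Qed.

Lemma LG2_le0 T : 0 <= T -> LG2_le iota T 0.
Proof. by move=> T0; apply/LG2_leP => //; exists (fun _ _ => 0); exact: L2rep0. Qed.

End L2.

Lemma subr_subr_dist (V : zmodType) (p q x y : V) : p - q - ((p - x) - (q - y)) = x - y.
Proof.
by rewrite [- (_ - (q - y))]opprB addrA [p - q + _]addrA subrK opprB addrC addrA subrK.
Qed.

(** * Closedness of L_G^2 and bilinearity of the product *)

Section L2Closed.
Variables (R : realType) (d : nat) (E : (Omega R d -> R) -> R).
Hypothesis HE : sublinear_expectation (@Lip0 R d) E.
Variables (L1 : completeNormedModType R) (iota : (Omega R d -> R) -> L1).
Hypothesis HL : is_completion (@Lip0 R d) (fun X => E (fun w => `|X w|)) iota.
Variables (T : R) (T_ge0 : 0 <= T).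
Local Notation H := (@Lip0 R d).
Local Notation L2 := (LG2_le iota T).
Local Notation L2rep := (L2rep E iota).
Local Notation E2 := (E2 E iota).
Let HS := @Lip0_stable R d.
Let HST := @Lip0_le_stable R d _ T_ge0.
Implicit Types (X Y Z : nat -> Omega R d -> R) (P Q : L1).

Lemma E2_ge0 P : L2 P -> 0 <= E2 P.
Proof.
move=> /(LG2_leP HE HL P T_ge0)[X rX].
apply: (@cvgn_ge _ _ _ _ 0 (L2rep_E2 HE HL T_ge0 rX)) => n _.
have HX := L2rep_Lip0 n T_ge0 rX.
by apply: (E_ge0 HE) => [|w]; [stable_tac HS|exact: sqr_ge0].
Qed.

Lemma sqr_norm_le_E2 P : L2 P -> `|P| ^+ 2 <= E2 P.
Proof.
move=> /(LG2_leP HE HL P T_ge0)[X rX].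
have HX n := L2rep_Lip0 n T_ge0 rX.
have h1 : `|iota (X n)| ^+ 2 @[n --> \oo] --> `|P| ^+ 2.
  rewrite expr2; under eq_cvg do rewrite expr2.
  by apply: cvgM; apply: cvg_norm; exact: L2rep_cvg rX.
apply: (cvgn_le_cvgn h1 (L2rep_E2 HE HL T_ge0 rX)) => n.
by rewrite (iota_norm HL) //; exact: E_sqr_norm.
Qed.

Lemma E2_lin_le c P Q : L2 P -> L2 Q -> E2 (c *: P + Q) <= 2 * c ^+ 2 * E2 P + 2 * E2 Q.
Proof.
move=> /(LG2_leP HE HL P T_ge0)[X rX] /(LG2_leP HE HL Q T_ge0)[Y rY].
have HX n := L2rep_Lip0 n T_ge0 rX; have HY n := L2rep_Lip0 n T_ge0 rY.
have h1 := L2rep_E2 HE HL T_ge0 (L2rep_lin HE HL c T_ge0 rX rY).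
have h2 : 2 * c ^+ 2 * E (fun w => X n w ^+ 2) + 2 * E (fun w => Y n w ^+ 2) @[n --> \oo]
    --> 2 * c ^+ 2 * E2 P + 2 * E2 Q.
  by apply: cvgD; apply: cvgMl_tmp; [exact: L2rep_E2 rX|exact: L2rep_E2 rY].
apply: (cvgn_le_cvgn h1 h2) => n.
apply: (E_le2 HE) => //; try (by stable_tac HS).
  by rewrite mulr_ge0 // sqr_ge0.
by move=> w; have := sqr_ge0 (c * X n w - Y n w); lra.
Qed.

Lemma E2_sub_le P Q : L2 P -> L2 Q -> E2 (P - Q) <= 2 * E2 P + 2 * E2 Q.
Proof.
move=> LP LQ; have := E2_lin_le (-1) LQ LP.
by rewrite scaleN1r addrC sqrrN expr1n; lra.
Qed.

Lemma LG2_leB P Q : L2 P -> L2 Q -> L2 (P - Q).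
Proof. by move=> LP LQ; rewrite addrC -scaleN1r; exact: (LG2_le_lin HE HL). Qed.

Lemma LG2_leD P Q : L2 P -> L2 Q -> L2 (P + Q).
Proof. by move=> LP LQ; rewrite -[P]scale1r; exact: (LG2_le_lin HE HL). Qed.

Lemma LG2_le_iota (X : Omega R d -> R) : Lip0_le T X -> L2 (iota X).
Proof. by move=> HX; apply/(LG2_leP HE HL) => //; exists (fun _ => X); exact: L2rep_cst. Qed.

Lemma E2_iota (X : Omega R d -> R) : Lip0_le T X -> E2 (iota X) = E (fun w => X w ^+ 2).
Proof.
move=> HX; apply: (cvgn_uniq (L2rep_E2 HE HL T_ge0 (L2rep_cst HE iota T_ge0 HX))).
exact: cvg_cst.
Qed.

Lemma E2_approx P (e : R) : L2 P -> 0 < e ->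
  exists X : Omega R d -> R, [/\ Lip0_le T X, `|P - iota X| < e & E2 (P - iota X) < e].
Proof.
move=> LP e0; have /(LG2_leP HE HL P T_ge0)[X rX] := LP.
have e20 : 0 < e / 2 by rewrite divr_gt0.
have [N1 HN1] := (iffLR (cvgnP _ _) (L2rep_cvg rX)) _ e0.
have [N2 HN2] := L2rep_cauchy rX e20.
pose N := maxn N1 N2; exists (X N); split; first exact: L2rep_in rX N.
  by apply: HN1; rewrite leq_maxl.
have rN := L2rep_cst HE iota T_ge0 (L2rep_in rX N).
have := L2rep_E2 HE HL T_ge0 (L2rep_lin HE HL (-1) T_ge0 rN rX).
rewrite scaleN1r addrC => h.
apply: le_lt_trans (_ : _ <= e / 2) _; last by lra.
apply: (@cvgn_le _ _ _ _ N2 h).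
move=> n Nn; have := HN2 n N Nn (leq_maxr _ _).
rewrite (_ : (fun w => (-1 * X N w + X n w) ^+ 2) = (fun w => (X n w - X N w) ^+ 2)); first exact: ltW.
by apply/funext => w; rewrite mulN1r addrC.
Qed.

(** Diagonal argument: each P n is replaced by a cylinder variable within 1 / (n + 1) of it in both
    senses. The factor 2 comes from (p - q)^2 <= 2 p^2 + 2 q^2, used in place of a triangle
    inequality; the bound only serves to prove continuity of the extended integral. *)
Lemma LG2_closed (P : nat -> L1) Q : (forall n, L2 (P n)) -> P @ \oo --> Q ->
  vanish (fun m n => E2 (P m - P n)) ->
  L2 Q /\ forall C N, (forall n, (N <= n)%N -> E2 (P n) <= C) -> E2 Q <= 2 * C.
Proof.
move=> LP PQ V.
have /choice[Y HY] : forall n : nat, exists Y : Omega R d -> R, [/\ Lip0_le T Y,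
    `|P n - iota Y| < n.+1%:R^-1 & E2 (P n - iota Y) < n.+1%:R^-1].
  by move=> n; apply: E2_approx.
have inY n : Lip0_le T (Y n) by have [] := HY n.
have LY n : L2 (iota (Y n)) by exact: LG2_le_iota.
have HYn n : H (Y n) by exact: Lip0_le_Lip0 (inY n).
have LPY n : L2 (P n - iota (Y n)) by exact: LG2_leB.
have inv0 := @cvgn_inv R.
have rY : L2rep T Q Y.
  split => //.
    apply: (cvgn_squeeze PQ inv0) => n.
    by apply: ltW; have [] := HY n.
  have D := vanishD (vanishD (vanishZ (ler0n R 4) (vanish_cvgl inv0))
    (vanishZ (ler0n R 4) (vanish_cvgr inv0))) (vanishZ (ler0n R 2) V).
  apply: vanish_le D => m n.
  have -> : E (fun w => (Y m w - Y n w) ^+ 2) = E2 (iota (Y m) - iota (Y n)).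
    rewrite -(iotaB HL) // E2_iota //.
    by have := inY m; have := inY n => ? ?; stable_tac HST.
  have -> : iota (Y m) - iota (Y n) =
      (P m - P n) - ((P m - iota (Y m)) - (P n - iota (Y n))).
    by rewrite subr_subr_dist.
  have h1 := E2_sub_le (LG2_leB (LP m) (LP n)) (LG2_leB (LPY m) (LPY n)).
  have h2 := E2_sub_le (LPY m) (LPY n).
  have [_ _ h3] := HY m; have [_ _ h4] := HY n.
  move: h1 h2 h3 h4; move: (m.+1%:R^-1 : R) (n.+1%:R^-1 : R) => p q; lra.
split; first by apply/(LG2_leP HE HL) => //; exists Y.
move=> C N HC.
have h1 := L2rep_E2 HE HL T_ge0 rY.
have h2 : 2 * C + 2 * n.+1%:R^-1 @[n --> \oo] --> 2 * C + 2 * 0.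
  by apply: cvgD; [exact: cvg_cst|apply: cvgMl_tmp; exact: inv0].
rewrite mulr0 addr0 in h2.
have h3 : 2 * C + 2 * n.+1%:R^-1 - E (fun w => Y n w ^+ 2) @[n --> \oo] --> 2 * C - E2 Q.
  exact: cvgB.
rewrite -subr_ge0; apply: (@cvgn_ge _ _ _ _ N h3) => n Nn; rewrite subr_ge0 -E2_iota //.
have -> : iota (Y n) = P n - (P n - iota (Y n)) by rewrite opprB addrC subrK.
apply: le_trans (E2_sub_le (LP n) (LPY n)) _.
have [_ _] := HY n; have := HC n Nn; move: (n.+1%:R^-1 : R) => q; lra.
Qed.

Lemma mulL_linl c P P' Q : L2 P -> L2 P' -> L2 Q ->
  mulL iota (c *: P + P') Q = c *: mulL iota P Q + mulL iota P' Q.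
Proof.
move=> /(LG2_leP HE HL P T_ge0)[X rX] /(LG2_leP HE HL P' T_ge0)[X' rX'].
move=> /(LG2_leP HE HL Q T_ge0)[Y rY].
have HX n := L2rep_Lip0 n T_ge0 rX; have HY n := L2rep_Lip0 n T_ge0 rY.
have HX' n := L2rep_Lip0 n T_ge0 rX'.
have h := L2rep_mul HE HL T_ge0 T_ge0 (L2rep_lin HE HL c T_ge0 rX rX') rY.
apply: (cvgn_uniq h).
rewrite (_ : (fun n => _) = (fun n => c *: iota (fun w => X n w * Y n w) + iota (fun w => X' n w * Y n w))).
  by apply: cvgD; [apply: cvgZl_tmp|]; apply: (L2rep_mul HE HL T_ge0 T_ge0).
apply/funext => n; rewrite -(iota_lin HL); [|by stable_tac HS|by stable_tac HS].
by congr iota; apply/funext => w; rewrite mulrDl mulrA.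
Qed.

Lemma mulLC P Q : L2 P -> L2 Q -> mulL iota P Q = mulL iota Q P.
Proof.
move=> /(LG2_leP HE HL P T_ge0)[X rX] /(LG2_leP HE HL Q T_ge0)[Y rY].
apply: (cvgn_uniq (L2rep_mul HE HL T_ge0 T_ge0 rX rY)).
rewrite (_ : (fun n => _) = (fun n => iota (fun w => Y n w * X n w))).
  exact: (L2rep_mul HE HL T_ge0 T_ge0 rY rX).
by apply/funext => n; congr iota; apply/funext => w; rewrite mulrC.
Qed.

Lemma mulL_linr c P Q Q' : L2 P -> L2 Q -> L2 Q' ->
  mulL iota P (c *: Q + Q') = c *: mulL iota P Q + mulL iota P Q'.
Proof.
move=> LP LQ LQ'; rewrite mulLC //; last exact: (LG2_le_lin HE HL).
by rewrite mulL_linl // !(mulLC LP).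
Qed.

Lemma mulL0 P : L2 P -> mulL iota P 0 = 0.
Proof.
move=> LP; have L0 : L2 0 by exact: (LG2_le0 HE HL).
have := mulL_linr 1 LP L0 L0; rewrite !scale1r addr0 => /eqP.
by rewrite -subr_eq0 opprD addNKr oppr_eq0 => /eqP.
Qed.

Lemma mulL_sumr (I : Type) (r : seq I) P (Q : I -> L1) : L2 P -> (forall i, L2 (Q i)) ->
  mulL iota P (\sum_(i <- r) Q i) = \sum_(i <- r) mulL iota P (Q i).
Proof.
move=> LP LQ.
suff : L2 (\sum_(i <- r) Q i) /\ mulL iota P (\sum_(i <- r) Q i) = \sum_(i <- r) mulL iota P (Q i) by case.
elim: r => [|i r [IH1 IH2]]; first by rewrite !big_nil mulL0 //; split => //; exact: (LG2_le0 HE HL).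
rewrite !big_cons; split; first exact: LG2_leD.
by rewrite -[Q i]scale1r mulL_linr // IH2 !scale1r.
Qed.

End L2Closed.

(** * Increments of B *)

Section Increments.
Variables (R : realType) (d : nat) (Gam : set 'M[R]_d).
Hypotheses (Gam_nonempty : Gam !=set0) (Gam_bounded : bounded_set Gam).
Variables (E : (Omega R d -> R) -> R).
Hypothesis E_Gexp : G_expectation Gam E.
Variable a : 'cV[R]_d.
Local Notation sg := (sigma Gam (a *m a^T)).
Let HE := Gexp_sublinear E_Gexp.
Let HS := @Lip0_stable R d.
Implicit Types (s t : R) (psi : 'cV[R]_d -> R) (X : Omega R d -> R).

Lemma E_increment_le (b e g C : R) psi s t : lip psi -> 0 <= s -> s <= t ->
  0 <= e -> 0 <= g -> (forall y, - C <= b * y + e * y ^+ 2) ->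
  (forall x, psi x <= b * dot a x + e * dot a x ^+ 2 + g * dot a x ^+ 4) ->
  E (fun w => psi (B t w - B s w)) <= e * (sg * (t - s)) + g * (3 * sg ^+ 2 * (t - s) ^+ 2).
Proof.
move=> Lpsi s0 st e0 g0 HC Hpsi.
have ts0 : 0 <= t - s by rewrite subr_ge0.
have [u PGu Hu] := Gexp_increment E_Gexp Lpsi.
have [+ _] := Hu s (t - s) s0 ts0; rewrite subrK => ->.
exact: heat_comparison.
Qed.

Lemma lip_trunc_dot (c : R) : 0 <= c -> lip (fun x => trunc c (dot a x)).
Proof.
move=> c0; split; first by exists c => x; exact: trunc_norm_le.
have [K [K0 HK]] := dot_lip a; exists K => x y.
by apply: le_trans (trunc_lip _ _ _) _; rewrite -dotBr.
Qed.

(* Truncation at level n + 1 rather than n, so that the bounds in 1 / (n + 1) also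
   hold at n = 0. *)
Definition incr s t (n : nat) (w : Omega R d) : R := trunc n.+1%:R (dot a (B t w - B s w)).

Lemma Lip0_le_incr s t n : 0 <= s -> s <= t -> Lip0_le t (incr s t n).
Proof.
move=> s0 st; apply: (Lip0_le_increment (psi := fun x => trunc n.+1%:R (dot a x))) => //.
exact: lip_trunc_dot.
Qed.

Lemma Lip0_incr s t n : 0 <= s -> s <= t -> Lip0 (incr s t n).
Proof. by move=> s0 st; apply: Lip0_le_Lip0 (Lip0_le_incr n s0 st); exact: le_trans st. Qed.

Lemma trunc_dist_le (c y : R) : 0 < c -> `|y - trunc c y| <= c^-1 * y ^+ 2.
Proof.
move=> c0; rewrite (trunc_dist _ (ltW c0)) -real_normK ?num_real // ge_max.
apply/andP; split; first by rewrite mulr_ge0 ?sqr_ge0 // invr_ge0 ltW.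
rewrite mulrC ler_pdivlMr //.
have [yc|yc] := leP `|y| c.
  by apply: le_trans (_ : 0 <= _); rewrite ?sqr_ge0 // mulr_le0_ge0 ?subr_le0 // ltW.
have : `|y| * c <= `|y| * `|y| by rewrite ler_wpM2l // ltW.
have : 0 <= c * c by rewrite mulr_ge0 // ltW.
by rewrite expr2; lra.
Qed.

Lemma E_sqr_incr_le s t n : 0 <= s -> s <= t ->
  E (fun w => incr s t n w ^+ 2) <= sg * (t - s).
Proof.
move=> s0 st.
have L := @lip_trunc_dot n.+1%:R (ler0n _ _).
have := @E_increment_le 0 1 0 0 (fun x => trunc n.+1%:R (dot a x) ^+ 2) s t
  (stableX (lip_stable _) 2 L) s0 st ler01 (lexx _).
rewrite mul1r mul0r addr0; apply.
  by move=> y; rewrite oppr0 mul0r add0r mul1r sqr_ge0.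
move=> x; rewrite !mul0r add0r addr0 mul1r -real_normK ?num_real //.
rewrite -[leRHS]real_normK ?num_real // ler_sqr ?nnegrE //.
exact: trunc_norm_le_id.
Qed.

(** With N = n + 1, the error |y - trunc N y| is at most y^2 / N, so c trunc N y <= c y + (|c| / N)
    y^2, to which the comparison applies for either sign of c. *)
Lemma E_mul_incr_le (c : R) s t n : 0 <= s -> s <= t ->
  E (fun w => c * incr s t n w) <= `|c| * (sg * (t - s) / n.+1%:R).
Proof.
move=> s0 st; have n0 : 0 < n.+1%:R :> R by rewrite ltr0n.
have L := @lip_trunc_dot n.+1%:R (ler0n _ _).
have ST := @lip_stable R 'cV[R]_d.
have Lc : lip (fun x => c * trunc n.+1%:R (dot a x)) by stable_tac ST.
have e0 : 0 <= `|c| / n.+1%:R by rewrite divr_ge0 // ltW.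
have := @E_increment_le c (`|c| / n.+1%:R) 0 (`|c| * n.+1%:R) _ s t Lc s0 st e0 (lexx _).
rewrite mul0r addr0 (_ : `|c| / n.+1%:R * (sg * (t - s)) = `|c| * (sg * (t - s) / n.+1%:R)); last first.
  by rewrite -mulrA [_^-1 * _]mulrC.
apply.
  (* Completing the square at |y| = (n + 1) / 2 bounds the majorant below by -|c| (n + 1) / 4. *)
  move=> y; rewrite -subr_ge0 opprK.
  have h1 : 0 <= `|c| / n.+1%:R * (`|y| - n.+1%:R / 2) ^+ 2 by rewrite mulr_ge0 ?sqr_ge0.
  have h2 : `|c| / n.+1%:R * (`|y| - n.+1%:R / 2) ^+ 2 =
     `|c| / n.+1%:R * y ^+ 2 - `|c| * `|y| + `|c| * n.+1%:R / 4.
    by rewrite -[y ^+ 2]real_normK ?num_real //; field; rewrite gt_eqF.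
  have h3 : 0 <= `|c| * n.+1%:R by rewrite mulr_ge0 // ltW.
  have h4 : - (`|c| * `|y|) <= c * y by rewrite -normrM; have := ler_norm (- (c * y)); rewrite normrN; lra.
  by move: h1; rewrite h2; move: h3 h4; move: (`|c| / _ * _) => p; lra.
move=> x; rewrite mul0r addr0 addrC -lerBlDr -mulrBr.
apply: le_trans (ler_norm _) _; rewrite normrM -mulrA ler_wpM2l // distrC.
exact: trunc_dist_le.
Qed.

(** The squared truncation error at level k + 1 is at most y^4 / (k + 1), and the fourth moment of
    the increment is finite. The constant C = 3 sigma^2 (t - s)^2 is the fourth moment of a centred
    Gaussian of variance sigma (t - s). *)
Lemma vanish_incr s t : 0 <= s -> s <= t ->
  vanish (fun m n => E (fun w => (incr s t m w - incr s t n w) ^+ 2)).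
Proof.
move=> s0 st; pose C := 3 * sg ^+ 2 * (t - s) ^+ 2.
have C0 : 0 <= C by rewrite /C mulr_ge0 ?sqr_ge0 // mulr_ge0 ?sqr_ge0.
have inv0 := @cvgn_inv R.
have D := vanishZ C0 (vanishD (vanishZ (ler0n R 2) (vanish_cvgl inv0))
    (vanishZ (ler0n R 2) (vanish_cvgr inv0))).
apply: vanish_le D => m n.
have Lm := @lip_trunc_dot m.+1%:R (ler0n _ _).
have Ln := @lip_trunc_dot n.+1%:R (ler0n _ _).
have ST := @lip_stable R 'cV[R]_d.
have L : lip (fun x => (trunc m.+1%:R (dot a x) - trunc n.+1%:R (dot a x)) ^+ 2) by stable_tac ST.
have g0 : 0 <= 2 / m.+1%:R + 2 / n.+1%:R :> R by rewrite addr_ge0 // divr_ge0.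
have := @E_increment_le 0 0 (2 / m.+1%:R + 2 / n.+1%:R) 0 _ s t L s0 st (lexx _) g0.
rewrite mul0r add0r -/C [C * _]mulrC; apply.
  by move=> y; rewrite !mul0r addr0 oppr0.
move=> x; rewrite !mul0r !add0r; set y := dot a x.
have sqd k : (y - trunc k.+1%:R y) ^+ 2 <= k.+1%:R^-1 * y ^+ 4.
  rewrite -real_normK ?num_real //.
  have k0 : 0 < k.+1%:R :> R by rewrite ltr0n.
  have h := trunc_dist_le y k0.
  apply: le_trans (_ : (k.+1%:R^-1 * y ^+ 2) ^+ 2 <= _).
    by rewrite ler_sqr ?nnegrE // mulr_ge0 ?sqr_ge0 // invr_ge0 ltW.
  rewrite exprMn -exprM ler_wpM2r ?exprn_even_ge0 //.
  by rewrite expr2 ler_piMl ?invr_ge0 ?ler0n // invf_le1 // ler1n.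
have := sqd m; have := sqd n.
have := sqr_ge0 ((y - trunc m.+1%:R y) + (y - trunc n.+1%:R y)).
rewrite mulrDl -!mulrA; move: (m.+1%:R^-1 * _) (n.+1%:R^-1 * _) (trunc _ _) (trunc _ _) => p q u v.
lra.
Qed.

End Increments.

(* The grid of times required by [Gexp_step]: strictly increasing and ending at s. *)
Lemma Lip0_le_sorted (R : realType) (d : nat) (s : R) (X : Omega R d -> R) :
  0 <= s -> Lip0_le s X ->
  exists (m : nat) (t : nat -> R) (phi : 'M[R]_(d, m.+1) -> R),
    [/\ 0 <= t 0, forall k, (k < m)%N -> t k < t k.+1, t m = s, lip phi &
        X = (fun w => phi (Bmx (fun k : 'I_m.+1 => t k) w))].
Proof.
move=> s0 [m [t [phi [m0 ts Lphi ->]]]].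
pose l := sort <=%R (undup (s :: codom t)).
have meml x : (x \in l) = (x == s) || (x \in codom t).
  by rewrite mem_sort mem_undup inE.
have sl : s \in l by rewrite meml eqxx.
have tl j : t j \in l by rewrite meml codom_f orbT.
have lbnd x : x \in l -> 0 <= x <= s.
  by rewrite meml => /orP[/eqP ->|/codomP[j ->]]; rewrite ?s0 ?lexx // ts.
have sorted_l : sorted <%R l.
  by rewrite lt_sorted_uniq_le sort_uniq undup_uniq sort_le_sorted.
have : (0 < size l)%N by case: (l) sl.
case El : (size l) => [//|M] _.
have ltM (x : R) : x \in l -> (index x l < M.+1)%N by rewrite -El index_mem.
(* Repeated and unordered times are absorbed here: each old index goes to the place of its time in
   the sorted list, and selecting columns is 1-Lipschitz in the maximum norm. *)
pose sig j := Ordinal (ltM _ (tl j)).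
exists M, (nth 0 l), (phi \o colsub sig); split.
- by have /andP[] : 0 <= nth 0 l 0 <= s by apply: lbnd; rewrite mem_nth // El.
- by move=> k kM; apply: (sorted_ltn_nth lt_trans 0 sorted_l); rewrite ?inE ?El // ltnW.
- apply/eqP; rewrite eq_le.
  have /andP[_ ->] /= : 0 <= nth 0 l M <= s by apply: lbnd; rewrite mem_nth // El.
  rewrite -{1}(nth_index 0 sl).
  have := ltM _ sl; rewrite ltnS leq_eqVlt => /orP[/eqP -> //|lt].
  by apply/ltW/(sorted_ltn_nth lt_trans 0 sorted_l); rewrite ?inE ?El // ltnW // ltM.
- apply: (lip_comp (K := 1)) => // x y; rewrite mul1r; apply: mx_norm_le => // i j.
  by have := coord_le_norm (x - y) i (sig j); rewrite !mxE.
- apply/funext => w /=; congr phi; apply/matrixP => i j.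
  by rewrite !mxE /= nth_index.
Qed.

(** * Independence of increments from the past *)

Section Independence.
Variables (R : realType) (d : nat) (Gam : set 'M[R]_d).
Variables (E : (Omega R d -> R) -> R).
Hypothesis E_Gexp : G_expectation Gam E.
Let HE := Gexp_sublinear E_Gexp.
Let HS := @Lip0_stable R d.
Implicit Types (s t : R) (psi : 'cV[R]_d -> R) (X : Omega R d -> R).

(** [Gexp_step] on the grid of X extended by t. Its integrand sees B_t, so [phi'] subtracts the last
    column of the past, which is B_s; in the step the same column is added to the increment, and the
    two cancel. *)
Lemma E_independent X psi s t : 0 <= s -> s < t -> Lip0_le s X -> lip psi ->
  E (fun w => X w * psi (B t w - B s w)) =
  E (fun w => E (fun w' => X w * psi (B t w' - B s w'))).
Proof.
move=> s0 st HX Lpsi.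
have [m [u [phi [u0 ulin um Lphi ->]]]] := Lip0_le_sorted s0 HX.
pose u' k := if (k <= m)%N then u k else t.
pose phi' (z : 'M[R]_(d, m.+1 + 1)) :=
  phi (lsubmx z) * psi (rsubmx z - col ord_max (lsubmx z)).
have lphi' : lip phi'.
  apply: (lip_comp2 (f := phi \o lsubmx)
    (g := psi \o (fun z => rsubmx z - col ord_max (lsubmx z))) (@locally_lip2_mul R)).
    apply: (lip_comp (K := 1)) => // x y; rewrite mul1r; apply: mx_norm_le => // i j.
    by rewrite !mxE; have := coord_le_norm (x - y) i (lshift 1 j); rewrite !mxE.
  apply: (lip_comp (K := 2)) => // x y; apply: mx_norm_le => [|i j]; first by rewrite mulr_ge0.
  have := coord_le_norm (x - y) i (rshift m.+1 j).
  have := coord_le_norm (x - y) i (lshift 1 ord_max).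
  rewrite !mxE; move: (x _ _) (y _ _) (x _ _) (y _ _) `|x - y| => p q p' q' n h1 h2.
  rewrite (_ : p - p' - (q - q') = (p - q) - (p' - q')); last by ring.
  by apply: le_trans (ler_normB _ _) _; lra.
have u'0 : 0 <= u' 0 by [].
have u'lin k : (k <= m)%N -> u' k < u' k.+1.
  rewrite /u' => km; rewrite km; case: ltnP => [|mk]; first exact: ulin.
  by rewrite (_ : k = m) ?um //; apply/eqP; rewrite eqn_leq km.
have := Gexp_step E_Gexp lphi' u'0 u'lin.
have u'm : u' m = s by rewrite /u' leqnn.
have u'm1 : u' m.+1 = t by rewrite /u' ltnn.
have BE w : lsubmx (Bmx (fun k : 'I_(m.+1 + 1) => u' k) w) = Bmx (fun k : 'I_m.+1 => u k) w.
  by apply/matrixP => i j; rewrite !mxE /= /u' -ltnS ltn_ord.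
have BE2 w : Bmx (fun k : 'I_m.+1 => u' k) w = Bmx (fun k : 'I_m.+1 => u k) w.
  by apply/matrixP => i j; rewrite !mxE /= /u' -ltnS ltn_ord.
rewrite u'm u'm1 /phi' => H.
rewrite [LHS](_ : _ = E (fun w => phi (lsubmx (Bmx (fun k : 'I_(m.+1 + 1) => u' k) w)) *
  psi (rsubmx (Bmx (fun k : 'I_(m.+1 + 1) => u' k) w) -
       col ord_max (lsubmx (Bmx (fun k : 'I_(m.+1 + 1) => u' k) w))))).
  rewrite H; congr E; apply/funext => w; congr E; apply/funext => w'.
  by rewrite BE2 row_mxKl row_mxKr addrK.
congr E; apply/funext => w; rewrite BE; congr (_ * psi _).
by apply/matrixP => i j; rewrite !mxE ord1 /= /u' addn0 ltnn um.
Qed.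

(** The coefficients are the positive and negative parts of c. Written out, they show that E[c X]
    stays a [Lip0] variable when c is replaced by one, as [E_independent_le] requires. *)
Lemma E_signed_scale (c : R) X : Lip0 X ->
  E (fun w => c * X w) = (`|c| + c) / 2 * E X + (`|c| - c) / 2 * E (fun w => - X w).
Proof.
move=> HX; have HN : Lip0 (fun w => - X w) by stable_tac HS.
have [c0|c0] := leP 0 c.
  by rewrite (E_scale HE) // ger0_norm // subrr mul0r mul0r addr0; congr (_ * _); lra.
rewrite ltr0_norm // addNr mul0r mul0r add0r.
rewrite (_ : (fun w => c * X w) = (fun w => - c * - X w)).
  by rewrite (E_scale HE) //; [congr (_ * _); lra|rewrite oppr_ge0 ltW].
by apply/funext => w; rewrite mulrNN.
Qed.

(** X >= 0 lets the inner expectation release X by positive homogeneity, and psi >= 0 lets the outer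
    one release the mean of psi. *)
Lemma E_independent_ge0 X psi s t : 0 <= s -> s < t -> Lip0_le s X -> lip psi ->
  (forall w, 0 <= X w) -> (forall x, 0 <= psi x) ->
  E (fun w => X w * psi (B t w - B s w)) = E X * E (fun w => psi (B t w - B s w)).
Proof.
move=> s0 st HX Lpsi X0 psi0; rewrite E_independent //.
have Hpsi : Lip0 (fun w => psi (B t w - B s w)).
  by apply: (@Lip0_le_Lip0 _ _ t); [exact: le_trans (ltW st)|exact: Lip0_le_increment (ltW st) _].
have HX0 := Lip0_le_Lip0 s0 HX.
under [X in E X]eq_fun do rewrite (E_scale HE) //.
rewrite mulrC -(E_scale HE) //; last exact: (E_ge0 HE).
by congr E; apply/funext => w; rewrite mulrC.
Qed.

Lemma E_independent_le X psi s t (c : R) : 0 <= s -> s < t -> Lip0_le s X -> lip psi ->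
  (forall x : R, E (fun w => x * psi (B t w - B s w)) <= `|x| * c) ->
  0 <= c ->
  E (fun w => X w * psi (B t w - B s w)) <= c * E (fun w => `|X w|).
Proof.
move=> s0 st HX Lpsi Hc c0; rewrite E_independent //.
have Hpsi : Lip0 (fun w => psi (B t w - B s w)).
  by apply: (@Lip0_le_Lip0 _ _ t); [exact: le_trans (ltW st)|exact: Lip0_le_increment (ltW st) _].
have HX0 := Lip0_le_Lip0 s0 HX.
apply: (E_le1 HE) => //; last by move=> w; rewrite mulrC.
  under eq_fun do rewrite E_signed_scale //.
  by stable_tac HS.
by stable_tac HS.
Qed.

End Independence.

(** * B^a as an element of the completion *)

Section Brownian.
Variables (R : realType) (d : nat) (Gam : set 'M[R]_d).
Hypotheses (Gam_nonempty : Gam !=set0) (Gam_bounded : bounded_set Gam).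
Variables (E : (Omega R d -> R) -> R).
Hypothesis E_Gexp : G_expectation Gam E.
Variables (L1 : completeNormedModType R) (iota : (Omega R d -> R) -> L1).
Hypothesis HL : is_completion (@Lip0 R d) (fun X => E (fun w => `|X w|)) iota.
Variable a : 'cV[R]_d.
Local Notation sg := (sigma Gam (a *m a^T)).
Let HE := Gexp_sublinear E_Gexp.
Let HS := @Lip0_stable R d.
Implicit Types (s t : R).

Lemma B0 (w : Omega R d) : B 0 w = 0.
Proof. by case: w => w [cw w0]; rewrite /B /= w0. Qed.

Lemma Ba_cvg t : 0 <= t -> iota (incr a 0 t n) @[n --> \oo] --> Ba iota a t.
Proof.
move=> t0.
have Hi n : Lip0 (incr a 0 t n) by exact: Lip0_incr.
(* Multiplication by the constant 1 turns [vanish_mul] into the passage from mean-square Cauchy to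
   L1-Cauchy. *)
have V := vanish_mul HE Hi (fun _ => stable_cst HS 1)
  (vanish_incr Gam_nonempty Gam_bounded E_Gexp a (lexx 0) t0).
have [|P HP] := iota_cauchy_cvg HL Hi.
  have V0 : vanish (fun m n => E (fun w : Omega R d => (1 - 1 : R) ^+ 2)).
    move=> e e0; exists 0%N => m n _ _; rewrite (_ : (fun w => _) = fun=> 0) ?(E_cst HE) //.
    by apply/funext => w; rewrite subrr expr0n.
  apply: vanish_le (V V0) => m n; apply: (E_le HE); try by stable_tac HS.
  by move=> w; rewrite !mulr1.
pose u n := iota (fun w : Omega R d => trunc n%:R (dot a (B t w))).
suff uP : u @ \oo --> P.
  rewrite (_ : Ba iota a t = P) //.
  by apply: (@cvg_lim L1); [exact: norm_hausdorff|exact: uP].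
(* [Ba] truncates at level n, [incr] at n + 1. *)
rewrite -cvg_shiftS /=.
rewrite (_ : (fun n => u n.+1) = (fun n => iota (incr a 0 t n))) //.
by apply/funext => n; rewrite /= /u /incr; congr iota; apply/funext => w; rewrite B0 subr0.
Qed.

(** No error occurs while |x|, |y| <= c / 2. Otherwise one of the truncations is at least c / 2 in
    absolute value, and the trivial bound 3 c equals (12 / c) (c^2 / 4). The squares on the right
    are truncated too, so that [E] can be applied to them. *)
Lemma trunc_sub_le (c x y : R) : 0 < c ->
  `|trunc c x - trunc c y - trunc c (x - y)| <= 12 / c * (trunc c x ^+ 2 + trunc c y ^+ 2).
Proof.
move=> c0; have c00 := ltW c0.
have h3 : `|trunc c x - trunc c y - trunc c (x - y)| <= 3 * c.
  apply: le_trans (ler_normB _ _) _.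
  have := ler_normB (trunc c x) (trunc c y).
  by have := trunc_norm_le x c00; have := trunc_norm_le y c00; have := trunc_norm_le (x - y) c00; lra.
have big z : c / 2 < `|z| -> c ^+ 2 / 4 <= trunc c z ^+ 2.
  move=> zc; rewrite -[trunc c z ^+ 2]real_normK ?num_real //.
  rewrite (_ : c ^+ 2 / 4 = (c / 2) ^+ 2); last by field.
  rewrite ler_sqr ?nnegrE ?divr_ge0 //.
  have [zc'|zc'] := leP `|z| c; first by rewrite trunc_id // ltW.
  have := trunc_dist z c00; rewrite max_r; last by rewrite subr_ge0 ltW.
  by have := ler_normD (z - trunc c z) (trunc c z); rewrite subrK; lra.
have c12 : 0 <= 12 / c by rewrite divr_ge0.
have e3 : 12 / c * (c ^+ 2 / 4) = 3 * c by field; rewrite gt_eqF.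
have [xc|xc] := leP `|x| (c / 2); last first.
  apply: le_trans h3 _; rewrite -e3 ler_wpM2l // (le_trans (big _ xc)) //.
  by rewrite lerDl sqr_ge0.
have [yc|yc] := leP `|y| (c / 2); last first.
  apply: le_trans h3 _; rewrite -e3 ler_wpM2l // (le_trans (big _ yc)) //.
  by rewrite lerDr sqr_ge0.
have xyc : `|x - y| <= c by apply: le_trans (ler_normB _ _) _; lra.
have xc' : `|x| <= c by lra.
have yc' : `|y| <= c by lra.
rewrite !trunc_id // subrr normr0.
by rewrite mulr_ge0 // addr_ge0 // sqr_ge0.
Qed.

(** Independence concerns functions of the increment, so truncated increments must represent it
    rather than differences of truncations; the two differ by O(1 / n) in L1. *)
Lemma L2rep_Ba s t : 0 <= s -> s <= t ->
  L2rep E iota t (Ba iota a t - Ba iota a s) (incr a s t).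
Proof.
move=> s0 st; have t0 : 0 <= t by exact: le_trans st.
split; [by move=> n; exact: Lip0_le_incr| |exact: (vanish_incr Gam_nonempty Gam_bounded)].
have H1 : iota (incr a 0 t n) - iota (incr a 0 s n) @[n --> \oo] --> Ba iota a t - Ba iota a s.
  by apply: cvgB; exact: Ba_cvg.
have H2 : 12 * (sg * t + sg * s) * n.+1%:R^-1 @[n --> \oo] --> (0 : R).
  by rewrite -(mulr0 (12 * (sg * t + sg * s))); apply: cvgMl_tmp; exact: cvgn_inv.
apply: (cvgn_squeeze H1 H2) => n.
have It : Lip0 (incr a 0 t n) by exact: Lip0_incr.
have Is : Lip0 (incr a 0 s n) by exact: Lip0_incr.
have Ist : Lip0 (incr a s t n) by exact: Lip0_incr.
rewrite -(iotaB HL) // (iota_dist HL) //; last by stable_tac HS.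
have n0 : 0 < n.+1%:R :> R by rewrite ltr0n.
have e0 : 0 <= 12 / n.+1%:R :> R by rewrite divr_ge0.
apply: le_trans (_ : 12 / n.+1%:R * E (fun w => incr a 0 t n w ^+ 2) +
  12 / n.+1%:R * E (fun w => incr a 0 s n w ^+ 2) <= _).
  apply: (E_le2 HE) => //; try by stable_tac HS.
  move=> w; rewrite -mulrDr /incr B0 !subr0 dotBr.
  exact: trunc_sub_le.
have h1 := ler_wpM2l e0 (E_sqr_incr_le Gam_nonempty Gam_bounded E_Gexp a n (lexx 0) t0).
have h2 := ler_wpM2l e0 (E_sqr_incr_le Gam_nonempty Gam_bounded E_Gexp a n (lexx 0) s0).
apply: le_trans (lerD h1 h2) _; rewrite !subr0 -mulrDr.
by rewrite [12 / _ * _]mulrAC.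
Qed.

End Brownian.

Lemma vanish_near_le (R : realType) (D D' : nat -> nat -> R) :
  (exists N, forall m n, (N <= m)%N -> (N <= n)%N -> D m n <= D' m n) ->
  vanish D' -> vanish D.
Proof.
move=> [N0 DD'] H e /H[N HN]; exists (maxn N0 N) => m n; rewrite !geq_max.
move=> /andP[m0 m1] /andP[n0 n1].
by apply: le_lt_trans (DD' _ _ m0 n0) _; exact: HN.
Qed.

(** * One step of the integral *)

Section Step.
Variables (R : realType) (d : nat) (Gam : set 'M[R]_d).
Hypotheses (Gam_nonempty : Gam !=set0) (Gam_bounded : bounded_set Gam).
Variables (E : (Omega R d -> R) -> R).
Hypothesis E_Gexp : G_expectation Gam E.
Variables (L1 : completeNormedModType R) (iota : (Omega R d -> R) -> L1).
Hypothesis HL : is_completion (@Lip0 R d) (fun X => E (fun w => `|X w|)) iota.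
Variable a : 'cV[R]_d.
Local Notation sg := (sigma Gam (a *m a^T)).
Local Notation E2 := (E2 E iota).
Local Notation L2rep := (L2rep E iota).
Let HE := Gexp_sublinear E_Gexp.
Let HS := @Lip0_stable R d.
Variables (s t : R).
Hypotheses (s_ge0 : 0 <= s) (st : s < t).
Local Notation b := (incr a s t).
Local Notation inc := (Ba iota a t - Ba iota a s).

Let t_ge0 : 0 <= t := le_trans s_ge0 (ltW st).
Let ST := @lip_stable R 'cV[R]_d.
Let Hb n : Lip0 (b n) := Lip0_incr a n s_ge0 (ltW st).
Let sgD_ge0 : 0 <= sg * (t - s).
Proof. by rewrite mulr_ge0 ?sigma_ge0 // subr_ge0 ltW. Qed.

Lemma E_sqr_mul_incr_le (X : Omega R d -> R) n : Lip0_le s X ->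
  E (fun w => X w ^+ 2 * b n w ^+ 2) <= sg * (t - s) * E (fun w => X w ^+ 2).
Proof.
move=> HX; have L := @lip_trunc_dot R d a n.+1%:R (ler0n _ _).
have HSS := Lip0_le_stable d s_ge0.
rewrite (E_independent_ge0 E_Gexp (psi := fun x => trunc n.+1%:R (dot a x) ^+ 2) s_ge0 st); first last.
- by move=> x; exact: sqr_ge0.
- by move=> w; exact: sqr_ge0.
- by stable_tac ST.
- by stable_tac HSS.
rewrite mulrC; apply: ler_wpM2r.
  have HX0 := Lip0_le_Lip0 s_ge0 HX.
  by apply: (E_ge0 HE) => [|w]; [stable_tac HS|exact: sqr_ge0].
exact: E_sqr_incr_le (ltW st).
Qed.

Lemma E_independent_incr_le (X : Omega R d -> R) n : Lip0_le s X ->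
  E (fun w => X w * b n w) <= sg * (t - s) / n.+1%:R * E (fun w => `|X w|).
Proof.
move=> HX; have L := @lip_trunc_dot R d a n.+1%:R (ler0n _ _).
apply: (E_independent_le E_Gexp (psi := fun x => trunc n.+1%:R (dot a x)) s_ge0 st) => //.
  by move=> x; exact: (E_mul_incr_le Gam_nonempty Gam_bounded E_Gexp a x n s_ge0 (ltW st)).
by rewrite divr_ge0.
Qed.

(** A product of two elements of L_G^2 is in general only in L_G^1. Here independence factorizes the
    second moments of (Y m - Y n) b m and Y n (b m - b n), which makes the products mean-square
    Cauchy. *)
Lemma L2rep_mul_incr xi Y : L2rep s xi Y ->
  L2rep t (mulL iota xi inc) (fun n w => Y n w * b n w).
Proof.
move=> rY.
have rb := L2rep_Ba Gam_nonempty Gam_bounded E_Gexp HL a s_ge0 (ltW st).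
have HY n := L2rep_Lip0 n s_ge0 rY.
have HSS := Lip0_le_stable d s_ge0; have HST := Lip0_le_stable d t_ge0.
have inY := L2rep_in rY.
split.
- move=> n; have h1 := L2rep_in (L2rep_mono (ltW st) rY) n; have h2 := L2rep_in rb n.
  by stable_tac HST.
- exact: (L2rep_mul HE HL s_ge0 t_ge0 rY rb).
have [C [N [C0 HC]]] := E_sqr_bounded HE HY (L2rep_cauchy rY).
have c1 : 0 <= 2 * (sg * (t - s)) by rewrite mulr_ge0.
have c2 : 0 <= 2 * C by rewrite mulr_ge0.
apply: vanish_near_le (vanishD (vanishZ c1 (L2rep_cauchy rY)) (vanishZ c2 (L2rep_cauchy rb))).
exists N => m n Nm Nn.
have Lm := @lip_trunc_dot R d a m.+1%:R (ler0n _ _).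
have Ln := @lip_trunc_dot R d a n.+1%:R (ler0n _ _).
have Hd : Lip0_le s (fun w => Y m w - Y n w) by have := inY m; have := inY n => ? ?; stable_tac HSS.
apply: le_trans (_ : 2 * E (fun w => (Y m w - Y n w) ^+ 2 * b m w ^+ 2) +
   2 * E (fun w => Y n w ^+ 2 * (b m w - b n w) ^+ 2) <= _).
  have := HY m; have := HY n; have := Hb m; have := Hb n => ? ? ? ?.
  apply: (E_le2 HE) => //; try by stable_tac HS.
  move=> w; rewrite -!exprMn.
  have -> : Y m w * b m w - Y n w * b n w =
    (Y m w - Y n w) * b m w + Y n w * (b m w - b n w) by ring.
  have := sqr_ge0 ((Y m w - Y n w) * b m w - Y n w * (b m w - b n w)).
  by move: ((Y m w - Y n w) * b m w) (Y n w * (b m w - b n w)) => p q; lra.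
have h1 := E_sqr_mul_incr_le m Hd.
have h2 : E (fun w => Y n w ^+ 2 * (b m w - b n w) ^+ 2) <=
    C * E (fun w => (b m w - b n w) ^+ 2).
  rewrite (E_independent_ge0 E_Gexp
    (psi := fun x => (trunc m.+1%:R (dot a x) - trunc n.+1%:R (dot a x)) ^+ 2) s_ge0 st); first last.
  - by move=> x; exact: sqr_ge0.
  - by move=> w; exact: sqr_ge0.
  - by stable_tac ST.
  - by have := inY n => ?; stable_tac HSS.
  apply: ler_wpM2r; last exact: HC.
  have := Hb m; have := Hb n => ? ?.
  by apply: (E_ge0 HE) => [|w]; [stable_tac HS|exact: sqr_ge0].
by move: h1 h2; rewrite -!mulrA; lra.
Qed.

Lemma ito_step P xi : LG2_le iota s P -> LG2_le iota s xi ->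
  [/\ LG2_le iota t (P + mulL iota xi inc),
      EL E iota (P + mulL iota xi inc) = EL E iota P &
      E2 (P + mulL iota xi inc) <= E2 P + sg * (t - s) * E2 xi].
Proof.
move=> /(LG2_leP HE HL P s_ge0)[X rX] /(LG2_leP HE HL xi s_ge0)[Y rY].
have rZ := L2rep_mul_incr rY.
have HSS := Lip0_le_stable d s_ge0.
have inX := L2rep_in rX; have inY := L2rep_in rY.
have HX n := L2rep_Lip0 n s_ge0 rX; have HY n := L2rep_Lip0 n s_ge0 rY.
have rQ : L2rep t (P + mulL iota xi inc) (fun n w => X n w + Y n w * b n w).
  have := L2rep_lin HE HL 1 t_ge0 (L2rep_mono (ltW st) rX) rZ.
  rewrite scale1r; congr (L2rep _ _ _).
  by apply/funext => n; apply/funext => w; rewrite mul1r.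
have HQ n := L2rep_Lip0 n t_ge0 rQ.
have HYb n : Lip0 (fun w => Y n w * b n w) by have := Hb n => ?; stable_tac HS.
split; first by apply/(LG2_leP HE HL) => //; exists (fun n w => X n w + Y n w * b n w).
- have h1 := E_cvg HE HL HQ (L2rep_cvg rQ).
  apply: (cvgn_uniq h1).
  have h2 : sg * (t - s) * (n.+1%:R^-1 * `|iota (Y n)|) @[n --> \oo] --> (0 : R).
    rewrite -(mulr0 (sg * (t - s))); apply: cvgMl_tmp.
    rewrite -(mul0r `|xi|); apply: cvgM; first exact: cvgn_inv.
    by apply: cvg_norm; exact: L2rep_cvg rY.
  apply: (cvgn_squeeze (E_cvg HE HL HX (L2rep_cvg rX)) h2) => n.
  rewrite (iota_norm HL) // mulrA ler_distlC.
  (* Used for Y n and for - Y n: both E[Y b] and E[- Y b] are O(1 / n), which traps E[X + Y b] -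
     E[X] from both sides. *)
  have b1 := E_independent_incr_le n (inY n).
  have HNY : Lip0_le s (fun w => - Y n w) by have := inY n => ?; stable_tac HSS.
  have := E_independent_incr_le n HNY.
  under [X in _ <= _ * E X]eq_fun do rewrite normrN.
  rewrite (_ : (fun w => - Y n w * b n w) = (fun w => - (Y n w * b n w))) => [b2|]; last first.
    by apply/funext => w; rewrite mulNr.
  have HNYb : Lip0 (fun w => - (Y n w * b n w)) by have := HYb n => ?; stable_tac HS.
  have b3 := E_add HE (HX n) (HYb n).
  have b4 := E_add HE (HQ n) HNYb.
  rewrite (_ : (fun w => X n w + Y n w * b n w + - (Y n w * b n w)) = X n) in b4; last first.
    by apply/funext => w; rewrite addrK.
  move: b1 b2; move: (sg * (t - s) / n.+1%:R * E (fun w => `|Y n w|)) => q b1 b2.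
  by apply/andP; split; lra.
have h1 := L2rep_E2 HE HL t_ge0 rQ.
have rXY := L2rep_mul HE HL s_ge0 s_ge0 rX rY.
have HXY n : Lip0_le s (fun w => X n w * Y n w).
  by have := inX n; have := inY n => ? ?; stable_tac HSS.
(* The cross term is treated as [X n * Y n], a variable of the past, times the increment. Its L1
   norm converges, so the factor 1 / (n + 1) removes it in the limit. *)
have h2 : E (fun w => X n w ^+ 2) +
    2 * (sg * (t - s) * (n.+1%:R^-1 * `|iota (fun w => X n w * Y n w)|)) +
    sg * (t - s) * E (fun w => Y n w ^+ 2) @[n --> \oo]
  --> E2 P + 2 * (sg * (t - s) * (0 * `|mulL iota P xi|)) + sg * (t - s) * E2 xi.
  apply: cvgD; last by apply: cvgMl_tmp; exact: (L2rep_E2 HE HL s_ge0 rY).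
  apply: cvgD; first exact: (L2rep_E2 HE HL s_ge0 rX).
  apply: cvgMl_tmp; apply: cvgMl_tmp; apply: cvgM; first exact: cvgn_inv.
  exact: cvg_norm.
rewrite mul0r !mulr0 addr0 in h2.
apply: (cvgn_le_cvgn h1 h2) => n.
have HXYn := Lip0_le_Lip0 s_ge0 (HXY n).
rewrite (iota_norm HL) //.
have b1 := E_independent_incr_le n (HXY n).
have b2 := E_sqr_mul_incr_le n (inY n).
have b3 : E (fun w => (X n w + Y n w * b n w) ^+ 2) <=
    1 * E (fun w => X n w ^+ 2) + 2 * E (fun w => X n w * Y n w * b n w) +
    1 * E (fun w => Y n w ^+ 2 * b n w ^+ 2).
  have := HX n; have := HY n; have := Hb n => ? ? ?.
  apply: (E_le3 HE) => //; try by stable_tac HS.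
  by move=> w; rewrite -exprMn; lra.
by move: b1 b2 b3; rewrite -!mulrA; move: (n.+1%:R^-1 * _) => p; lra.
Qed.

End Step.

(** * The integral of simple processes *)

Section Partition.
Variable R : realType.
Implicit Types (t : nat -> R).

Definition increasing_upto (N : nat) t := forall k, (k < N)%N -> t k < t k.+1.

Lemma increasing_upto_le N t j k : increasing_upto N t -> (j <= k)%N -> (k <= N)%N -> t j <= t k.
Proof.
move=> tN; elim: k => [|k IH]; first by rewrite leqn0 => /eqP ->.
rewrite leq_eqVlt => /orP[/eqP -> //|]; rewrite ltnS => jk kN.
by apply: le_trans (IH jk (ltnW kN)) _; apply/ltW/tN.
Qed.

Lemma increasing_upto_lt N t j k : increasing_upto N t -> (j < k)%N -> (k <= N)%N -> t j < t k.
Proof.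
move=> tN jk kN; apply: lt_le_trans (increasing_upto_le tN jk kN).
by apply: tN; exact: leq_trans jk kN.
Qed.

Lemma locate N t (s : R) : t 0 <= s -> s < t N -> exists2 k, (k < N)%N & t k <= s < t k.+1.
Proof.
move=> t0s; elim: N => [|N IH] stN; first by move: stN; rewrite ltNge t0s.
have [tNs|/IH[k kN ks]] := leP (t N) s; first by exists N => //; rewrite tNs stN.
by exists k => //; exact: ltnW.
Qed.

(** Stated for any module, to serve both the L1-valued process and the scalar integrand of
    [int_E_sq]. *)
Lemma step_fun_in (V : lmodType R) N t (xi : nat -> V) (s : R) k :
  increasing_upto N t -> (k < N)%N -> t k <= s < t k.+1 ->
  \sum_(j < N) \1_(`[t j, t j.+1[ : set R) s *: xi j = xi k.
Proof.
move=> tN kN /andP[ks sk]; rewrite (bigD1 (Ordinal kN)) //= big1 ?addr0.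
  by rewrite indicE mem_set ?scale1r //= in_itv /= ks.
move=> j /eqP jk; rewrite indicE memNset ?scale0r //= in_itv /= => /andP[js sj].
have [lt|lt|eq] := ltngtP j k.
- have := increasing_upto_le tN lt (ltnW kN).
  by rewrite leNgt (le_lt_trans ks sj).
- have := increasing_upto_le tN lt (ltnW (ltn_ord j)).
  by rewrite leNgt (le_lt_trans js sk).
- by apply: jk; apply: val_inj.
Qed.

Lemma step_fun_out (V : lmodType R) N t (xi : nat -> V) (s : R) :
  increasing_upto N t -> ~ (t 0 <= s < t N) ->
  \sum_(j < N) \1_(`[t j, t j.+1[ : set R) s *: xi j = 0.
Proof.
move=> tN nst; apply: big1 => j _; rewrite indicE memNset ?scale0r //= in_itv /= => /andP[js sj].
apply: nst; rewrite (le_trans (increasing_upto_le tN (leq0n j) (ltnW (ltn_ord j))) js).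
exact: lt_le_trans sj (increasing_upto_le tN (ltn_ord j) _).
Qed.

Definition clip (lo hi r : R) := Num.max lo (Num.min hi r).

(** Cells that meet clip each other to the same interval, from max(lo, lo') to min(hi, hi'), whose
    left end is p; disjoint cells clip each other to a point. *)
Lemma clip_overlap (lo hi lo' hi' : R) : lo < hi -> lo' < hi' ->
  (exists p, [/\ lo <= p < hi, lo' <= p < hi', clip lo hi hi' = clip lo' hi' hi &
     clip lo hi lo' = clip lo' hi' lo]) \/
  (clip lo hi hi' = clip lo hi lo' /\ clip lo' hi' hi = clip lo' hi' lo).
Proof.
move=> h h'; have [ov|ov] := ltP (Num.max lo lo') (Num.min hi hi').
  left; exists (Num.max lo lo').
  move: ov; rewrite gt_max !lt_min => /andP[/andP[a1 a2] /andP[a3 a4]].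
  split; rewrite ?le_max ?lexx ?orbT /= ?gt_max ?a1 ?a2 ?a3 ?a4 ?h ?h' //.
    rewrite /clip minC [Num.max lo _]max_r; last by rewrite le_min !ltW.
    by rewrite max_r // le_min !ltW.
  by rewrite /clip (min_r (ltW a3)) (min_r (ltW a2)) maxC.
right; move: ov; rewrite le_max !ge_min => /orP[/orP[|ov]|/orP[ov|]].
- by move=> ov; move: h; rewrite ltNge ov.
- rewrite /clip; split.
    rewrite (min_r (le_trans ov (ltW h))) (max_l ov) max_l //.
    by rewrite ge_min (le_trans (ltW h') ov) orbT.
  rewrite (min_l (le_trans ov (ltW h))) (min_l ov).
  by [].
- rewrite /clip; split.
    rewrite (min_l (le_trans ov (ltW h'))) (min_l ov).
    by [].
  rewrite (min_r (le_trans ov (ltW h'))) (max_l ov) max_l //.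
  by rewrite ge_min (le_trans (ltW h) ov) orbT.
- by move=> ov; move: h'; rewrite ltNge ov.
Qed.

Lemma clip_bound (lo hi r : R) : lo <= hi -> lo <= clip lo hi r <= hi.
Proof. by move=> h; rewrite /clip le_max lexx /= ge_max h /= ge_min lexx. Qed.

Lemma clip_high (lo hi r : R) : lo <= hi -> hi <= r -> clip lo hi r = hi.
Proof. by move=> h hr; rewrite /clip (min_l hr) max_r. Qed.

Lemma clip_low (lo hi r : R) : lo <= hi -> r <= lo -> clip lo hi r = lo.
Proof. by move=> h hr; rewrite /clip (min_r (le_trans hr h)) max_l. Qed.

Lemma telescope_clip (V : zmodType) (f : R -> V) M (s : nat -> R) lo hi :
  lo <= hi -> s 0 <= lo -> hi <= s M ->
  f hi - f lo = \sum_(j < M) (f (clip lo hi (s j.+1)) - f (clip lo hi (s j))).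
Proof.
move=> h sl hs; rewrite -(big_mkord xpredT (fun j => f (clip lo hi (s j.+1)) - f (clip lo hi (s j)))).
rewrite (telescope_sumr (fun j => f (clip lo hi (s j)))) //.
by rewrite clip_high // clip_low.
Qed.

(** Needed for linear combinations: two different processes must be written over one grid before
    they can be added. *)
Lemma common_refinement (A B : seq R) (T : R) : 0 \in A -> T \in A ->
  (forall x, x \in A -> 0 <= x <= T) -> (forall x, x \in B -> 0 <= x <= T) ->
  exists M (r : nat -> R), [/\ r 0 = 0, r M = T, increasing_upto M r &
    forall x, x \in A ++ B -> exists2 i, (i <= M)%N & r i = x].
Proof.
move=> A0 AT HA HB; pose l := sort <=%R (undup (A ++ B)).
have meml x : (x \in l) = (x \in A ++ B) by rewrite mem_sort mem_undup.
have lbnd x : x \in l -> 0 <= x <= T.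
  by rewrite meml mem_cat => /orP[/HA|/HB].
have l0 : 0 \in l by rewrite meml mem_cat A0.
have lT : T \in l by rewrite meml mem_cat AT.
have sorted_l : sorted <%R l.
  by rewrite lt_sorted_uniq_le sort_uniq undup_uniq sort_le_sorted.
have : (0 < size l)%N by case: (l) l0.
case El : (size l) => [//|M] _.
have ltM (x : R) : x \in l -> (index x l <= M)%N by rewrite -ltnS -El index_mem.
have inc : increasing_upto M (nth 0 l).
  by move=> k kM; apply: (sorted_ltn_nth lt_trans 0 sorted_l); rewrite ?inE ?El // ltnW.
exists M, (nth 0 l); split => //.
- apply/eqP; rewrite eq_le.
  have /andP[-> _] : 0 <= nth 0 l 0 <= T by apply: lbnd; rewrite mem_nth // El.
  rewrite andbT -[leRHS](nth_index 0 l0).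
  exact: (increasing_upto_le inc (leq0n _) (ltM _ l0)).
- apply/eqP; rewrite eq_le.
  have /andP[_ ->] /= : 0 <= nth 0 l M <= T by apply: lbnd; rewrite mem_nth // El.
  rewrite -{1}(nth_index 0 lT).
  exact: (increasing_upto_le inc (ltM _ lT) (leqnn _)).
- move=> x; rewrite -meml => lx; exists (index x l); first exact: ltM.
  exact: nth_index.
Qed.

Lemma integral_step_fun N t (c : nat -> R) (T : R) : increasing_upto N t ->
  0 <= t 0 -> t N <= T -> (forall k, (k < N)%N -> 0 <= c k) ->
  \int[lebesgue_measure]_(s in `[0, T]) (\sum_(j < N) \1_(`[t j, t j.+1[ : set R) s * c j) =
  \sum_(j < N) (t j.+1 - t j) * c j.
Proof.
move=> tN t0 tT c0; rewrite /Rintegral.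
transitivity (fine (\sum_(j < N) ((t j.+1 - t j) * c j)%:E)%E); last by rewrite sumEFin.
congr fine.
under eq_integral do rewrite -sumEFin.
rewrite ge0_integral_sum //; first last.
- by move=> j x _; rewrite lee_fin mulr_ge0 ?c0.
- move=> j; apply/measurable_EFinP; apply: measurable_funM => //; exact: measurable_indic.
apply: eq_bigr => j _.
under eq_integral do rewrite mulrC EFinM.
rewrite ge0_integralZl_EFin //; first last.
- exact: c0.
- by apply/measurable_EFinP; exact: measurable_indic.
rewrite integral_indic // setIidl; last first.
  move=> x; rewrite /= !in_itv /= => /andP[h1 h2]; apply/andP; split.
    by apply: le_trans t0 (le_trans _ h1); exact: (increasing_upto_le tN (leq0n j) (ltnW (ltn_ord j))).
  apply: ltW; apply: lt_le_trans h2 (le_trans _ tT).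
  exact: (increasing_upto_le tN (ltn_ord j) (leqnn _)).
have H := @lebesgue_measure_itv R `[t j, t j.+1[%R.
apply: etrans (congr1 (fun x => (c j)%:E * x)%E H) _.
by rewrite /= lte_fin tN // -EFinB -EFinM mulrC.
Qed.

End Partition.

Section ItoIntegral.
Variables (R : realType) (d : nat) (Gam : set 'M[R]_d).
Hypotheses (Gam_nonempty : Gam !=set0) (Gam_bounded : bounded_set Gam).
Variables (E : (Omega R d -> R) -> R).
Hypothesis E_Gexp : G_expectation Gam E.
Variables (L1 : completeNormedModType R) (iota : (Omega R d -> R) -> L1).
Hypothesis HL : is_completion (@Lip0 R d) (fun X => E (fun w => `|X w|)) iota.
Variables (a : 'cV[R]_d) (T : R).
Hypothesis T_gt0 : 0 < T.
Local Notation sg := (sigma Gam (a *m a^T)).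
Local Notation E2 := (E2 E iota).
Local Notation rep := (simple_rep iota T).
Local Notation S := (ito iota a T).
Let HE := Gexp_sublinear E_Gexp.
Let T_ge0 := ltW T_gt0.
Implicit Types (N M : nat) (t s r : nat -> R) (xi : nat -> L1) (eta : R -> L1).

Lemma simple_rep_times N t xi eta : rep N t xi eta -> increasing_upto N t.
Proof. by case. Qed.

Lemma simple_rep_bound N t xi eta k : rep N t xi eta -> (k <= N)%N -> 0 <= t k <= T.
Proof.
case=> t0 tN tinc _ _ kN.
by rewrite -t0 -tN !(increasing_upto_le tinc).
Qed.

Lemma simple_rep_in N t xi eta k : rep N t xi eta -> (k < N)%N -> LG2_le iota T (xi k).
Proof.
move=> h kN; have /andP[tk0 tkT] := simple_rep_bound h (ltnW kN).
by case: h => _ _ _ Lxi _; apply: (LG2_le_mono HE HL tk0 tkT); exact: Lxi.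
Qed.

Lemma simple_rep_val N t xi eta k (s : R) : rep N t xi eta -> (k < N)%N ->
  t k <= s < t k.+1 -> eta s = xi k.
Proof. by case=> _ _ tinc _ -> kN ks; exact: step_fun_in. Qed.

Lemma simple_rep_out N t xi eta (s : R) : rep N t xi eta -> ~ (0 <= s < T) -> eta s = 0.
Proof. by case=> t0 tN tinc _ -> ns; apply: step_fun_out => //; rewrite t0 tN. Qed.

Lemma Ba_in (s : R) : 0 <= s <= T -> LG2_le iota T (Ba iota a s).
Proof.
move=> /andP[s0 sT]; apply: (LG2_le_mono HE HL s0 sT); apply/(LG2_leP HE HL) => //.
have r := L2rep_Ba Gam_nonempty Gam_bounded E_Gexp HL a (lexx 0) s0.
(* Since B starts at 0, B^a_s is its own increment from 0, so [L2rep_Ba] applies to it. *)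
have Ba0 : Ba iota a 0 = 0.
  have H : iota (incr a 0 0 n) @[n --> \oo] --> Ba iota a 0.
    exact: (Ba_cvg Gam_nonempty Gam_bounded E_Gexp HL).
  apply: (cvgn_uniq H); rewrite (_ : (fun n => _) = fun=> 0); first exact: cvg_cst.
  apply/funext => n; rewrite -(iota0 HE HL); congr iota.
  by apply/funext => w; rewrite /incr subrr dot0r trunc_id ?normr0.
by exists (incr a 0 s); rewrite Ba0 subr0 in r.
Qed.

Lemma Ba_sub_in (s t : R) : 0 <= s <= T -> 0 <= t <= T -> LG2_le iota T (Ba iota a t - Ba iota a s).
Proof. by move=> hs ht; apply: (LG2_leB HE HL T_ge0); exact: Ba_in. Qed.

(* Clipping one partition to the cells of the other makes the two double sums below
   agree cell by cell, with no common refinement. *)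
Lemma ito_sum_split N t xi eta M s zeta : rep N t xi eta -> rep M s zeta eta ->
  ito_sum iota a N t xi = \sum_(k < N) \sum_(j < M) mulL iota (xi k)
     (Ba iota a (clip (t k) (t k.+1) (s j.+1)) - Ba iota a (clip (t k) (t k.+1) (s j))).
Proof.
move=> ht hs; apply: eq_bigr => k _.
have tk : t k <= t k.+1 by apply/ltW/(simple_rep_times ht).
have /andP[tk0 _] := simple_rep_bound ht (ltnW (ltn_ord k)).
have /andP[_ tkT] := simple_rep_bound ht (ltn_ord k).
have [s0 sM _ _ _] := hs.
rewrite (telescope_clip (Ba iota a) (M := M) (s := s) tk) ?s0 ?sM //.
rewrite (mulL_sumr HE HL T_ge0) //; first exact: (simple_rep_in ht).
move=> j.
suff cl (p : R) : 0 <= clip (t k) (t k.+1) p <= T by exact: Ba_sub_in.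
by have /andP[h1 h2] := clip_bound p tk; rewrite (le_trans tk0 h1) (le_trans h2 tkT).
Qed.

Lemma ito_sum_unique N t xi M s zeta eta : rep N t xi eta -> rep M s zeta eta ->
  ito_sum iota a N t xi = ito_sum iota a M s zeta.
Proof.
move=> ht hs; rewrite (ito_sum_split ht hs) (ito_sum_split hs ht) exchange_big /=.
apply: eq_bigr => j _; apply: eq_bigr => k _.
have tk := simple_rep_times ht (ltn_ord k); have sj := simple_rep_times hs (ltn_ord j).
(* On cells that meet both coefficients are the value of eta at p; on disjoint cells both increments
   are 0. *)
case: (clip_overlap tk sj) => [[p [pt ps -> ->]]|[-> ->]].
  by rewrite -(simple_rep_val ht _ pt) // -(simple_rep_val hs _ ps).
rewrite !subrr (mulL0 HE HL T_ge0); last exact: (simple_rep_in ht).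
by rewrite (mulL0 HE HL T_ge0) //; exact: (simple_rep_in hs).
Qed.

Lemma ito_eq N t xi eta : rep N t xi eta -> S eta = ito_sum iota a N t xi.
Proof.
move=> ht; apply: xget_subset1; first by exists N, t, xi.
move=> _ _ [N1 [t1 [xi1 [h1 ->]]]] [N2 [t2 [xi2 [h2 ->]]]].
exact: (ito_sum_unique h1 h2).
Qed.

(** Membership at time [t k] is part of the induction because [ito_step] needs the partial sum to
    depend only on the path up to the left end point. *)
Lemma ito_sum_partial N t xi eta k : rep N t xi eta -> (k <= N)%N ->
  [/\ LG2_le iota (t k) (ito_sum iota a k t xi), EL E iota (ito_sum iota a k t xi) = 0 &
      E2 (ito_sum iota a k t xi) <= sg * \sum_(j < k) (t j.+1 - t j) * E2 (xi j)].
Proof.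
move=> ht; elim: k => [|k IH] kN.
  have /andP[t0 _] := simple_rep_bound ht kN.
  have r0 := L2rep0 HE HL t0.
  have H0 (n : nat) : Lip0 (fun _ : Omega R d => 0 : R) by exact: (L2rep_Lip0 n t0 r0).
  rewrite /ito_sum !big_ord0 mulr0; split; first exact: (LG2_le0 HE HL).
    apply: (cvgn_uniq (E_cvg HE HL H0 (L2rep_cvg r0))).
    by rewrite (E_cst HE); exact: cvg_cst.
  apply: (cvgn_le (N := 0) (L2rep_E2 HE HL t0 r0)) => n _.
  by rewrite (_ : (fun w => _) = fun=> 0) ?(E_cst HE) //; apply/funext => w; rewrite expr0n.
have [L E0 E2le] := IH (ltnW kN).
have /andP[tk0 _] := simple_rep_bound ht (ltnW kN).
have tk := simple_rep_times ht kN.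
have Lxi : LG2_le iota (t k) (xi k) by case: (ht) => _ _ _ h _; exact: h.
have [h1 h2 h3] := ito_step Gam_nonempty Gam_bounded E_Gexp HL a tk0 tk L Lxi.
rewrite /ito_sum big_ord_recr /= -/(ito_sum iota a k t xi); split => //.
  by rewrite h2.
apply: le_trans h3 _; rewrite [X in _ <= sg * X]big_ord_recr /=.
by rewrite [leRHS]mulrDr [sg * (_ * E2 _)]mulrA lerD2r.
Qed.

Lemma int_E_sqE N t xi eta : rep N t xi eta ->
  int_E_sq E iota T eta = \sum_(j < N) (t j.+1 - t j) * E2 (xi j).
Proof.
move=> ht; have [t0 tN tinc _ _] := ht.
(* The integral runs over the closed interval, and eta vanishes at T. *)
have E20 : E2 0 = 0.
  have r0 := L2rep0 HE HL T_ge0.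
  apply: (cvgn_uniq (L2rep_E2 HE HL T_ge0 r0)).
  rewrite (_ : (fun n => _) = fun=> 0); first exact: cvg_cst.
  apply/funext => n; rewrite (_ : (fun w => _) = fun=> 0) ?(E_cst HE) //.
  by apply/funext => w; rewrite expr0n.
rewrite -(@integral_step_fun R N t (fun j => E2 (xi j)) T) ?t0 ?tN //; last first.
  by move=> k kN; apply: (E2_ge0 HE HL T_ge0); exact: (simple_rep_in ht).
rewrite /int_E_sq; apply: eq_Rintegral => s _ /=.
have [sT|nsT] := pselect (0 <= s < T).
  have /andP[] := sT; rewrite -{1}t0 -{1}tN => s0 sN.
  have [k kN ks] := locate s0 sN.
  rewrite (simple_rep_val ht kN ks).
  exact/esym/(step_fun_in (V := R^o) (fun j => E2 (xi j)) tinc kN ks).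
rewrite (simple_rep_out ht nsT) -/(E2 0) E20; apply/esym.
by apply: (step_fun_out (V := R^o) (fun j => E2 (xi j)) tinc (s := s)); rewrite t0 tN.
Qed.

Lemma ito_props eta : MG20 iota T eta ->
  [/\ LG2_le iota T (S eta), EL E iota (S eta) = 0,
      E2 (S eta) <= sg * int_E_sq E iota T eta & 0 <= int_E_sq E iota T eta].
Proof.
move=> [N [t [xi ht]]]; rewrite (ito_eq ht) (int_E_sqE ht).
have [h1 h2 h3] := ito_sum_partial ht (leqnn N).
have [_ tN tinc _ _] := ht; rewrite tN in h1; split => //.
apply: sumr_ge0 => j _; rewrite mulr_ge0 //; first by rewrite subr_ge0 ltW // tinc.
by apply: (E2_ge0 HE HL T_ge0); exact: (simple_rep_in ht).
Qed.

(** The value of eta at [r k] is the xi j with t j <= r k, so it is known at time [r k] as well. *)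
Lemma simple_rep_refine N t xi eta M r : rep N t xi eta ->
  r 0 = 0 -> r M = T -> increasing_upto M r ->
  (forall k, (k <= N)%N -> exists2 i, (i <= M)%N & r i = t k) ->
  rep M r (fun k => eta (r k)) eta.
Proof.
move=> ht r0 rM rinc tr; have [t0 tN tinc Lxi _] := ht; split => //.
  move=> k kM.
  have rk0 : t 0 <= r k by rewrite t0 -r0 (increasing_upto_le rinc) // ltnW.
  have rkT : r k < t N by rewrite tN -rM (increasing_upto_lt rinc).
  have [j jN jk] := locate rk0 rkT; have /andP[tjr _] := jk.
  rewrite (simple_rep_val ht jN jk); apply: (LG2_le_mono HE HL _ tjr); last exact: Lxi.
  by have /andP[] := simple_rep_bound ht (ltnW jN).
apply/funext => s; have [sT|nsT] := pselect (0 <= s < T); last first.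
  rewrite (simple_rep_out ht nsT); apply/esym.
  by apply: (step_fun_out (fun k => eta (r k)) rinc); rewrite r0 rM.
have /andP[s0 sM] := sT; rewrite -{1}r0 in s0; rewrite -{1}rM in sM.
have [k kM ks] := locate s0 sM.
transitivity (eta (r k)); last exact/esym/(step_fun_in (fun k => eta (r k)) rinc kM ks).
have rk0 : t 0 <= r k by rewrite t0 -r0 (increasing_upto_le rinc) // ltnW.
have rkT : r k < t N by rewrite tN -rM (increasing_upto_lt rinc).
have [j jN jk] := locate rk0 rkT; rewrite (simple_rep_val ht jN jk).
apply: (simple_rep_val ht jN); have /andP[tjr rjt] := jk; have /andP[rks sr] := ks.
rewrite (le_trans tjr rks) /=; apply: lt_le_trans sr _.
(* No old time lies strictly inside a new cell: t (j + 1) is some r i with r k < r i, hence r (k +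
   1) <= r i. *)
have [i iM ri] := tr j.+1 jN; rewrite -ri; apply: (increasing_upto_le rinc) => //.
rewrite ltnNge; apply/negP => ik.
have := increasing_upto_le rinc ik (ltnW kM).
by rewrite ri leNgt rjt.
Qed.

Lemma simple_rep_common eta eta' : MG20 iota T eta -> MG20 iota T eta' ->
  exists M r, rep M r (fun k => eta (r k)) eta /\ rep M r (fun k => eta' (r k)) eta'.
Proof.
move=> [N [t [xi ht]]] [N' [t' [xi' ht']]].
have in_mkseq (u : nat -> R) n k : (k <= n)%N -> u k \in mkseq u n.+1.
  by move=> kn; apply: map_f; rewrite mem_iota.
have bnd n u zeta theta : rep n u zeta theta -> forall x, x \in mkseq u n.+1 -> 0 <= x <= T.
  move=> hu x /mapP[k]; rewrite mem_iota /= add0n => kn ->.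
  exact: (simple_rep_bound hu).
have [t0 tN _ _ _] := ht.
have [||M [r [r0 rM rinc Hr]]] :=
  common_refinement (A := mkseq t N.+1) (B := mkseq t' N'.+1) (T := T) _ _ (bnd _ _ _ _ ht) (bnd _ _ _ _ ht').
- by rewrite -{1}t0; exact: in_mkseq.
- by rewrite -{1}tN; exact: in_mkseq.
exists M, r; split.
  by apply: (simple_rep_refine ht) => // k kN; apply: Hr; rewrite mem_cat in_mkseq.
by apply: (simple_rep_refine ht') => // k kN; apply: Hr; rewrite mem_cat in_mkseq // orbT.
Qed.

Lemma simple_rep_lin (c : R) M r eta eta' :
  rep M r (fun k => eta (r k)) eta -> rep M r (fun k => eta' (r k)) eta' ->
  rep M r (fun k => c *: eta (r k) + eta' (r k)) (c *: eta + eta').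
Proof.
move=> h h'; have [r0 rM rinc L etaE] := h; have [_ _ _ L' etaE'] := h'; split => //.
  move=> k kM; have /andP[rk0 _] := simple_rep_bound h (ltnW kM).
  by apply: (LG2_le_lin HE HL) => //; [exact: L|exact: L'].
apply/funext => s; rewrite {1}etaE {1}etaE' /=.
rewrite [LHS](_ : _ = c *: (\sum_(k < M) \1_(`[r k, r k.+1[ : set R) s *: eta (r k)) +
  \sum_(k < M) \1_(`[r k, r k.+1[ : set R) s *: eta' (r k)) //.
rewrite scaler_sumr -big_split /=; apply: eq_bigr => k _.
by rewrite scalerDr !scalerA [c * _]mulrC.
Qed.

Lemma MG20_lin (c : R) eta eta' : MG20 iota T eta -> MG20 iota T eta' ->
  MG20 iota T (c *: eta + eta').
Proof.
move=> h h'; have [M [r [hr hr']]] := simple_rep_common h h'.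
by exists M, r, (fun k => c *: eta (r k) + eta' (r k)); exact: simple_rep_lin.
Qed.

Lemma ito_linear : linear_on (MG20 iota T) S.
Proof.
move=> c eta eta' h h'; have [M [r [hr hr']]] := simple_rep_common h h'.
rewrite (ito_eq (simple_rep_lin c hr hr')) (ito_eq hr) (ito_eq hr').
rewrite /ito_sum scaler_sumr -big_split /=; apply: eq_bigr => k _.
apply: (mulL_linl HE HL T_ge0).
- exact: (simple_rep_in hr (ltn_ord k)).
- exact: (simple_rep_in hr' (ltn_ord k)).
- by apply: Ba_sub_in; [exact: (simple_rep_bound hr (ltnW (ltn_ord k)))|
    exact: (simple_rep_bound hr (ltn_ord k))].
Qed.

Lemma MG20_sub eta eta' : MG20 iota T eta -> MG20 iota T eta' -> MG20 iota T (eta - eta').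
Proof. by move=> h h'; rewrite addrC -scaleN1r; exact: MG20_lin. Qed.

Lemma itoB eta eta' : MG20 iota T eta -> MG20 iota T eta' -> S (eta - eta') = S eta - S eta'.
Proof.
by move=> h h'; rewrite addrC -scaleN1r ito_linear // scaleN1r addrC.
Qed.

Local Notation nrm := (MG2_norm E iota T).

Lemma E2_ito_le eta : MG20 iota T eta -> E2 (S eta) <= sg * T * nrm eta ^+ 2.
Proof.
move=> /ito_props[_ _ h i0]; rewrite /MG2_norm sqr_sqrtr; last first.
  by rewrite mulr_ge0 // invr_ge0.
by rewrite -mulrA mulVKf // gt_eqF.
Qed.

Let sgT_ge0 : 0 <= sg * T.
Proof. by rewrite mulr_ge0 // sigma_ge0. Qed.

Lemma sqrt_mul_le (K c r : R) (x : R) : 0 <= K -> 0 <= r -> x <= c * K * r ^+ 2 -> 0 <= c ->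
  Num.sqrt x <= Num.sqrt (c * K) * r.
Proof.
move=> K0 r0 h c0; apply: le_trans (ler_wsqrtr h) _.
by rewrite sqrtrM ?mulr_ge0 // sqrtr_sqr ger0_norm.
Qed.

Lemma ito_continuous :
  seminorm_continuous_on (MG20 iota T) nrm (LG2_norm E iota) S.
Proof.
(* The summand 1 keeps c positive when [sigma] is 0. *)
move=> x hx e e0; pose c := Num.sqrt (1 * (sg * T)) + 1.
have c0 : 0 < c by rewrite ltr_wpDl // sqrtr_ge0.
exists (e / c); first by rewrite divr_gt0.
move=> y hy; rewrite -itoB // ltr_pdivlMr // => h.
have hyx := MG20_sub hy hx.
apply: le_lt_trans (sqrt_mul_le sgT_ge0 (sqrtr_ge0 _) _ ler01) _.
  by rewrite mul1r; exact: (E2_ito_le hyx).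
apply: le_lt_trans h; rewrite mulrC; apply: ler_wpM2l; first exact: sqrtr_ge0.
by rewrite /c lerDl.
Qed.

(** * Extension of the integral to M_G^2 *)

Variables (M2 : completeNormedModType R) (kappa : (R -> L1) -> M2).
Hypothesis HM : is_completion (MG20 iota T) nrm kappa.

(** The graph of the extension; a function is chosen from it once existence and uniqueness of p are
    known. *)
Definition ito_ext_rel (z : M2) (p : L1) := exists eta : nat -> R -> L1,
  [/\ forall n, MG20 iota T (eta n), kappa (eta n) @[n --> \oo] --> z &
      S (eta n) @[n --> \oo] --> p].

Lemma kappaB eta eta' : MG20 iota T eta -> MG20 iota T eta' ->
  kappa (eta - eta') = kappa eta - kappa eta'.
Proof.
by move=> h h'; rewrite addrC -scaleN1r (completion_linear HM) // scaleN1r addrC.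
Qed.

Lemma E2_ito_sub_le eta eta' : MG20 iota T eta -> MG20 iota T eta' ->
  E2 (S eta - S eta') <= sg * T * `|kappa eta - kappa eta'| ^+ 2.
Proof.
move=> h h'; rewrite -itoB // -kappaB // (completion_isometry HM); last exact: MG20_sub.
by apply: E2_ito_le; exact: MG20_sub.
Qed.

(** The L1 norm is below the mean-square norm, so the integral is Lipschitz into L1. The extension
    is built by completeness of L1, and its values are placed in L_G^2 afterwards. *)
Lemma ito_sub_le eta eta' : MG20 iota T eta -> MG20 iota T eta' ->
  `|S eta - S eta'| <= Num.sqrt (1 * (sg * T)) * `|kappa eta - kappa eta'|.
Proof.
move=> h h'; rewrite -[leLHS]ger0_norm // -sqrtr_sqr.
apply: sqrt_mul_le => //; rewrite mul1r; apply: le_trans _ (E2_ito_sub_le h h').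
apply: (sqr_norm_le_E2 HE HL T_ge0); rewrite -itoB //.
by have [] := ito_props (MG20_sub h h').
Qed.

Lemma ito_ext_exists z : exists p, ito_ext_rel z p.
Proof.
have cl : closure (kappa @` MG20 iota T) z by rewrite (completion_dense HM).
have /choice[eta Heta] : forall n : nat, exists eta : R -> L1,
    MG20 iota T eta /\ `|z - kappa eta| < n.+1%:R^-1.
  move=> n; have n0 : 0 < n.+1%:R^-1 :> R by rewrite invr_gt0.
  have [_ [eta h <-] hz] := (iffLR (closure_seqP _ _) cl) _ n0.
  by exists eta.
have h n : MG20 iota T (eta n) by have [] := Heta n.
have kz : kappa (eta n) @[n --> \oo] --> z.
  apply: (@cvgn_squeeze _ _ (fun=> z) _ _ (fun n => n.+1%:R^-1) (cvg_cst _) (@cvgn_inv R)).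
  by move=> n; apply: ltW; have [] := Heta n.
suff [p Sp] : exists p : L1, S (eta n) @[n --> \oo] --> p by exists p, eta.
pose c := Num.sqrt (1 * (sg * T)) + 1.
have c0 : 0 < c by rewrite ltr_wpDl // sqrtr_ge0.
apply: cvgn_cauchy => e e0; have ec : 0 < e / c / 2 by rewrite !divr_gt0.
have [N HN] := (iffLR (cvgnP _ _) kz) _ ec; exists N => m n Nm Nn.
apply: le_lt_trans (ito_sub_le (h m) (h n)) _.
have : `|kappa (eta m) - kappa (eta n)| < e / c.
  rewrite (_ : _ - _ = (z - kappa (eta n)) - (z - kappa (eta m))); last first.
    by rewrite opprB [RHS]addrC addrA subrK.
  by apply: le_lt_trans (ler_normB _ _) _; have := HN m Nm; have := HN n Nn; lra.
rewrite ltr_pdivlMr // => hh; apply: le_lt_trans hh.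
by rewrite mulrC ler_wpM2l // /c lerDl.
Qed.

Lemma ito_ext_unique z p q : ito_ext_rel z p -> ito_ext_rel z q -> p = q.
Proof.
move=> [eta [h kz Sp]] [eta' [h' kz' Sq]]; apply: (cvgn_uniq Sp).
have D : Num.sqrt (1 * (sg * T)) * `|kappa (eta' n) - kappa (eta n)| @[n --> \oo] --> (0 : R).
  rewrite -(mulr0 (Num.sqrt (1 * (sg * T)))); apply: cvgMl_tmp.
  by rewrite -(normr0 M2) -(subrr z); apply: cvg_norm; exact: cvgB.
by apply: (cvgn_squeeze Sq D) => n; exact: ito_sub_le.
Qed.

Lemma ito_ext_lin c z z' p p' : ito_ext_rel z p -> ito_ext_rel z' p' ->
  ito_ext_rel (c *: z + z') (c *: p + p').
Proof.
move=> [eta [h kz Sp]] [eta' [h' kz' Sp']]; exists (fun n => c *: eta n + eta' n); split.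
- by move=> n; exact: MG20_lin.
- rewrite (_ : (fun n => _) = (fun n => c *: kappa (eta n) + kappa (eta' n))).
    by apply: cvgD => //; exact: cvgZl_tmp.
  by apply/funext => n; rewrite (completion_linear HM).
- rewrite (_ : (fun n => _) = (fun n => c *: S (eta n) + S (eta' n))).
    by apply: cvgD => //; exact: cvgZl_tmp.
  by apply/funext => n; rewrite ito_linear.
Qed.

(** Any c > |z| eventually bounds the norms of the approximating processes, and the factor 2 is that
    of [LG2_closed]. *)
Lemma ito_ext_LG2 z p : ito_ext_rel z p ->
  LG2_le iota T p /\ forall c, `|z| < c -> E2 p <= 2 * (sg * T) * c ^+ 2.
Proof.
move=> [eta [h kz Sp]].
have L n : LG2_le iota T (S (eta n)) by have [] := ito_props (h n).
have V : vanish (fun m n => E2 (S (eta m) - S (eta n))).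
  have sq0 : `|z - kappa (eta n)| ^+ 2 @[n --> \oo] --> (0 : R).
    rewrite -(mulr0 (0 : R)) -{1}(normr0 M2) -{1}(normr0 M2) -(subrr z).
    under eq_cvg do rewrite expr2.
    by apply: cvgM; apply: cvg_norm; apply: cvgB => //; exact: cvg_cst.
  apply: vanish_le (vanishZ sgT_ge0 (vanishD (vanishZ (ler0n R 2) (vanish_cvgl sq0))
    (vanishZ (ler0n R 2) (vanish_cvgr sq0)))) => m n.
  apply: le_trans (E2_ito_sub_le (h m) (h n)) _; apply: ler_wpM2l => //.
  have : `|kappa (eta m) - kappa (eta n)| <= `|z - kappa (eta m)| + `|z - kappa (eta n)|.
    by rewrite [`|z - kappa (eta m)|]distrC; exact: ler_distD.
  have := normr_ge0 (kappa (eta m) - kappa (eta n)).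
  move: `|_ - _| `|_ - _| `|_ - _| => p1 p2 p3 h1 h2.
  have h3 : p3 ^+ 2 <= (p2 + p1) ^+ 2 by rewrite ler_sqr ?nnegrE // (le_trans h1).
  by have := sqr_ge0 (p2 - p1); move: h3; lra.
have [Lp Hp] := LG2_closed HE HL T_ge0 L Sp V; split => // c zc.
have c0 : 0 < c by apply: le_lt_trans zc.
have kn : `|kappa (eta n)| @[n --> \oo] --> `|z| by exact: cvg_norm.
have cz0 : 0 < c - `|z| by rewrite subr_gt0.
have [N HN] := (iffLR (cvgnP _ _) kn) _ cz0.
rewrite -mulrA; apply: (Hp _ N) => n /HN hn.
apply: le_trans (E2_ito_le (h n)) _; apply: ler_wpM2l => //.
rewrite -(completion_isometry HM) // ler_sqr ?nnegrE // ?(ltW c0) //.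
by move: hn; rewrite ltr_distl => /andP[]; lra.
Qed.

End ItoIntegral.

Theorem lemma33 (R : realType) (d : nat) (d_ge1 : (1 <= d)%N)
  (Gam : set 'M[R]_d) (Gam_nonempty : Gam !=set0) (Gam_bounded : bounded_set Gam)
  (Gam_closed : closed Gam)
  (E : (Omega R d -> R) -> R) (E_Gexp : G_expectation Gam E)
  (L1 : completeNormedModType R) (iota : (Omega R d -> R) -> L1)
  (L1_completion :
     is_completion (@Lip0 R d) (fun X => E (fun w => `|X w|)) iota)
  (T : R) (T_gt0 : 0 < T) (a : 'cV[R]_d)
  (M2 : completeNormedModType R) (kappa : (R -> L1) -> M2)
  (M2_completion : is_completion (MG20 iota T) (MG2_norm E iota T) kappa) :
  [/\ (* I is well defined by the formula, with values in L_G^2(H_T) *)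
      forall N t xi eta, simple_rep iota T N t xi eta ->
        ito iota a T eta = ito_sum iota a N t xi /\
        LG2_le iota T (ito iota a T eta),
      (* I is linear and continuous *)
      linear_on (MG20 iota T) (ito iota a T) /\
      seminorm_continuous_on (MG20 iota T) (MG2_norm E iota T)
        (LG2_norm E iota) (ito iota a T),
      (* I extends continuously to M_G^2(0,T) *)
      exists I : M2 -> L1,
        [/\ forall eta, MG20 iota T eta -> I (kappa eta) = ito iota a T eta,
            forall x, LG2_le iota T (I x),
            linear_on setT I &
            seminorm_continuous_on setT (fun x => `|x|) (LG2_norm E iota) I] &
      forall eta, MG20 iota T eta ->
        EL E iota (ito iota a T eta) = 0 /\
        EL E iota (sqL iota (ito iota a T eta)) <=
          sigma Gam (a *m a^T) * int_E_sq E iota T eta].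

Proof.
have HE := Gexp_sublinear E_Gexp.
have HL := L1_completion; have T_ge0 := ltW T_gt0.
have sgT_ge0 : 0 <= sigma Gam (a *m a^T) * T by rewrite mulr_ge0 // sigma_ge0.
split.
- move=> N t xi eta h; split.
    exact: (ito_eq Gam_nonempty Gam_bounded E_Gexp HL a T_gt0 h).
  have hM : MG20 iota T eta by exists N, t, xi.
  by have [] := ito_props Gam_nonempty Gam_bounded E_Gexp HL a T_gt0 hM.
- split; first exact: (ito_linear Gam_nonempty Gam_bounded E_Gexp HL a T_gt0).
  exact: (ito_continuous Gam_nonempty Gam_bounded E_Gexp HL a T_gt0).
- have /choice[I HI] := ito_ext_exists Gam_nonempty Gam_bounded E_Gexp HL a T_gt0 M2_completion.
  have uniq z p : ito_ext_rel iota a T kappa z p -> I z = p.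
    exact: (ito_ext_unique Gam_nonempty Gam_bounded E_Gexp HL T_gt0 M2_completion (HI z)).
  have lin : linear_on setT I.
    move=> c x y _ _; apply: uniq.
    exact: (ito_ext_lin Gam_nonempty Gam_bounded E_Gexp HL T_gt0 M2_completion c (HI x) (HI y)).
  exists I; split => //.
  + move=> eta h; apply: uniq; exists (fun _ => eta); split => //; exact: cvg_cst.
  + by move=> x; have [] := ito_ext_LG2 Gam_nonempty Gam_bounded E_Gexp HL T_gt0 M2_completion (HI x).
  + move=> x _ e e0; pose c := Num.sqrt (2 * (sigma Gam (a *m a^T) * T)) + 1.
    have c0 : 0 < c by rewrite ltr_wpDl // sqrtr_ge0.
    exists (e / c); first by rewrite divr_gt0.
    move=> y _ yx; have ec0 : 0 < e / c by rewrite divr_gt0.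
    (* By linearity it is enough to bound I at y - x, of norm below e / c: the mean-square norm is
       then at most sqrt(2 sigma T) e / c < e. *)
    have -> : I y - I x = I (y - x).
      by have := lin (-1) x y Logic.I Logic.I; rewrite !scaleN1r ![- _ + _]addrC.
    have [_ H] := ito_ext_LG2 Gam_nonempty Gam_bounded E_Gexp HL T_gt0 M2_completion (HI (y - x)).
    apply: le_lt_trans (sqrt_mul_le sgT_ge0 (ltW ec0) (H _ yx) (ler0n _ 2)) _.
    rewrite -[ltRHS](divfK (lt0r_neq0 c0)) mulrC ltr_pM2l // /c ltrDl.
    exact: ltr01.
- move=> eta h.
  by have [_ h1 h2 _] := ito_props Gam_nonempty Gam_bounded E_Gexp HL a T_gt0 h.
Qed.
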